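(* For every $p\in[1,\infty)$ there exists $C_p>0$ depending only on $p$ such that the following holds. Let $G=(V,E)$ be a connected graph which is either finite or infinite with bounded degrees, and consider the edge-averaging process $(f_t)_{t\ge0}$ on $G$ with i.i.d.\ initial opinions $\{f_0(v)\}_{v\in V}$ in $L^p$, with $\mu:=\mathbb{E}[f_0(v)]$. Then for every $t>0$ and every $o\in V$, $$\|f_t(o)-\mu\|_p\le C_p\,\|f_0(o)-\mu\|_p\cdot\begin{cases}t_*^{\frac{1-p}{2p}} & p\in[1,2),\\ t_*^{-1/4} & p\ge 2,\end{cases}$$ where $t_*:=\min(t,|V|^2)$ (so $t_*=t$ if $V$ is infinite). Moreover, if $V$ is infinite and $p\in[1,2)$, then $\|f_t(o)-\mu\|_p=o\big(t^{\frac{1-p}{2p}}\big)$ as $t\to\infty$.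
   Context: Edge-averaging process: each vertex $v\in V$ carries an opinion $f_t(v)\in\mathbb R$ at each time $t\ge 0$. Each edge carries an independent rate-one Poisson clock (clocks independent of the initial opinions). When the clock of edge $\{u,v\}$ rings at time $t$, both endpoints update to $f_t(u)=f_t(v)=\frac{f_{t-}(u)+f_{t-}(v)}{2}$, where $f_{t-}(u)=\lim_{s\uparrow t}f_s(u)$; other opinions are unchanged. $\|X\|_p=(\mathbb{E}|X|^p)^{1/p}$. *)

(* Defs.v *)
From HB Require Import structures.
From mathcomp Require Import all_boot all_order all_algebra.
From mathcomp Require Import all_classical all_reals all_analysis.
Set Implicit Arguments. Unset Strict Implicit. Unset Printing Implicit Defensive.
Import Order.TTheory GRing.Theory Num.Theory.
Import numFieldNormedType.Exports.
Local Open Scope classical_set_scope.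
Local Open Scope ring_scope.

Definition simple_graph (V : countType) (adj : rel V) : Prop :=
  (forall u v, adj u v = adj v u) /\ (forall v, ~~ adj v v).

Definition connected_graph (V : countType) (adj : rel V) : Prop :=
  forall u v : V, exists s : seq V, path adj u s /\ last u s = v.

Definition bounded_degree (V : countType) (adj : rel V) : Prop :=
  exists D : nat, forall (v : V) (s : seq V), uniq s -> all (adj v) s ->
    (size s <= D)%N.

Definition vcard (V : countType) (k : option nat) : Prop :=
  match k with
  | Some n => exists s : seq V, [/\ uniq s, forall v, v \in s & size s = n]
  | None => forall s : seq V, exists v, v \notin s
  end.

Definition tstar {R : realType} (k : option nat) (t : R) : R :=
  match k with
  | Some n => Num.min t ((n ^ 2)%N)%:R
  | None => t
  end.

(* canonical orientation of the undirected edge {u,v} (independent of the order) *)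
Definition edge_key (V : countType) (u v : V) : V * V :=
  if (pickle u < pickle v)%N then (u, v) else (v, u).

Definition mutually_independent {d} {T : measurableType d} {R : realType}
  (P : probability T R) (I : eqType) (J : set I) (X : I -> T -> R) : Prop :=
  forall (F : seq I) (B : I -> set R), uniq F -> (forall i, i \in F -> J i) ->
    (forall i, measurable (B i)) ->
    P (\big[setI/setT]_(i <- F) (X i @^-1` B i)) =
    (\prod_(i <- F) P (X i @^-1` B i))%E.

(* [ring u v s]: the clock of edge {u,v} rings at time s.
   [left_value g v t a]: g_s(v) = a for all s in (t - e, t), s >= 0, some e > 0
   (so a = g_{t-}(v)). *)
Definition left_value {R : realType} (V : Type) (g : R -> V -> R) (v : V) (t a : R) :=
  exists2 e : R, 0 < e & forall s, 0 <= s -> t - e < s -> s < t -> g s v = a.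

Definition averaging_path {R : realType} (V : countType) (adj : rel V)
  (ring : V -> V -> R -> Prop) (x0 : V -> R) (g : R -> V -> R) : Prop :=
  [/\ (forall v, g 0 v = x0 v),
      (forall v t, 0 <= t -> exists2 e : R, 0 < e &
          forall s, t <= s -> s < t + e -> g s v = g t v)
    & (forall v t, 0 < t -> exists a, left_value g v t a /\
          ((forall u, adj u v -> ~ ring u v t) -> g t v = a) /\
          (forall u b, adj u v -> ring u v t -> left_value g u t b ->
              g t v = (a + b) / 2))].

(* ring times of the edge with key e: partial sums of the inter-arrival times tau e k *)
Definition ring_time {R : realType} (V : Type) (tau : V * V -> nat -> R) (e : V * V) (n : nat) : R :=
  \sum_(k < n.+1) tau e k.

Definition rings {R : realType} (V : countType) (tau : V * V -> nat -> R) (u v : V) (s : R) : Prop :=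
  exists n, ring_time tau (edge_key u v) n = s.

(* index set for the independent family: initial opinions (inl v) and
   inter-arrival times (inr (e, k)) of the edges e = edge_key u v, u ~ v *)
Definition process_indices (V : countType) (adj : rel V) : set (V + (V * V * nat)) :=
  fun i => match i with
           | inl _ => True
           | inr (e, _) => adj e.1 e.2 /\ edge_key e.1 e.2 = e
           end.

(* Main.v *)
(** By duality [f_t o] is a combination of the initial opinions with random
    nonnegative weights of total mass one. Their squared norm [q] loses half the
    energy at the ringing edge at each ring; on a connected graph the Nash
    inequality bounds [q ^ 3] by the Dirichlet energy, so [E q^r] decays like
    [t ^ (- r / 2)] until it reaches the scale [|V|^(-r)]. Conditionally on the
    clocks, a moment inequality for sums of independent centred variables then
    gives the bound (for p < 2, after splitting the opinions at a level L, which
    also yields the little-o statement as L grows).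

    To reduce to finite sums, time is cut into slots of length 1/N and the
    exponential gaps are rounded down, which makes the slots i.i.d. Bernoulli,
    and the graph is cut to a finite window; the influence of the boundary has
    expectation exponentially small in the radius. Almost surely the slotted
    process agrees with the true one for large N, and Fatou's lemma passes to
    the limit. *)

Require Import Defs.
From HB Require Import structures.
From mathcomp Require Import all_boot all_order all_algebra.
From mathcomp Require Import all_classical all_reals all_analysis.
From mathcomp Require Import measurable_realfun.
From mathcomp Require Import ring lra zify.
Import Order.TTheory GRing.Theory Num.Theory.
Import numFieldNormedType.Exports.
Set Implicit Arguments. Unset Strict Implicit. Unset Printing Implicit Defensive.
Local Open Scope classical_set_scope.
Local Open Scope ring_scope.

(** * Power inequalities *)

(** The constant may depend on [p] only. The Nash inequality uses nothing but connectivity: a simple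
    path from a maximum to a minimum of the weights already carries enough energy. The degree bound
    enters only through the rate [kappa] at which boundary effects spread, and their total
    [exp (kappa t)] is beaten by a larger window at fixed [t]. Opinions are rounded to finitely many
    values as well, so every quantitative estimate is about a finite sum [iterE], and measure theory
    is confined to the passage to the limit.

    Fatou's lemma needs an integrand that bounds the true quantity from above for every fine mesh.
    Hence [|f_t - mu|^p] is first weakened to [min A (excess delta (f_t - mu))^p], the minimum being
    taken last: the cap [A] pays for the event that the boundary has reached [o], and the margin
    [delta] pays for rounding. The mesh is refined within a fixed window, then the window grows, and
    only then [A] tends to infinity and [delta] to [0]. *)

Lemma powR_bernoulli (R : realType) (s z : R) :
  1 <= s -> 0 <= z -> 1 + s * (z - 1) <= z `^ s.
Proof.
rewrite le_eqVlt => /orP[/eqP <- z0|s1 z0]; first by rewrite powRr1//; lra.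
have s0 : 0 < s by apply: lt_trans s1.
have t0 : 0 < (1 - s^-1)^-1 by rewrite invr_gt0 subr_gt0 invf_lt1.
(* Young's inequality for the product [z * 1]. *)
have := conjugate_powR z0 ler01 s0 t0.
rewrite invrK addrC subrK => /(_ erefl).
rewrite mulr1 powR1 mul1r => h.
have : s * z <= s * (z `^ s / s + (1 - s^-1)) by rewrite ler_pM2l.
rewrite mulrDr mulrCA divff ?gt_eqF// mulr1 mulrBr mulr1 divff ?gt_eqF//.
lra.
Qed.

(** Bernoulli's inequality at [x / y], rescaled. This tangent-line form of convexity is the source
    of the Jensen and Lipschitz estimates below. *)
Lemma powR_tangent (R : realType) (s x y : R) : 1 <= s -> 0 <= x -> 0 < y ->
  y `^ s + s * y `^ (s - 1) * (x - y) <= x `^ s.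
Proof.
move=> s1 x0 y0.
have /(powR_bernoulli s1) h : 0 <= x / y by rewrite divr_ge0// ltW.
have xE : x = (x / y) * y by rewrite divfK// gt_eqF.
rewrite {2}xE powRM ?(ltW y0)//; last by rewrite divr_ge0// ltW.
apply: le_trans (ler_wpM2r (powR_ge0 y s) h).
have -> : y `^ s = y * y `^ (s - 1) by rewrite mulr_powRB1 ?(ltW y0)//; lra.
rewrite le_eqVlt; apply/orP; left; apply/eqP.
by field; rewrite gt_eqF.
Qed.

Lemma powR_superadd (R : realType) (s x y : R) : 1 <= s -> 0 <= x -> 0 <= y ->
  x `^ s + y `^ s <= (x + y) `^ s.
Proof.
move=> s1 x0 y0.
have s0 : 0 < s by apply: lt_le_trans s1.
rewrite -(mulr_powRB1 x0 s0) -(mulr_powRB1 y0 s0) -(mulr_powRB1 (addr_ge0 x0 y0) s0).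
by rewrite mulrDl; apply: lerD; apply: ler_wpM2l => //; apply: ge0_ler_powR;
  rewrite ?subr_ge0 ?nnegrE ?addr_ge0 ?lerDl ?lerDr.
Qed.

(** Multiplying by [u] merges the upper bound on [(1 + u)^s - 1] for [u >= 0] with the lower bound
    for [u < 0]; the tangent inequality at [1 + u] calls for exactly this form. *)
Lemma powR_lipschitz1 (R : realType) (s : R) : 0 <= s -> exists2 C : R, 0 <= C &
  forall u : R, `|u| <= 2^-1 -> u * ((1 + u) `^ s - 1) <= C * u ^+ 2.
Proof.
move=> s0; exists (1 + s * 2 `^ s).
  by rewrite addr_ge0// mulr_ge0// powR_ge0.
move=> u; rewrite ler_norml => /andP[u1 u2].
have v0 : 0 < 1 + u by lra.
have D0 : 0 <= s * 2 `^ s by rewrite mulr_ge0// powR_ge0.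
have [u0|u0] := leP 0 u.
  suff h : (1 + u) `^ s - 1 <= (1 + s * 2 `^ s) * u.
    by rewrite expr2 mulrCA; apply: ler_wpM2l.
  have [s1|s1] := leP s 1.
    have : (1 + u) `^ s <= 1 + u by apply: ler1_powR => //; rewrite lerDl.
    nra.
  have := powR_tangent (ltW s1) ler01 v0; rewrite powR1.
  have : (1 + u) `^ (s - 1) <= 2 `^ s.
    apply: (@le_trans _ _ (2 `^ (s - 1))).
      by apply: ge0_ler_powR; rewrite ?nnegrE; lra.
    by apply: ler_powR; lra.
  have := powR_ge0 (1 + u) (s - 1).
  move: D0; set A := 2 `^ s; set B := (1 + u) `^ (s - 1); set E := (1 + u) `^ s.
  move=> D0 B0 BA h.
  have : s * B * u <= s * A * u by rewrite ler_wpM2r// ler_wpM2l// ltW.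
  nra.
suff h : 1 - (1 + u) `^ s <= (1 + s * 2 `^ s) * - u.
  have := @ler_wpM2l _ (- u) _ _ _ h; rewrite oppr_ge0 ltW// => /(_ isT).
  by rewrite expr2; lra.
have [s1|s1] := leP s 1.
  have : 1 + u <= (1 + u) `^ s by apply: ger1_powR => //; rewrite v0/=; lra.
  nra.
have h1 := powR_bernoulli (ltW s1) (ltW v0).
have : 2 <= 2 `^ s by apply: le1r_powR; lra.
move: h1 D0; set A := 2 `^ s; set E := (1 + u) `^ s => h1 D0 h2.
have : s * -u <= s * A * - u by rewrite ler_wpM2r//; nra.
nra.
Qed.

Lemma powR_quadratic (R : realType) (p : R) : 1 <= p -> exists2 C : R, 0 <= C &
  forall u : R, `|u| <= 2^-1 -> (1 + u) `^ p <= 1 + p * u + C * u ^+ 2.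
Proof.
move=> p1; have [|C C0 h] := @powR_lipschitz1 R (p - 1); first by lra.
have p0 : 0 <= p by lra.
exists (p * C); first exact: mulr_ge0.
move=> u uh; have {h} h := h _ uh.
move: uh; rewrite ler_norml => /andP[u1 u2].
have v0 : 0 < 1 + u by lra.
(* The tangent at [1 + u], evaluated at [1], gives [(1 + u)^p <= 1 + p u (1 + u)^(p-1)]. *)
have := powR_tangent p1 ler01 v0; rewrite powR1.
have := ler_wpM2l p0 h.
move: (_ `^ p) (_ `^ _) (u ^+ 2) => A B D; nra.
Qed.

(** A second-order Taylor bound while [b] is small against [a]; otherwise [|b|^p] dominates every
    other term. The witness [psi] is the derivative of [|a|^p], but only the linearity of
    [psi a * b] in [b] matters later: the term vanishes when a centred [b] is averaged. *)
Lemma powR_norm_expand (R : realType) (p : R) : 1 <= p ->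
  exists2 C : R, 0 < C & exists psi : R -> R, forall a b : R,
  `|a + b| `^ p <= `|a| `^ p + psi a * b +
    C * ((if `|b| <= `|a| / 2 then `|a| `^ (p - 2) * b ^+ 2 else 0) + `|b| `^ p).
Proof.
move=> p1; have [C C0 h] := powR_quadratic p1.
(* [C] serves the case [|b| <= |a| / 2]. In the other case [|a| < 2 |b|], so [3^p] controls
   [|a + b|^p] and [p 2^(p-1)] controls the linear term. *)
pose K := C + 3 `^ p + p * 2 `^ (p - 1).
have e0 : 0 <= p * 2 `^ (p - 1) by rewrite mulr_ge0 ?powR_ge0//; lra.
have e1 : 1 <= 3 `^ p by have : 3 <= 3 `^ p; [apply: le1r_powR|]; lra.
have p0 : 0 < p by lra.
have K1 : 1 <= K by rewrite /K; lra.
exists K; first by apply: lt_le_trans K1.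
exists (fun a => p * Num.sg a * `|a| `^ (p - 1)) => a b.
have pos (x y : R) : 0 < x -> `|x + y| `^ p <= x `^ p + p * x `^ (p - 1) * y +
    K * ((if `|y| <= x / 2 then x `^ (p - 2) * y ^+ 2 else 0) + `|y| `^ p).
  move=> x0; have yp := powR_ge0 `|y| p; have := normr_ge0 y.
  case: ifPn => [yx|].
    move=> _; have uh : `|y / x| <= 2^-1.
      by rewrite normrM normfV (gtr0_norm x0) ler_pdivrMr// mulrC.
    have hh := h _ uh.
    have v0 : 0 <= 1 + y / x by move: uh; rewrite ler_norml; lra.
    have -> : x + y = (1 + y / x) * x by field; rewrite gt_eqF.
    rewrite ger0_norm; last by rewrite mulr_ge0// ltW.
    rewrite powRM ?(ltW x0)//.
    have xE : x `^ p = x ^+ 2 * x `^ (p - 2).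
      rewrite -(powR_mulrn _ (ltW x0)) -powRD ?(gt_eqF x0) ?implybT//.
      by congr (_ `^ _); ring.
    have xE1 : x `^ (p - 1) = x * x `^ (p - 2).
      rewrite -{2}(powRr1 (ltW x0)) -powRD ?(gt_eqF x0) ?implybT//.
      by congr (_ `^ _); ring.
    apply: le_trans (ler_wpM2r (powR_ge0 _ _) hh) _.
    rewrite xE xE1; have X0 := powR_ge0 x (p - 2).
    have Ky : 0 <= K * `|y| `^ p by rewrite mulr_ge0//; lra.
    have CK : C <= K by rewrite /K; lra.
    have : 0 <= (K - C) * (x `^ (p - 2) * y ^+ 2).
      by apply: mulr_ge0; [rewrite subr_ge0|apply: mulr_ge0; [|exact: sqr_ge0]].
    move: (x `^ (p - 2)) X0 (`|y| `^ p) Ky => A A0 B Ky KA.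
    have -> : (1 + p * (y / x) + C * (y / x) ^+ 2) * (x ^+ 2 * A) =
       x ^+ 2 * A + p * (x * A) * y + C * (A * y ^+ 2).
      by field; rewrite gt_eqF.
    nra.
  rewrite -ltNge add0r => xy y0.
  have xy2 : x <= 2 * `|y| by move: xy; rewrite ltr_pdivrMr//; lra.
  have h1 : `|x + y| `^ p <= 3 `^ p * `|y| `^ p.
    rewrite -powRM//; apply: ge0_ler_powR; rewrite ?nnegrE//; try lra.
    by apply: le_trans (ler_normD _ _) _; rewrite (gtr0_norm x0); lra.
  have h2 : p * x `^ (p - 1) * - y <= p * 2 `^ (p - 1) * `|y| `^ p.
    rewrite -!mulrA; apply: ler_wpM2l; first lra.
    apply: (@le_trans _ _ ((2 * `|y|) `^ (p - 1) * `|y|)).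
      apply: (@le_trans _ _ (x `^ (p - 1) * `|y|)).
        by apply: ler_wpM2l; [exact: powR_ge0|rewrite -normrN ler_norm].
      apply: ler_wpM2r => //; apply: ge0_ler_powR; rewrite ?nnegrE//; try lra.
    rewrite powRM// -mulrA; apply: ler_wpM2l; first exact: powR_ge0.
    by rewrite mulrC mulr_powRB1.
  have h3 : 0 <= C * `|y| `^ p by rewrite mulr_ge0.
  have := powR_ge0 x p; move: h1 h2 h3; rewrite /K.
  by move: (x `^ p) (`|y| `^ p) => A B; nra.
have [a0|a0|->] := ltgtP a 0.
- have := pos (- a) (- b); rewrite oppr_gt0 -opprD !normrN => /(_ a0).
  rewrite (ltr0_norm a0) ltr0_sg// sqrrN.
  have -> // : p * -1 * (- a) `^ (p - 1) * b = p * (- a) `^ (p - 1) * - b by ring.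
- by have := pos a b a0; rewrite (gtr0_norm a0) gtr0_sg// mulr1.
- rewrite sgr0 mulr0 mul0r mul0r add0r normr0 mul0r.
  rewrite (_ : (if _ then _ else _) = 0); last first.
    by case: ifPn => //; rewrite normr_le0 => /eqP ->; rewrite expr0n mulr0.
  rewrite add0r powR0 ?gt_eqF// add0r.
  by rewrite add0r; have := ler_wpM2r (powR_ge0 `|b| p) K1; rewrite mul1r.
Qed.

(** For [p <= 2] the exponent [p - 2] is nonpositive, so [|b| <= |a|] gives [|a|^(p-2) b^2 <= |b|^p]
    and the quadratic term is absorbed. *)
Lemma powR_norm_expand_le2 (R : realType) (p : R) : 1 <= p -> p <= 2 ->
  exists2 C : R, 0 < C & exists psi : R -> R, forall a b : R,
  `|a + b| `^ p <= `|a| `^ p + psi a * b + C * `|b| `^ p.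
Proof.
move=> p1 p2; have [C C0 [psi h]] := powR_norm_expand p1.
exists (2 * C); first by rewrite mulr_gt0.
exists psi => a b; apply: le_trans (h a b) _; rewrite lerD2l.
rewrite (_ : 2 * C * _ = C * (`|b| `^ p + `|b| `^ p)); last by ring.
rewrite ler_pM2l// lerD2r; case: ifPn => ba; last exact: powR_ge0.
have [->|b0] := eqVneq b 0; first by rewrite expr0n mulr0 powR_ge0.
have nb : 0 < `|b| by rewrite normr_gt0.
have -> : `|b| `^ p = `|b| `^ (p - 2) * b ^+ 2.
  rewrite -real_normK ?num_real// -(powR_mulrn _ (normr_ge0 b)).
  by rewrite -powRD ?(gt_eqF nb) ?implybT//; congr (_ `^ _); ring.
apply: ler_wpM2r; first exact: sqr_ge0.
have na : `|b| <= `|a| by apply: le_trans ba _; have := normr_ge0 a; lra.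
rewrite -(opprB 2 p) !powRN lef_pV2 ?posrE ?powR_gt0//; last exact: lt_le_trans na.
by apply: ge0_ler_powR; rewrite ?nnegrE// subr_ge0.
Qed.

Lemma powR_norm_expand_ge2 (R : realType) (p : R) : 2 <= p ->
  exists2 C : R, 0 < C & exists psi : R -> R, forall a b : R,
  `|a + b| `^ p <= `|a| `^ p + psi a * b +
    C * (`|a| `^ (p - 2) * b ^+ 2 + `|b| `^ p).
Proof.
move=> p2; have p1 : 1 <= p by lra.
have [C C0 [psi h]] := powR_norm_expand p1.
exists C => //; exists psi => a b; apply: le_trans (h a b) _.
rewrite lerD2l ler_pM2l// lerD2r; case: ifPn => // _.
by rewrite mulr_ge0 ?powR_ge0 ?sqr_ge0.
Qed.

Lemma powRB2_mulr_sqr (R : realType) (p x : R) : 0 < p -> 0 <= x ->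
  x `^ (p - 2) * x ^+ 2 = x `^ p.
Proof.
move=> p0; rewrite le_eqVlt => /orP[/eqP <-|x0].
  by rewrite expr0n mulr0 powR0// gt_eqF.
rewrite -(powR_mulrn _ (ltW x0)) -powRD ?(gt_eqF x0) ?implybT//.
by congr (_ `^ _); ring.
Qed.

(** Split according to [b <= f a] with [f = min e 1], so that [f^2 <= e]; on the other side [a] is
    at most [b / f]. The free factor [e] lets the term in [a^p] be absorbed in an induction. *)
Lemma powR_young2 (R : realType) (p e : R) : 2 <= p -> 0 < e ->
  exists2 C : R, 0 <= C & forall a b : R, 0 <= a -> 0 <= b ->
  a `^ (p - 2) * b ^+ 2 <= e * a `^ p + C * b `^ p.
Proof.
move=> p2 e0; pose f := Num.min e 1.
have f0 : 0 < f by rewrite lt_min e0 ltr01.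
exists (f^-1 `^ (p - 2)); first exact: powR_ge0.
move=> a b a0 b0; have p0 : 0 < p by lra.
have [ba|ab] := leP b (f * a).
  apply: (@le_trans _ _ (e * a `^ p)); last first.
    by rewrite lerDl mulr_ge0 ?powR_ge0.
  rewrite -(powRB2_mulr_sqr p0 a0) (mulrCA e); apply: ler_wpM2l; first exact: powR_ge0.
  apply: (@le_trans _ _ ((f * a) ^+ 2)); first by rewrite ler_sqr ?nnegrE// mulr_ge0// ltW.
  rewrite exprMn; apply: ler_wpM2r; first exact: sqr_ge0.
  have fe : f <= e by rewrite ge_min lexx.
  have f1 : f <= 1 by rewrite ge_min lexx orbT.
  by rewrite expr2; nra.
apply: (@le_trans _ _ (f^-1 `^ (p - 2) * b `^ p)); last first.
  by rewrite lerDr mulr_ge0 ?powR_ge0 ?ltW.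
rewrite -(powRB2_mulr_sqr p0 b0) mulrA; apply: ler_wpM2r; first exact: sqr_ge0.
rewrite -powRM ?invr_ge0 ?(ltW f0)//.
apply: ge0_ler_powR; rewrite ?nnegrE ?subr_ge0//.
  by rewrite mulr_ge0// invr_ge0 ltW.
by rewrite ler_pdivlMl// ltW.
Qed.

(** * Iterated expectations and random linear combinations *)

(** The expectation of [F] over [n] i.i.d. draws from the finite law [w]. *)
Fixpoint iterE (R : realType) (S : finType) (w : S -> R) (n : nat)
    (F : seq S -> R) : R :=
  if n is n'.+1 then \sum_s w s * iterE w n' (fun l => F (s :: l)) else F [::].

Section iterE_theory.
Variables (R : realType) (S : finType) (w : S -> R).
Hypothesis w0 : forall s, 0 <= w s.
Implicit Types F G : seq S -> R.

Lemma eq_iterE n F G : (forall l, size l = n -> F l = G l) ->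
  iterE w n F = iterE w n G.
Proof.
elim: n F G => [|n ih] F G FG /=; first exact: FG.
by apply: eq_bigr => s _; congr (_ * _); apply: ih => l ln; apply: FG; rewrite /= ln.
Qed.

Lemma ler_iterE n F G : (forall l, size l = n -> F l <= G l) ->
  iterE w n F <= iterE w n G.
Proof.
elim: n F G => [|n ih] F G FG /=; first exact: FG.
by apply: ler_sum => s _; apply: ler_wpM2l => //; apply: ih => l ln; apply: FG; rewrite /= ln.
Qed.

Lemma iterED n F G : iterE w n (fun l => F l + G l) = iterE w n F + iterE w n G.
Proof.
elim: n F G => [//|n ih] F G /=.
by rewrite -big_split/=; apply: eq_bigr => s _; rewrite ih mulrDr.
Qed.

Lemma iterEZ n c F : iterE w n (fun l => c * F l) = c * iterE w n F.
Proof.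
elim: n F => [//|n ih] F /=.
by rewrite mulr_sumr; apply: eq_bigr => s _; rewrite ih mulrCA.
Qed.

Lemma iterE_sum n (I : finType) (F : I -> seq S -> R) :
  iterE w n (fun l => \sum_i F i l) = \sum_i iterE w n (F i).
Proof.
elim: n F => [//|n ih] F /=.
by rewrite exchange_big/=; apply: eq_bigr => s _; rewrite ih mulr_sumr.
Qed.

(** Averages the head conditionally on the tail. The dual weights and [lincomb] are built by
    recursion on the tail, so this is the form in which one more slot or one more variable is
    added. *)
Lemma iterES n F : iterE w n.+1 F = iterE w n (fun l => \sum_s w s * F (s :: l)).
Proof. by rewrite iterE_sum /=; apply: eq_bigr => s _; rewrite iterEZ. Qed.

Hypothesis w1 : \sum_s w s = 1.

Lemma iterE_cst n c : iterE w n (fun=> c) = c.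
Proof. by elim: n => [//|n ih] /=; rewrite -mulr_suml w1 mul1r. Qed.

End iterE_theory.

Fixpoint lincomb (R : realType) (A : Type) (x : A -> R) (m : nat -> R) (l : seq A) : R :=
  if l is a :: l' then m 0%N * x a + lincomb x (fun i => m i.+1) l' else 0.

(** An inequality of von Bahr-Esseen type: conditionally on the tail, the linear term of the
    expansion has mean zero, so each variable contributes only its own [p]-th moment. *)
Lemma iterE_lincomb_le2 (R : realType) (p : R) : 1 <= p -> p <= 2 ->
  exists2 C : R, 0 < C &
  forall (A : finType) (w x : A -> R), (forall a, 0 <= w a) -> \sum_a w a = 1 ->
    \sum_a w a * x a = 0 ->
  forall n (m : nat -> R), (forall i, 0 <= m i) ->
  iterE w n (fun l => `|lincomb x m l| `^ p) <=
  C * (\sum_(i < n) m i `^ p) * \sum_a w a * `|x a| `^ p.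
Proof.
move=> p1 p2; have p0 : p != 0 by rewrite gt_eqF//; lra.
have [C C0 [psi h]] := powR_norm_expand_le2 p1 p2.
exists C => // A w x w0 w1 x0.
elim=> [|n ih] m m0.
  by rewrite /= normr0 powR0// big_ord0 mulr0 mul0r.
rewrite iterES /= big_ord_recl/= [_ + \sum_(i < n) _]addrC mulrDr mulrDl.
set s := \sum_a w a * _.
apply: (@le_trans _ _ (iterE w n (fun l => `|lincomb x (fun i => m i.+1) l| `^ p
    + C * m 0%N `^ p * s))); last first.
  by rewrite iterED iterE_cst// lerD2r; exact: ih.
apply: ler_iterE => // l _; set S := lincomb _ _ l.
apply: (@le_trans _ _ (\sum_a w a * (`|S| `^ p + psi S * (m 0%N * x a) +
    C * (m 0%N `^ p * `|x a| `^ p)))).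
  apply: ler_sum => a _; apply: ler_wpM2l => //.
  by rewrite addrC; apply: le_trans (h _ _) _; rewrite normrM (ger0_norm (m0 _)) powRM.
under eq_bigr do rewrite !mulrDr.
rewrite !big_split/= -mulr_suml w1 mul1r.
rewrite [X in _ + X + _](_ : _ = psi S * m 0%N * \sum_a w a * x a); last first.
  by rewrite mulr_sumr; apply: eq_bigr => a _; ring.
rewrite x0 mulr0 addr0 lerD2l le_eqVlt; apply/orP; left; apply/eqP.
by rewrite /s mulr_sumr; apply: eq_bigr => a _; ring.
Qed.

(** An inequality of Marcinkiewicz-Zygmund type, by induction on the number of variables: the
    increment of the [p]-th moment caused by one more variable is compared with the increment of
    [(sum of squares)^(p/2)]. *)
Lemma iterE_lincomb_ge2 (R : realType) (p : R) : 2 <= p ->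
  exists2 C : R, 0 < C &
  forall (A : finType) (w x : A -> R), (forall a, 0 <= w a) -> \sum_a w a = 1 ->
    \sum_a w a * x a = 0 ->
  forall n (m : nat -> R), (forall i, 0 <= m i) -> 0 < \sum_(i < n) m i ^+ 2 ->
  iterE w n (fun l => `|lincomb x m l| `^ p) <=
  C * (\sum_(i < n) m i ^+ 2) `^ (p / 2) * \sum_a w a * `|x a| `^ p.
Proof.
move=> p2; have p0 : p != 0 by rewrite gt_eqF//; lra.
have [C C0 [psi h]] := powR_norm_expand_ge2 p2.
have e0 : 0 < (4 * C)^-1 by rewrite invr_gt0 mulr_gt0.
have [Ce Ce0 hy] := powR_young2 p2 e0.
(* Half of [K] times the increment of [D^(p/2)] must cover [K E / 4 + C Ce E], and the other half
   must cover [C m_0^p]. *)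
pose K := 4 * C * Ce + 2 * C.
have K0 : 0 < K by rewrite ltr_wpDl// ?mulr_gt0// mulr_ge0// mulr_ge0// ltW.
(* The shift [d > 0] keeps the sum of squares of the tail away from zero, where the induction
   divides by a power of it. Taking [d] equal to the whole sum costs the factor [2^(p/2)]. *)
suff main (A : finType) (w x : A -> R) : (forall a, 0 <= w a) -> \sum_a w a = 1 ->
    \sum_a w a * x a = 0 ->
  forall n (m : nat -> R) (d : R), (forall i, 0 <= m i) -> 0 < d ->
  iterE w n (fun l => `|lincomb x m l| `^ p) <=
  K * (d + \sum_(i < n) m i ^+ 2) `^ (p / 2) * \sum_a w a * `|x a| `^ p.
  exists (K * 2 `^ (p / 2)); first by rewrite mulr_gt0// powR_gt0.
  move=> A w x w0 w1 x0 n m m0 q0; apply: le_trans (main A w x w0 w1 x0 n m _ m0 q0) _.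
  set q := \sum_(i < n) _ in q0 *; have -> : q + q = 2 * q by ring.
  by rewrite powRM ?(ltW q0)// mulrA.
move=> w0 w1 x0; elim=> [|n ih] m d m0 d0.
  rewrite /= normr0 powR0// !mulr_ge0 ?powR_ge0 ?(ltW K0)//.
  by apply: sumr_ge0 => a _; rewrite mulr_ge0 ?powR_ge0.
rewrite iterES /= big_ord_recl/=.
set s := \sum_a w a * `|_| `^ _.
have s0 : 0 <= s by apply: sumr_ge0 => a _; rewrite mulr_ge0 ?powR_ge0.
pose D := d + \sum_(i < n) m i.+1 ^+ 2.
have D0 : 0 < D by rewrite ltr_pwDl// sumr_ge0// => i _; exact: sqr_ge0.
have -> : d + (m 0%N ^+ 2 + \sum_(i < n) m (lift ord0 i) ^+ 2) = D + m 0%N ^+ 2.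
  by rewrite /D; under eq_bigr do rewrite lift0; ring.
pose E := D `^ (p / 2 - 1) * m 0%N ^+ 2.
have E0 : 0 <= E by rewrite mulr_ge0 ?powR_ge0 ?sqr_ge0.
have Dp : 0 < D `^ (p / 2) by rewrite powR_gt0.
have step : iterE w n (fun l => \sum_a w a * `|m 0%N * x a +
      lincomb x (fun i => m i.+1) l| `^ p) <=
   iterE w n (fun l => (1 + C * (E * (4 * C)^-1 / D `^ (p / 2))) *
       `|lincomb x (fun i => m i.+1) l| `^ p
    + C * (E * Ce * s + m 0%N `^ p * s)).
  apply: ler_iterE => // l _; set S := lincomb _ _ l.
  apply: (@le_trans _ _ (\sum_a w a * (`|S| `^ p + psi S * (m 0%N * x a) +
    C * ((E * (4 * C)^-1 / D `^ (p / 2) * `|S| `^ p + E * Ce * `|x a| `^ p) +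
    m 0%N `^ p * `|x a| `^ p)))).
    apply: ler_sum => a _; apply: ler_wpM2l => //.
    rewrite addrC; apply: le_trans (h _ _) _; rewrite lerD2l ler_pM2l//.
    rewrite normrM (ger0_norm (m0 _)) powRM// lerD2r.
    (* Young's inequality is applied to [|S| / r] with [r = D^(1/2)], the natural size of [S], so
       that the coefficient of [|S|^p] is a relative increment [E / D^(p/2)]. *)
    have [r [r0 rp rp2]] : exists r, [/\ 0 < r, r `^ p = D `^ (p / 2) &
        r `^ (p - 2) = D `^ (p / 2 - 1)].
      exists (D `^ 2^-1); split; first by rewrite powR_gt0.
        by rewrite -powRrM mulrC.
      by rewrite -powRrM; congr (_ `^ _); field.
    have rV q : r^-1 `^ q = (r `^ q)^-1.
      by rewrite -(powR_inv1 (ltW r0)) powRAC powR_inv1// powR_ge0.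
    have Sr0 : 0 <= `|S| / r by rewrite divr_ge0// ltW.
    have := hy (`|S| / r) `|x a| Sr0 (normr_ge0 _).
    rewrite !powRM ?invr_ge0 ?(ltW r0)// !rV rp rp2.
    rewrite real_normK ?num_real// exprMn => hh.
    have D10 : 0 < D `^ (p / 2 - 1) by rewrite powR_gt0.
    have := ler_wpM2l E0 hh; rewrite /E.
    rewrite (_ : _ * (_ / _ * _) = `|S| `^ (p - 2) * (m 0%N ^+ 2 * x a ^+ 2)); last first.
      by field; rewrite gt_eqF.
    by move=> /le_trans; apply; rewrite le_eqVlt; apply/orP; left; apply/eqP; ring.
  under eq_bigr do rewrite !mulrDr.
  rewrite !big_split/= -!mulr_suml w1 !mul1r.
  rewrite [X in _ + X + _](_ : _ = psi S * m 0%N * \sum_a w a * x a); last first.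
    by rewrite mulr_sumr; apply: eq_bigr => a _; ring.
  rewrite x0 mulr0 addr0 le_eqVlt; apply/orP; left; apply/eqP.
  rewrite -(addrA (C * _)) -big_split/=.
  rewrite [X in _ + (_ + X)](_ : _ = C * (E * Ce * s + m 0%N `^ p * s)); last first.
    by rewrite mulrDr /s !mulr_sumr -big_split; apply: eq_bigr => a _ /=; ring.
  by move: (E / _ / _) => z; ring.
apply: le_trans step _; rewrite iterED iterE_cst// iterEZ.
have c0 : 0 <= 1 + C * (E / (4 * C) / D `^ (p / 2)).
  apply: addr_ge0 => //; apply: mulr_ge0; first exact: ltW.
  by apply: divr_ge0 (ltW Dp); apply: mulr_ge0 => //; apply: ltW.
have ih' := ler_wpM2l c0 (ih (fun i => m i.+1) d (fun i => m0 i.+1) d0).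
rewrite -/s -/D in ih'; apply: le_trans (lerD ih' (lexx _)) _.
have -> : (1 + C * (E / (4 * C) / D `^ (p / 2))) * (K * D `^ (p / 2) * s) =
   (K * D `^ (p / 2) + K * E / 4) * s.
  by field; rewrite !gt_eqF.
rewrite -mulrDl mulrA -mulrDl; apply: ler_wpM2r => //.
(* Two lower bounds on the increment of [D^(p/2)]: convexity pays for [E] and superadditivity pays
   for [m_0^p]. *)
have s1 : 1 <= p / 2 by lra.
have t1 := powR_tangent s1 (addr_ge0 (ltW D0) (sqr_ge0 (m 0%N))) D0.
have t2 := powR_superadd s1 (ltW D0) (sqr_ge0 (m 0%N)).
rewrite -(powR_mulrn _ (m0 0%N)) -powRrM mulrCA mulfV// mulr1 in t2.
rewrite addrAC subrr add0r -mulrA -/E in t1.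
have t3 : E <= p / 2 * E by rewrite ler_peMl.
have t4 := ler_wpM2l (ltW K0) t1.
have t5 := ler_wpM2l (ltW K0) t2.
have t6 := ler_wpM2l (ltW K0) t3.
have t7 : 0 <= C * m 0%N `^ p by rewrite mulr_ge0 ?powR_ge0 ?(ltW C0).
have t8 : 0 <= C * Ce * m 0%N `^ p by rewrite mulr_ge0 ?powR_ge0// mulr_ge0// ltW.
have t9 : 0 <= C * E by rewrite mulr_ge0// ltW.
move: t4 t5 t6 t7 t8 t9; rewrite powR_mulrn// /K.
move: (D `^ _) (_ `^ p) ((D + _) `^ _) => u1 u2 u3.
lra.
Qed.

(** * Averaging on a finite graph and the Nash inequality *)

(* A slot acts only if exactly one edge rings in it: in a fixed finite graph two
   rings eventually fall into distinct slots as the mesh is refined. *)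
Definition slot_step (I : finType) (X : Type) (f : I -> X -> X) (b : {set I}) (x : X) : X :=
  if [pick i | b == [set i]%SET] is Some i then f i x else x.

Definition slot_weight (R : realType) (I : finType) (p : R) (b : {set I}) : R :=
  \prod_i (if i \in b then p else 1 - p).

(** * One slot with independent edge rings *)

Section slots.
Variables (R : realType) (I : finType) (p : R).
Hypothesis p01 : 0 <= p <= 1.
Notation q := (p * (1 - p) ^+ #|I|.-1).

Lemma slot_step1 (X : Type) (f : I -> X -> X) (i : I) x : slot_step f [set i]%SET x = f i x.
Proof.
rewrite /slot_step; case: pickP => [j /eqP/set1_inj ->//|/(_ i)].
by rewrite eqxx.
Qed.

Lemma slot_weight_ge0 (b : {set I}) : 0 <= slot_weight p b.
Proof. by apply: prodr_ge0 => i _; case: ifP => _; case/andP: p01 => p0 p1; rewrite ?subr_ge0. Qed.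

Lemma slot_weight_sum1 : \sum_(b : {set I}) slot_weight p b = 1.
Proof.
transitivity (\prod_(i : I) (p + (1 - p))); last by apply: big1 => i _; ring.
by rewrite bigA_distr; apply: eq_bigl => b; rewrite inE.
Qed.

Lemma slot_weight1 (i : I) : slot_weight p [set i]%SET = q.
Proof.
rewrite /slot_weight (bigD1 i)//= inE eqxx; congr (_ * _).
rewrite (eq_bigr (fun=> 1 - p)); last by move=> j; rewrite inE => /negbTE ->.
rewrite prodr_const; congr (_ ^+ _).
by rewrite (cardD1 i I)/=; apply: eq_card => j; rewrite !inE andbT.
Qed.

(** A discrete generator: [p (1 - p)^(|I| - 1)] is the probability that a given edge rings alone,
    and every other outcome leaves [x] unchanged. *)
Lemma sum_slot_step (X : Type) (f : I -> X -> X) (F : X -> R) x :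
  \sum_(b : {set I}) slot_weight p b * F (slot_step f b x) =
  F x + q * \sum_i (F (f i x) - F x).
Proof.
have e : F x = \sum_(b : {set I}) slot_weight p b * F x.
  by rewrite -mulr_suml slot_weight_sum1 mul1r.
apply/eqP; rewrite addrC -subr_eq {1}e -sumrB.
under eq_bigr do rewrite -mulrBr.
rewrite (bigID (mem [set [set i]%SET | i in I]%SET))/= [X in _ + X]big1 ?addr0; last first.
  move=> b bP; rewrite /slot_step; case: pickP => [i /eqP bi|]; last by rewrite subrr mulr0.
  by move: bP; rewrite bi imset_f.
rewrite big_imset/=; last by move=> i j _ _; exact: set1_inj.
rewrite mulr_sumr; apply/eqP; apply: eq_big => [i|i _]; first by rewrite inE.
by rewrite slot_weight1 slot_step1.
Qed.

End slots.

Section averaging.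
Variables (R : realType) (W I : finType) (ends : I -> W * W).
Hypothesis ends_neq : forall i, (ends i).1 != (ends i).2.
Implicit Types m x : W -> R.

Definition average (i : I) m : W -> R := fun v =>
  if (v == (ends i).1) || (v == (ends i).2) then (m (ends i).1 + m (ends i).2) / 2 else m v.

Definition sqnorm m : R := \sum_v m v ^+ 2.

Definition energy m : R := \sum_i (m (ends i).1 - m (ends i).2) ^+ 2.

Definition prob_vec m : Prop := (forall v, 0 <= m v) /\ \sum_v m v = 1.

Lemma sum_ends (F : W -> R) i : \sum_v F v = F (ends i).1 + (F (ends i).2 +
  \sum_(v | (v != (ends i).1) && (v != (ends i).2)) F v).
Proof.
rewrite (bigD1 (ends i).1)//=; congr (_ + _).
by rewrite (bigD1 (ends i).2)//= eq_sym.
Qed.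

(** Averaging touches two coordinates. Symmetry, conservation of mass and the loss of squared norm
    are all instances of this one computation. *)
Lemma average_sum i (F G : R -> W -> R) m :
  (forall v, v != (ends i).1 -> v != (ends i).2 -> F (average i m v) v = G (m v) v) ->
  \sum_v F (average i m v) v - \sum_v G (m v) v =
  F ((m (ends i).1 + m (ends i).2) / 2) (ends i).1 +
  F ((m (ends i).1 + m (ends i).2) / 2) (ends i).2 -
  (G (m (ends i).1) (ends i).1 + G (m (ends i).2) (ends i).2).
Proof.
move=> FG; rewrite (sum_ends _ i) [X in _ - X](sum_ends _ i).
rewrite {1 2}/average !eqxx orbT/=.
rewrite (eq_bigr (fun v => G (m v) v)) => [|v /andP[v1 v2]]; last exact: FG.
ring.
Qed.

Lemma averageE i m v : v != (ends i).1 -> v != (ends i).2 -> average i m v = m v.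
Proof. by rewrite /average => /negbTE -> /negbTE ->. Qed.

Lemma average_sym i m x : \sum_v average i m v * x v = \sum_v m v * average i x v.
Proof.
have h1 := @average_sum i (fun a v => a * x v) (fun a v => a * x v) m.
have h2 := @average_sum i (fun a v => m v * a) (fun a v => m v * a) x.
have /eqP := h1 (fun v v1 v2 => congr1 (fun a => a * x v) (averageE m v1 v2)).
have /eqP := h2 (fun v v1 v2 => congr1 (fun a => m v * a) (averageE x v1 v2)).
by rewrite !subr_eq => /eqP -> /eqP ->; field.
Qed.

Lemma average_prob i m : prob_vec m -> prob_vec (average i m).
Proof.
move=> [m0 m1]; split=> [v|].
  by rewrite /average; case: ifP => // _; rewrite divr_ge0// addr_ge0.
have /eqP := @average_sum i (fun a v => a) (fun a v => a) m (averageE m).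
by rewrite subr_eq m1 => /eqP ->; field.
Qed.

Lemma sqnorm_average i m :
  sqnorm (average i m) = sqnorm m - (m (ends i).1 - m (ends i).2) ^+ 2 / 2.
Proof.
have h := @average_sum i (fun a v => a ^+ 2) (fun a v => a ^+ 2) m.
have /eqP := h (fun v v1 v2 => congr1 (fun a => a ^+ 2) (averageE m v1 v2)).
by rewrite subr_eq => /eqP; rewrite /sqnorm => ->; field.
Qed.

Lemma sqnorm_ge0 m : 0 <= sqnorm m.
Proof. by apply: sumr_ge0 => v _; exact: sqr_ge0. Qed.

Lemma slot_step_prob b m : prob_vec m -> prob_vec (slot_step average b m).
Proof. by rewrite /slot_step; case: pickP => // i _; exact: average_prob. Qed.

Lemma slot_step_sym b m x :
  \sum_v slot_step average b m v * x v = \sum_v m v * slot_step average b x v.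
Proof. by rewrite /slot_step; case: pickP => // i _; exact: average_sym. Qed.

(** Each averaging is symmetric, so transposing their product reverses the order: opinions run
    through the slots forwards and weights run backwards, whence [foldr]. *)
Lemma foldl_average_dual (l : seq {set I}) m x :
  \sum_v m v * foldl (fun x b => slot_step average b x) x l v =
  \sum_v foldr (slot_step average) m l v * x v.
Proof. by elim: l x => [//|b l ih] x /=; rewrite ih slot_step_sym. Qed.

Lemma foldr_prob m (l : seq {set I}) :
  prob_vec m -> prob_vec (foldr (slot_step average) m l).
Proof. by move=> m1; elim: l => //= b l; exact: slot_step_prob. Qed.

Lemma sqnorm_lb m : prob_vec m -> #|W|%:R^-1 <= sqnorm m.
Proof.
move=> [m0 m1]; have W0 : (0 < #|W|)%N.
  case: (posnP #|W|) => // W0; move: m1; rewrite big1 => [/eqP|v]; first by rewrite eq_sym oner_eq0.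
  by have := card0_eq W0 v; rewrite inE.
have n0 : 0 < #|W|%:R :> R by rewrite ltr0n.
have : 0 <= \sum_v (m v - #|W|%:R^-1) ^+ 2 by apply: sumr_ge0 => v _; exact: sqr_ge0.
have -> : \sum_v (m v - #|W|%:R^-1) ^+ 2 = sqnorm m - 2 * #|W|%:R^-1 * \sum_v m v + #|W|%:R * #|W|%:R^-1 ^+ 2.
  rewrite (eq_bigr (fun v => m v ^+ 2 + (- (2 * #|W|%:R^-1) * m v + #|W|%:R^-1 ^+ 2))).
    by rewrite !big_split/= -mulr_sumr sumr_const mulNr addrA -(mulr_natl (_ ^+ 2)).
  by move=> v _; ring.
by rewrite m1 expr2 mulVKf ?gt_eqF//; lra.
Qed.

Definition edge_rel : rel W := fun u v => [exists i, (ends i == (u, v)) || (ends i == (v, u))].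

Lemma ordered_energy m :
  \sum_(a : W * W | edge_rel a.1 a.2) (m a.1 - m a.2) ^+ 2 <= 2 * energy m.
Proof.
apply: (@le_trans _ _ (\sum_(a : W * W) \sum_i
   ((if ends i == a then (m a.1 - m a.2) ^+ 2 else 0) +
    (if ends i == (a.2, a.1) then (m a.1 - m a.2) ^+ 2 else 0)))).
  rewrite [leRHS](bigID (fun a => edge_rel a.1 a.2))/= -[leLHS]addr0 lerD//.
    apply: ler_sum => -[u v]/= /existsP[i] /orP h.
    rewrite (bigD1 i)//= -[leLHS]addr0 lerD//; last first.
      by apply: sumr_ge0 => j _; rewrite addr_ge0//; case: ifP => // _; exact: sqr_ge0.
    case: h => ->; first by rewrite lerDl; case: ifP => // _; exact: sqr_ge0.
    by rewrite lerDr; case: ifP => // _; exact: sqr_ge0.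
  by apply: sumr_ge0 => a _; apply: sumr_ge0 => j _; rewrite addr_ge0//; case: ifP => // _; exact: sqr_ge0.
rewrite exchange_big/= /energy mulr_sumr; apply: ler_sum => i _.
rewrite big_split/= (bigD1 (ends i))//= eqxx big1 ?addr0; last first.
  by move=> a; rewrite eq_sym => /negbTE ->.
rewrite (bigD1 ((ends i).2, (ends i).1))//= -surjective_pairing eqxx big1 ?addr0; last first.
  move=> [a1 a2] /= an; case: ifP => // /eqP ei; move: an; rewrite ei/= eqxx//.
by rewrite le_eqVlt; apply/orP; left; apply/eqP; ring.
Qed.

Lemma ler_sum_uniq (T : finType) (P : pred T) (F : T -> R) (s : seq T) :
  uniq s -> all P s -> (forall a, 0 <= F a) -> \sum_(a <- s) F a <= \sum_(a | P a) F a.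
Proof.
move=> us Ps F0; rewrite big_uniq//= [leRHS](bigID (mem s))/= -[leLHS]addr0 lerD//.
  rewrite le_eqVlt; apply/orP; left; apply/eqP; apply: eq_bigl => a.
  by case: (boolP (a \in s)) => [/(allP Ps) ->|]; rewrite ?andbF.
exact: sumr_ge0.
Qed.

Hypothesis conn : forall u v : W, connect edge_rel u v.

(* Telescoping [m^2] along a simple path from a maximum to a minimum of [m]. *)
Lemma nash m : prob_vec m -> 2 / #|W|%:R <= sqnorm m -> sqnorm m ^+ 3 <= 16 * energy m.
Proof.
move=> mp; have [m0 m1] := mp.
have Qn := sqnorm_lb mp; set Q := sqnorm m in Qn *; move=> Q2.
have W0 : (0 < #|W|)%N.
  case: (posnP #|W|) => // W0; move: m1; rewrite big1 => [/eqP|v]; first by rewrite eq_sym oner_eq0.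
  by have := card0_eq W0 v; rewrite inE.
have n0 : 0 < #|W|%:R :> R by rewrite ltr0n.
have Q0 : 0 < Q by apply: lt_le_trans Qn; rewrite invr_gt0.
have [w0 _] : exists w0 : W, true by case/card_gt0P: W0 => w _; exists w.
have [a _ aP] := @Order.TotalTheory.arg_maxP _ _ _ w0 xpredT m isT.
have [b _ bP] := @Order.TotalTheory.arg_minP _ _ _ w0 xpredT m isT.
(* [Q] is the average of [m] under the probability vector [m], hence at most its maximum; likewise
   the minimum is at most the uniform average. *)
have Qa : Q <= m a.
  rewrite -[leRHS]mulr1 -m1 mulr_sumr; apply: ler_sum => v _.
  by rewrite expr2; apply: ler_wpM2r => //; exact: aP.
have bn : m b <= #|W|%:R^-1.
  rewrite -[leRHS]mul1r ler_pdivlMr// -[leRHS]m1 mulr_natr -sumr_const.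
  by apply: ler_sum => v _; exact: bP.
have /connectP[s0 ps0 bs0] := conn a b.
(* On a simple path no vertex and no ordered edge is repeated, so sums along it are bounded by [Q]
   and by twice the energy. *)
move: bs0; case/shortenP: ps0 => s ps us _ bs0.
pose L := zip (belast a s) s.
(* Each telescoping term factors as [(m a - m c) (m a + m c)]; the arithmetic-geometric inequality
   is applied with a free parameter [l]. *)
have tele (l : R) : 0 < l -> m a ^+ 2 - m b ^+ 2 <=
  l / 2 * \sum_(c <- L) (m c.1 - m c.2) ^+ 2 + (2 * l)^-1 * \sum_(c <- L) (m c.1 + m c.2) ^+ 2.
  move=> l0; rewrite bs0 /L {ps us L bs0}; elim: s a {aP Qa} => [|c s ih] a /=.
    by rewrite !big_nil subrr !mulr0 addr0.
  rewrite !big_cons/=.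
  have := ih c; set x1 := \sum_(_ <- _) _; set x2 := \sum_(_ <- _) _ => h.
  have h2 : m a ^+ 2 - m c ^+ 2 <= l / 2 * (m a - m c) ^+ 2 + (2 * l)^-1 * (m a + m c) ^+ 2.
    have h2 := sqr_ge0 (l * (m a - m c) - (m a + m c)).
    have l2 : 0 < 2 * l by rewrite mulr_gt0.
    rewrite -(ler_pM2l l2) [leRHS]mulrDr mulVKf ?gt_eqF ?mulr_gt0//.
    have -> : 2 * l * (l / 2 * (m a - m c) ^+ 2) = (l * (m a - m c)) ^+ 2 by field.
    by move: h2; nra.
  by lra.
have szE : size (belast a s) = size s by rewrite size_belast.
have uL : uniq L by apply: zip_uniqr; move: us => /= /andP[].
have L1 : \sum_(c <- L) (m c.1 - m c.2) ^+ 2 <= 2 * energy m.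
  apply: le_trans (ordered_energy m).
  apply: ler_sum_uniq => //; last by move=> c; exact: sqr_ge0.
  rewrite /L; elim: s a ps {us aP Qa tele szE uL L bs0} => //= c s ih a /andP[ac cs].
  by rewrite ac/= ih.
have sq1 (r : seq W) : uniq r -> \sum_(c <- r) m c ^+ 2 <= Q.
  by move=> ur; apply: (@ler_sum_uniq _ xpredT) => //; [apply/allP|move=> c; exact: sqr_ge0].
have L2 : \sum_(c <- L) (m c.1 + m c.2) ^+ 2 <= 4 * Q.
  apply: (@le_trans _ _ (2 * \sum_(c <- L) m c.1 ^+ 2 + 2 * \sum_(c <- L) m c.2 ^+ 2)).
    rewrite !mulr_sumr -big_split/=; apply: ler_sum => c _.
    by have := sqr_ge0 (m c.1 - m c.2); nra.
  have -> : \sum_(c <- L) m c.1 ^+ 2 = \sum_(c <- belast a s) m c ^+ 2.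
    by rewrite -[in RHS](unzip1_zip (s := belast a s) (t := s)) ?szE// big_map.
  have -> : \sum_(c <- L) m c.2 ^+ 2 = \sum_(c <- s) m c ^+ 2.
    by rewrite -[in RHS](unzip2_zip (s := belast a s) (t := s)) ?szE// big_map.
  have h1 := sq1 (belast a s); have h2 := sq1 s.
  have {}h1 : \sum_(c <- belast a s) m c ^+ 2 <= Q.
    by apply: h1; move: us; rewrite lastI rcons_uniq => /andP[].
  have {}h2 : \sum_(c <- s) m c ^+ 2 <= Q by apply: h2; move: us => /= /andP[].
  lra.
(* With this [l] the sum of the [(m a + m c)^2] costs [3/8 Q^2], half of the total drop [3/4 Q^2];
   the drop follows from [m a >= Q] and [m b <= 1 / |W| <= Q / 2]. *)
have l0 : 0 < 16 / (3 * Q) by rewrite divr_gt0// mulr_gt0.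
have := tele _ l0.
have -> : (2 * (16 / (3 * Q)))^-1 = 3 * Q / 32 by field; rewrite gt_eqF.
have -> : 16 / (3 * Q) / 2 = 8 / 3 / Q by field; rewrite gt_eqF.
move: L1 L2; set x1 := \sum_(_ <- _) _; set x2 := \sum_(_ <- _) _ => L1 L2 h.
have h3 : 3 / 4 * Q ^+ 2 <= m a ^+ 2 - m b ^+ 2.
  have : m b <= Q / 2 by lra.
  by have := m0 b; nra.
have h4 : 3 * Q / 32 * x2 <= 3 * Q / 32 * (4 * Q) by apply: ler_wpM2l => //; lra.
have h5 : 3 / 8 * Q ^+ 2 <= 8 / 3 / Q * x1 by move: h h3 h4; rewrite expr2; lra.
have h6 : Q * (3 / 8 * Q ^+ 2) <= Q * (8 / 3 / Q * x1) by rewrite ler_pM2l.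
have h7 : Q * (8 / 3 / Q * x1) = 8 / 3 * x1 by field; rewrite gt_eqF.
have E0 : 0 <= energy m by apply: sumr_ge0 => i _; exact: sqr_ge0.
by rewrite exprS; move: h6; rewrite h7; lra.
Qed.

End averaging.

(** * Decay of the squared norm of the dual weights *)

Lemma powR_expR (R : realType) (x y : R) : expR x `^ y = expR (y * x).
Proof. by rewrite /powR gt_eqF ?expR_gt0// expRK. Qed.

(* [y^-a] increases by at least [a c] per step, since
   [(1 - u)^-a >= exp (a u) >= 1 + a u]. *)
Lemma polynomial_decay (R : realType) (a c B : R) (y : nat -> R) :
  0 < a -> 0 <= c -> (forall j, 0 < y j) -> (forall j, y j.+1 <= y j) ->
  (forall j, B <= y j -> y j.+1 <= y j * (1 - c * y j `^ a)) ->
  forall j, y j <= B \/ a * c * j%:R <= y j `^ (- a).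
Proof.
move=> a0 c0 y0 yd ys; elim=> [|j ih]; first by right; rewrite mulr0 powR_ge0.
have [yB|By] := leP (y j.+1) B; [by left|right].
have Byj : B < y j by apply: lt_le_trans By (yd j).
case: ih => [|ih]; first by rewrite leNgt Byj.
have h1 := ys j (ltW Byj).
have h2 : y j.+1 <= y j * expR (- (c * y j `^ a)).
  by apply: le_trans h1 _; rewrite ler_pM2l// expR_ge1Dx.
have h3 : (y j * expR (- (c * y j `^ a))) `^ (- a) <= y j.+1 `^ (- a).
  rewrite !powRN lef_pV2 ?posrE ?powR_gt0 ?mulr_gt0 ?expR_gt0//.
  by apply: ge0_ler_powR; rewrite ?nnegrE ?(ltW a0) ?(ltW (y0 _))// mulr_ge0 ?expR_ge0// ltW.
apply: le_trans h3; rewrite powRM ?expR_ge0 ?(ltW (y0 _))// powR_expR mulrNN.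
have h4 := expR_ge1Dx (a * (c * y j `^ a)).
apply: (@le_trans _ _ (y j `^ (- a) * (1 + a * (c * y j `^ a)))); last first.
  by apply: ler_wpM2l h4; exact: powR_ge0.
rewrite mulrDr mulr1 -natr1 mulrDr mulr1 lerD//.
rewrite powRN le_eqVlt; apply/orP; left; apply/eqP; field.
by rewrite gt_eqF ?powR_gt0.
Qed.

(** After factoring out [Q^r] this is [(1 - u)^r <= 1 - u] for [u = d / Q] in the unit interval. *)
Lemma powR_decrement (R : realType) (r Q d : R) : 1 <= r -> 0 < Q -> 0 <= d -> d <= Q ->
  (Q - d) `^ r <= Q `^ r - Q `^ (r - 1) * d.
Proof.
move=> r1 Q0 d0 dQ; have r0 : 0 < r by lra.
have u0 : 0 <= 1 - d / Q by rewrite subr_ge0 ler_pdivrMr// mul1r.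
have -> : Q - d = Q * (1 - d / Q) by field; rewrite gt_eqF.
have -> : Q `^ (r - 1) * d = Q `^ r * (d / Q).
  by rewrite -(mulr_powRB1 (ltW Q0) r0); field; rewrite gt_eqF.
rewrite powRM ?(ltW Q0)// -{2}(mulr1 (Q `^ r)) -mulrBr.
apply: ler_wpM2l; first exact: powR_ge0.
have [->|u1] := eqVneq (1 - d / Q) 0; first by rewrite powR0// gt_eqF.
apply: ge1r_powR => //; rewrite lt_neqAle eq_sym u1 u0/= lerBlDr lerDl.
by rewrite divr_ge0// ltW.
Qed.

Lemma iterE_powR_jensen (R : realType) (S : finType) (w : S -> R) n (F : seq S -> R) (s : R) :
  (forall a, 0 <= w a) -> \sum_a w a = 1 -> 1 <= s -> (forall l, 0 <= F l) ->
  0 < iterE w n F -> iterE w n F `^ s <= iterE w n (fun l => F l `^ s).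
Proof.
move=> w0 w1 s1 F0 E0; set y := iterE w n F in E0 *.
apply: (@le_trans _ _ (iterE w n (fun l => (y `^ s - s * y `^ (s - 1) * y) + s * y `^ (s - 1) * F l))).
  by rewrite iterED iterEZ iterE_cst// subrK.
by apply: ler_iterE => // l _; apply: le_trans (powR_tangent s1 (F0 l) E0); lra.
Qed.

Section decay.
Variables (R : realType) (W I : finType) (ends : I -> W * W).
Hypothesis ends_neq : forall i, (ends i).1 != (ends i).2.
Hypothesis conn : forall u v : W, connect (edge_rel ends) u v.
Variable p : R.
Hypothesis p01 : 0 <= p <= 1.
Notation q := (p * (1 - p) ^+ #|I|.-1).
Notation w := (@slot_weight R I p).

(** The dual weights: pairing them with the initial opinions gives the opinion of [o] after the
    slots [l]. *)
Definition slot_vec (o : W) (l : seq {set I}) : W -> R :=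
  foldr (slot_step (average ends)) (fun v => (v == o)%:R) l.

Lemma slot_vec_prob o l : prob_vec (slot_vec o l).
Proof.
apply: foldr_prob => //; split=> //; rewrite (bigD1 o)//= eqxx big1 ?addr0//.
by move=> v /negbTE ->.
Qed.

Lemma q_ge0 : 0 <= q.
Proof. by case/andP: p01 => p0 p1; rewrite mulr_ge0// exprn_ge0// subr_ge0. Qed.

(** The factor [1/32] combines the loss of half the energy with the [1/16] of the Nash inequality.
    Subtracting [(2 / |W|)^(r + 2)] makes the bound unconditional, since below the Nash threshold it
    only asks for no increase; it can therefore be averaged over the weights. *)
Lemma sqnorm_powR_step (r : R) (m : W -> R) : 1 <= r -> prob_vec m ->
  \sum_(b : {set I}) w b * sqnorm (slot_step (average ends) b m) `^ r <=
  sqnorm m `^ r - q / 32 * (sqnorm m `^ (r + 2) - (2 / #|W|%:R) `^ (r + 2)).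
Proof.
move=> r1 mp; have q0 := q_ge0.
rewrite (sum_slot_step p _ (fun m => sqnorm m `^ r)).
set Q := sqnorm m; have W0 : (0 < #|W|)%N.
  case: (posnP #|W|) => // W0; case: mp => _; rewrite big1 => [/eqP|v]; first by rewrite eq_sym oner_eq0.
  by have := card0_eq W0 v; rewrite inE.
have Q0 : 0 < Q by apply: lt_le_trans (sqnorm_lb mp); rewrite invr_gt0 ltr0n.
move: q0; set q' := q => q0.
rewrite lerD2l -(mulrA q') -mulrN; apply: ler_wpM2l => //.
apply: (@le_trans _ _ (\sum_i - (Q `^ (r - 1) * ((m (ends i).1 - m (ends i).2) ^+ 2 / 2)))).
  apply: ler_sum => i _; rewrite lerBlDl sqnorm_average//.
  have := @powR_decrement R r Q ((m (ends i).1 - m (ends i).2) ^+ 2 / 2) r1 Q0.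
  apply; first by rewrite divr_ge0// sqr_ge0.
  by rewrite -subr_ge0 /Q -sqnorm_average// sqnorm_ge0.
rewrite sumrN lerN2 -mulr_sumr -mulr_suml -/(energy ends m).
have E0 : 0 <= energy ends m by apply: sumr_ge0 => i _; exact: sqr_ge0.
have [Q2|Q2] := leP (2 / #|W|%:R) Q.
  have := nash conn mp Q2; rewrite -/Q => h.
  have -> : Q `^ (r + 2) = Q `^ (r - 1) * Q ^+ 3.
    rewrite -(powR_mulrn _ (ltW Q0)) -powRD ?(gt_eqF Q0) ?implybT//.
    by congr (_ `^ _); ring.
  have := ler_wpM2l (powR_ge0 Q (r - 1)) h.
  have := powR_ge0 (2 / #|W|%:R : R) (r + 2).
  lra.
apply: (@le_trans _ _ 0); last by rewrite mulr_ge0 ?powR_ge0// divr_ge0.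
rewrite mulr_ge0_le0 ?invr_ge0// subr_le0.
by apply: ge0_ler_powR; rewrite ?nnegrE ?(ltW Q0) ?(ltW Q2)// ?divr_ge0//; lra.
Qed.

End decay.

(** By Jensen's inequality the averaged drop is at least a multiple of [y^(1 + 2/r)] up to the
    floor, which is the recursion of [polynomial_decay] with exponent [2 / r]. The number [s] stands
    for the elapsed time capped at [|W|^2]; the factor [2] in its last hypothesis leaves room for
    the time lost to discretisation. *)
Lemma iterE_sqnorm_decay (R : realType) (r : R) : 1 <= r -> exists2 C : R, 0 < C &
  forall (W I : finType) (ends : I -> W * W),
  (forall i, (ends i).1 != (ends i).2) ->
  (forall u v : W, connect (edge_rel ends) u v) ->
  forall (p : R), 0 <= p <= 1 -> forall (o : W) (M : nat) (s : R), 0 < s ->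
  s <= #|W|%:R ^+ 2 -> s <= 2 * (p * (1 - p) ^+ #|I|.-1 * M%:R) ->
  iterE (slot_weight p) M (fun l => sqnorm (slot_vec R ends o l) `^ r) <= C * s `^ (- (r / 2)).
Proof.
move=> r1; have r0 : 0 < r by lra.
(* The two summands match the two outcomes of the decay: the floor [2 (2 / |W|)^r] has been reached,
   where [s <= |W|^2] is used, or the polynomial rate holds. *)
exists (2 * 2 `^ r + (2 / r / 128) `^ (- (r / 2))).
  by rewrite addr_gt0 ?mulr_gt0 ?powR_gt0// !divr_gt0.
move=> W I ends en conn p p01 o M s s0 sn sM.
have q0 := q_ge0 I p01; set q := p * _ in q0 sM.
have W0 : (0 < #|W|)%N by apply/card_gt0P; exists o.
have n0 : 0 < #|W|%:R :> R by rewrite ltr0n.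
pose y j := iterE (slot_weight p) j (fun l => sqnorm (slot_vec R ends o l) `^ r).
have w0 := @slot_weight_ge0 R I p p01.
have w1 := @slot_weight_sum1 R I p.
pose N := 2 / #|W|%:R : R; have N0 : 0 < N by rewrite divr_gt0.
have Qpos l : 0 < sqnorm (slot_vec R ends o l).
  by apply: lt_le_trans (sqnorm_lb (slot_vec_prob R en o l)); rewrite invr_gt0.
have y0 j : 0 < y j.
  apply: (@lt_le_trans _ _ (#|W|%:R^-1 `^ r)); first by rewrite powR_gt0// invr_gt0.
  rewrite -(iterE_cst w1 j (_ `^ r)); apply: ler_iterE => // l _.
  by apply: ge0_ler_powR; rewrite ?nnegrE ?(ltW r0) ?invr_ge0 ?sqnorm_ge0 ?(ltW n0)//; exact: sqnorm_lb (slot_vec_prob R en o l).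
have jens j : y j `^ (1 + 2 / r) <= iterE (slot_weight p) j
    (fun l => sqnorm (slot_vec R ends o l) `^ (r + 2)).
  apply: le_trans (iterE_powR_jensen w0 w1 _ _ (y0 j)) _.
  - by rewrite lerDl divr_ge0// ltW.
  - by move=> l; exact: powR_ge0.
  apply: ler_iterE => // l _; rewrite -powRrM mulrDr mulr1 mulrCA divff ?gt_eqF//.
  by rewrite mulr1.
have step j : y j.+1 <= y j - q / 32 * (y j `^ (1 + 2 / r) - N `^ (r + 2)).
  rewrite /y iterES.
  apply: (@le_trans _ _ (iterE (slot_weight p) j (fun l =>
     sqnorm (slot_vec R ends o l) `^ r + - (q / 32) * (sqnorm (slot_vec R ends o l) `^ (r + 2)
     + - N `^ (r + 2))))).
    apply: ler_iterE => // l _; rewrite mulNr.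
    refine (sqnorm_powR_step en conn p01 r1 (slot_vec_prob R en o l)).
  rewrite iterED iterEZ iterED iterE_cst// mulNr lerD2l lerN2.
  by apply: ler_wpM2l; [exact: divr_ge0|rewrite lerD2r; exact: jens].
have yd j : y j.+1 <= y j.
  rewrite /y iterES; apply: ler_iterE => // l _.
  rewrite -[leRHS]mul1r -[X in X * _]w1 mulr_suml; apply: ler_sum => b _; apply: ler_wpM2l => //.
  apply: ge0_ler_powR; rewrite ?nnegrE ?(ltW r0) ?sqnorm_ge0//=.
  rewrite /slot_step; case: pickP => // i _; rewrite sqnorm_average// lerBlDr lerDl.
  by rewrite divr_ge0// sqr_ge0.
have a0 : 0 < 2 / r by rewrite divr_gt0.
have c0 : 0 <= q / 64 by rewrite divr_ge0.
(* Above twice the floor, [(2 N^r)^(1 + 2/r) >= 2 N^(r + 2)], so the correction takes away at most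
   half of the drop and [1/32] becomes [1/64]. *)
have big j : 2 * N `^ r <= y j -> y j.+1 <= y j * (1 - q / 64 * y j `^ (2 / r)).
  move=> h; apply: le_trans (step j) _.
  have yE : y j `^ (1 + 2 / r) = y j * y j `^ (2 / r).
    by rewrite powRD ?(gt_eqF (y0 j)) ?implybT// powRr1// ltW.
  have h2 : 2 * N `^ (r + 2) <= y j `^ (1 + 2 / r).
    apply: (@le_trans _ _ ((2 * N `^ r) `^ (1 + 2 / r))); last first.
      by apply: ge0_ler_powR; rewrite ?nnegrE ?(ltW (y0 _))// ?mulr_ge0 ?powR_ge0// addr_ge0// ltW.
    rewrite powRM ?powR_ge0// -powRrM mulrDr mulr1 mulrCA divff ?gt_eqF// mulr1.
    apply: ler_wpM2r; first exact: powR_ge0.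
    by rewrite -[leLHS](powRr1 (_ : 0 <= 2))//; apply: ler_powR; [lra|rewrite lerDl ltW].
  have h3 : q * (2 * N `^ (r + 2)) <= q * y j `^ (1 + 2 / r) by apply: ler_wpM2l.
  by move: h3; rewrite yE; lra.
have fin := @polynomial_decay R (2 / r) (q / 64) (2 * N `^ r) y a0 c0 y0 yd big M.
have C10 : 0 <= 2 * 2 `^ r * s `^ (- (r / 2)) by rewrite !mulr_ge0 ?powR_ge0.
have C20 : 0 <= (2 / r / 128) `^ (- (r / 2)) * s `^ (- (r / 2)) by rewrite !mulr_ge0 ?powR_ge0.
rewrite mulrDl; case: fin => fin.
  apply: (@le_trans _ _ (2 * 2 `^ r * s `^ (- (r / 2)))); last by rewrite lerDl.
  apply: le_trans fin _; rewrite -mulrA ler_pM2l// powRM ?invr_ge0 ?ler0n//.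
  apply: ler_wpM2l; first exact: powR_ge0.
  rewrite -(powR_inv1 (ltW n0)) -powRrM mulN1r !powRN lef_pV2 ?posrE ?powR_gt0//.
  apply: (@le_trans _ _ ((#|W|%:R ^+ 2) `^ (r / 2))).
    by apply: ge0_ler_powR; rewrite ?nnegrE ?(ltW s0) ?sqr_ge0// divr_ge0// ltW.
  rewrite -(powR_mulrn _ (ltW n0)) -powRrM.
  by rewrite (_ : 2%:R * _ = r)//; field.
apply: (@le_trans _ _ ((2 / r / 128) `^ (- (r / 2)) * s `^ (- (r / 2)))); last by rewrite lerDr.
rewrite -powRM ?(ltW s0)//; last by rewrite ltW// divr_gt0.
have u0 : 0 < 2 / r / 128 * s by rewrite mulr_gt0// divr_gt0.
have h : 2 / r / 128 * s <= y M `^ (- (2 / r)).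
  apply: le_trans fin; rewrite -!(mulrA (2 / r)) ler_pM2l//; move: sM; lra.
have yE : y M = (y M `^ (- (2 / r))) `^ (- (r / 2)).
  rewrite -powRrM (_ : _ * _ = 1) ?powRr1 ?(ltW (y0 M))//.
  by field; rewrite gt_eqF.
rewrite [leLHS]yE !(powRN _ (r / 2)) lef_pV2 ?posrE ?powR_gt0//.
by apply: ge0_ler_powR; rewrite ?nnegrE ?powR_ge0 ?(ltW u0)// divr_ge0// ltW.
Qed.

(** * Moment bounds for the slotted process *)

(** Compare [y] with a reference scale [t]: below it [y^e <= t^e], above it the larger power wins.
    The [t] chosen later is the expected size of [y], so both terms have the same order. *)
Lemma powR_interp (R : realType) (e k t y : R) : 0 <= e -> e <= k -> 0 < t -> 0 <= y ->
  y `^ e <= t `^ e + t `^ (e - k) * y `^ k.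
Proof.
move=> e0 ek t0 y0; have [yt|ty] := leP y t.
  apply: (@le_trans _ _ (t `^ e)); first by apply: ge0_ler_powR; rewrite ?nnegrE// ltW.
  by rewrite lerDl mulr_ge0 ?powR_ge0.
apply: (@le_trans _ _ (t `^ (e - k) * y `^ k)); last by rewrite lerDr powR_ge0.
have yp : 0 < y by apply: lt_trans ty.
have -> : y `^ e = y `^ (e - k) * y `^ k by rewrite -powRD ?(gt_eqF yp) ?implybT// subrK.
apply: ler_wpM2r; first exact: powR_ge0.
rewrite -(opprB k e) !powRN lef_pV2 ?posrE ?powR_gt0//.
by apply: ge0_ler_powR; rewrite ?nnegrE ?subr_ge0// ltW.
Qed.

Lemma powR_normD (R : realType) (p a b : R) : 0 <= p ->
  `|a + b| `^ p <= 2 `^ p * (`|a| `^ p + `|b| `^ p).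
Proof.
move=> p0; wlog ab : a b / `|a| <= `|b|.
  move=> h; have [|ba] := leP `|a| `|b|; first exact: h.
  by rewrite addrC [_ `^ p + _]addrC; apply: h; exact: ltW.
apply: (@le_trans _ _ ((2 * `|b|) `^ p)).
  apply: ge0_ler_powR; rewrite ?nnegrE ?mulr_ge0//.
  by apply: le_trans (ler_normD _ _) _; lra.
by rewrite powRM//; apply: ler_wpM2l; [exact: powR_ge0|rewrite lerDr powR_ge0].
Qed.

Lemma sum_powR_jensen (R : realType) (A : finType) (w y : A -> R) (p : R) :
  (forall a, 0 <= w a) -> \sum_a w a = 1 -> 1 <= p -> (forall a, 0 <= y a) ->
  (\sum_a w a * y a) `^ p <= \sum_a w a * y a `^ p.
Proof.
move=> w0 w1 p1 y0; have p0 : 0 < p by lra.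
set z := \sum_a _; have z0 : 0 <= z by apply: sumr_ge0 => a _; rewrite mulr_ge0.
move: z0; rewrite le_eqVlt => /orP[/eqP <-|z0].
  rewrite powR0 ?gt_eqF//; apply: sumr_ge0 => a _; rewrite mulr_ge0 ?powR_ge0//.
apply: (@le_trans _ _ (\sum_a w a * ((z `^ p - p * z `^ (p - 1) * z) + p * z `^ (p - 1) * y a))).
  under eq_bigr do rewrite mulrDr mulrCA.
  by rewrite big_split/= -mulr_suml w1 mul1r -mulr_sumr -/z subrK.
apply: ler_sum => a _; apply: ler_wpM2l => //.
by apply: le_trans (powR_tangent p1 (y0 a) z0); lra.
Qed.

Lemma sum_weight_le (R : realType) (A : finType) (w y : A -> R) (B : R) :
  (forall a, 0 <= w a) -> \sum_a w a = 1 -> (forall a, y a <= B) ->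
  \sum_a w a * y a <= B.
Proof.
move=> w0 w1 yB; apply: (@le_trans _ _ (\sum_a w a * B)).
  by apply: ler_sum => a _; apply: ler_wpM2l.
by rewrite -mulr_suml w1 mul1r.
Qed.

Definition clamp (R : realType) (L x : R) : R := Num.max (- L) (Num.min L x).
(** The distance from [x] to the interval [[-L, L]]. Unlike a cut-off by an indicator it is
    [1]-Lipschitz in [x], hence compatible with rounding and limits. *)
Definition excess (R : realType) (L x : R) : R := Num.max 0 (`|x| - L).

Lemma clamp_le (R : realType) (L x : R) : 0 <= L -> `|clamp L x| <= L.
Proof.
move=> L0; by rewrite /clamp ler_norml le_max lexx ge_max ge_min lexx /= andbT; lra.
Qed.

Lemma excess_ge0 (R : realType) (L x : R) : 0 <= excess L x.
Proof. by rewrite /excess le_max lexx. Qed.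

Lemma excess_clamp (R : realType) (L x : R) : 0 <= L -> `|x - clamp L x| = excess L x.
Proof.
move=> L0; rewrite /clamp /excess.
have [xL|Lx] := leP L x.
  rewrite max_r; last lra.
  by rewrite (ger0_norm (le_trans L0 xL)) max_r ?subr_ge0// ger0_norm// subr_ge0.
have [h|h] := leP x (- L).
  rewrite (@ler0_norm _ (x - - L)); last lra.
  by rewrite (@ler0_norm _ x); [rewrite max_r; lra|lra].
by rewrite subrr normr0 max_l// subr_le0 ler_norml !ltW.
Qed.

Lemma lincombD (R : realType) (A : Type) (x y : A -> R) m l :
  lincomb (fun a => x a + y a) m l = lincomb x m l + lincomb y m l.
Proof. by elim: l m => [|a l ih] m /=; rewrite ?addr0// ih; ring. Qed.

Lemma lincomb0 (R : realType) (A : Type) (x : A -> R) m l :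
  (forall a, x a = 0) -> lincomb x m l = 0.
Proof. by move=> x0; elim: l m => [|a l ih] m //=; rewrite ih x0 mulr0 addr0. Qed.

Definition enum_fun (R : realType) (W : finType) (o : W) (m : W -> R) (i : nat) : R :=
  m (nth o (enum W) i).

Lemma sum_enum_fun (R : realType) (W : finType) (o : W) (m : W -> R) (F : R -> R) :
  \sum_(i < #|W|) F (enum_fun o m i) = \sum_v F (m v).
Proof.
rewrite -[RHS]big_enum/= (big_nth o) -cardE big_mkord.
by [].
Qed.

Section discrete_bounds.
Variable R : realType.

Definition moment (p : R) (W I A : finType) (ends : I -> W * W) (pr : R) (o : W) (M : nat)
    (w x : A -> R) : R :=
  iterE (slot_weight pr) M (fun l => iterE w #|W| (fun a =>
    `|lincomb x (enum_fun o (slot_vec R ends o l)) a| `^ p)).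

Lemma moment_bound_ge2 (p : R) : 2 <= p -> exists2 C : R, 0 < C &
  forall (W I : finType) (ends : I -> W * W),
  (forall i, (ends i).1 != (ends i).2) ->
  (forall u v : W, connect (edge_rel ends) u v) ->
  forall (pr : R), 0 <= pr <= 1 -> forall (o : W) (M : nat) (s : R), 0 < s ->
  s <= #|W|%:R ^+ 2 -> s <= 2 * (pr * (1 - pr) ^+ #|I|.-1 * M%:R) ->
  forall (A : finType) (w x : A -> R), (forall a, 0 <= w a) -> \sum_a w a = 1 ->
    \sum_a w a * x a = 0 ->
  moment p ends pr o M w x <= C * (s `^ (- (p / 4)) * \sum_a w a * `|x a| `^ p).
Proof.
move=> p2; have [C C0 hC] := iterE_lincomb_ge2 p2.
have r1 : 1 <= p / 2 by lra.
have [D D0 hD] := iterE_sqnorm_decay r1.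
exists (C * D); first exact: mulr_gt0.
move=> W I ends en conn pr p01 o M s s0 sn sM A w x w0 w1 x0.
have W0 : (0 < #|W|)%N by apply/card_gt0P; exists o.
have sw0 := @slot_weight_ge0 R I pr p01.
set S := \sum_a _; have S0 : 0 <= S by apply: sumr_ge0 => a _; rewrite mulr_ge0 ?powR_ge0.
apply: (@le_trans _ _ (iterE (slot_weight pr) M (fun l =>
    C * S * sqnorm (slot_vec R ends o l) `^ (p / 2)))).
  apply: ler_iterE => // l _; have mp := slot_vec_prob R en o l.
  have sE := sum_enum_fun o (slot_vec R ends o l) (fun a => a ^+ 2).
  have := hC A w x w0 w1 x0 #|W| (enum_fun o (slot_vec R ends o l)).
  rewrite sE -/(sqnorm _) -/S => h; apply: le_trans (h _ _) _.
  - by move=> i; case: mp => m0 _; exact: m0.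
  - by apply: lt_le_trans (sqnorm_lb mp); rewrite invr_gt0 ltr0n.
  - by rewrite mulrAC.
rewrite iterEZ; have CS0 : 0 <= C * S by rewrite mulr_ge0// ltW.
apply: le_trans (ler_wpM2l CS0 (hD W I ends en conn pr p01 o M s s0 sn sM)) _.
rewrite (_ : p / 2 / 2 = p / 4); last by field.
by rewrite le_eqVlt; apply/orP; left; apply/eqP; ring.
Qed.

(** The part clamped at [L] has a second moment and decays like [s^(-p/4)]; the excess has only a
    [p]-th moment and decays like [s^(-(p-1)/2)]. Level [L = 0] gives the plain bound. For [p < 2]
    the first rate is faster, so a large [L] makes the slow term small: this is the little-o. *)
Lemma moment_bound_le2 (p : R) : 1 <= p -> p <= 2 -> exists2 C : R, 0 < C &
  forall (W I : finType) (ends : I -> W * W),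
  (forall i, (ends i).1 != (ends i).2) ->
  (forall u v : W, connect (edge_rel ends) u v) ->
  forall (pr : R), 0 <= pr <= 1 -> forall (o : W) (M : nat) (s : R), 0 < s ->
  s <= #|W|%:R ^+ 2 -> s <= 2 * (pr * (1 - pr) ^+ #|I|.-1 * M%:R) ->
  forall (A : finType) (w x : A -> R), (forall a, 0 <= w a) -> \sum_a w a = 1 ->
    \sum_a w a * x a = 0 -> forall L : R, 0 <= L ->
  moment p ends pr o M w x <= C * (s `^ (- ((p - 1) / 2)) * \sum_a w a * excess L (x a) `^ p +
    s `^ (- (p / 4)) * L `^ p).
Proof.
move=> p1 p2; have [C C0 hC] := iterE_lincomb_le2 p1 p2.
have p0 : 0 < p by lra.
have [K K0 hK] := iterE_lincomb_ge2 (lexx (2 : R)).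
have [D D0 hD] := iterE_sqnorm_decay (lexx (1 : R)).
pose C1 := 2 `^ p * (C * (1 + D) * (2 `^ p * 2)).
pose C2 := 2 `^ p * (1 + K * 4 * D).
have P2 : 0 < 2 `^ p :> R by rewrite powR_gt0.
have C10 : 0 < C1 by rewrite !mulr_gt0// addr_gt0.
have C20 : 0 < C2 by rewrite !mulr_gt0// addr_gt0// !mulr_gt0.
exists (C1 + C2); first exact: addr_gt0.
move=> W I ends en conn pr p01 o M s s0 sn sM A w x w0 w1 x0 L L0.
have W0 : (0 < #|W|)%N by apply/card_gt0P; exists o.
have sw0 := @slot_weight_ge0 R I pr p01; have sw1 := @slot_weight_sum1 R I pr.
set S := \sum_a _; have S0 : 0 <= S by apply: sumr_ge0 => a _; rewrite mulr_ge0 ?powR_ge0.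
pose mu := \sum_a w a * clamp L (x a).
(* Both parts are recentred, because the moment inequalities require mean zero. *)
pose x1 a := clamp L (x a) - mu.
pose x2 a := x a - clamp L (x a) + mu.
have xE a : x a = x1 a + x2 a by rewrite /x1 /x2; ring.
have x10 : \sum_a w a * x1 a = 0.
  rewrite /x1; under eq_bigr do rewrite mulrBr.
  by rewrite sumrB -mulr_suml w1 mul1r subrr.
have x20 : \sum_a w a * x2 a = 0.
  have : \sum_a w a * x a = \sum_a w a * x1 a + \sum_a w a * x2 a.
    by rewrite -big_split/=; apply: eq_bigr => a _; rewrite {1}xE mulrDr.
  by rewrite x0 x10 add0r.
have muL : `|mu| <= L.
  apply: le_trans (ler_norm_sum _ _ _) _.
  under eq_bigr do rewrite normrM (ger0_norm (w0 _)).
  by apply: sum_weight_le => // a; exact: clamp_le.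
have mup : `|mu| `^ p <= S.
  apply: le_trans (sum_powR_jensen w0 w1 p1 (fun a => excess_ge0 L (x a))).
  apply: ge0_ler_powR; rewrite ?nnegrE ?(ltW p0)//.
    by apply: sumr_ge0 => a _; rewrite mulr_ge0// excess_ge0.
  (* Since [x] is centred, the mean of the clamped part is minus the mean of the excess part, so
     recentring costs no more than the excess itself. *)
  have -> : mu = - \sum_a w a * (x a - clamp L (x a)).
    under eq_bigr do rewrite mulrBr.
    by rewrite sumrB x0 sub0r opprK.
  rewrite normrN; apply: le_trans (ler_norm_sum _ _ _) _; apply: ler_sum => a _.
  by rewrite normrM (ger0_norm (w0 a)) excess_clamp.
have S2 : \sum_a w a * `|x2 a| `^ p <= 2 `^ p * 2 * S.
  apply: (@le_trans _ _ (\sum_a w a * (2 `^ p * (excess L (x a) `^ p + S)))).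
    apply: ler_sum => a _; apply: ler_wpM2l => //.
    apply: le_trans (powR_normD _ _ (ltW p0)) _; rewrite ler_pM2l//.
    by rewrite excess_clamp// lerD2l.
  under eq_bigr do rewrite mulrCA mulrDr.
  rewrite -mulr_sumr big_split/= -mulr_suml w1 mul1r -/S.
  by rewrite -mulrA ler_pM2l// -mulr2n mulr_natl.
pose v l := enum_fun o (slot_vec R ends o l).
have v0 l i : 0 <= v l i by case: (slot_vec_prob R en o l) => m0 _; exact: m0.
have t1 : 0 < s `^ (- 2^-1) by rewrite powR_gt0.
have hQ : iterE (slot_weight pr) M (fun l => sqnorm (slot_vec R ends o l)) <= D * s `^ (- 2^-1).
  have := hD W I ends en conn pr p01 o M s s0 sn sM; rewrite div1r; apply: le_trans.
  by apply: ler_iterE => // l _; rewrite powRr1// sqnorm_ge0.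
(* The weights sum to one, so [sum m^p] is the [m]-average of [m^(p-1)]; interpolating at the scale
   [s^(-1/2)] bounds it by [s^(-(p-1)/2)] plus a multiple of the squared norm, whose mean is of
   order [s^(-1/2)]. *)
have E2 : iterE (slot_weight pr) M (fun l => iterE w #|W| (fun a =>
    `|lincomb x2 (v l) a| `^ p)) <= C * (1 + D) * s `^ (- ((p - 1) / 2)) * (2 `^ p * 2 * S).
  apply: (@le_trans _ _ (iterE (slot_weight pr) M (fun l => (C * (2 `^ p * 2 * S)) *
     ((s `^ (- 2^-1)) `^ (p - 1) + (s `^ (- 2^-1)) `^ (p - 2) * sqnorm (slot_vec R ends o l))))).
    apply: ler_iterE => // l _; apply: le_trans (hC A w x2 w0 w1 x20 #|W| (v l) (v0 l)) _.
    have mp := slot_vec_prob R en o l.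
    set B := _ + _ * sqnorm _; rewrite -(mulrA C _ B) (mulrC _ B) mulrA.
    apply: ler_pM => //.
    - by rewrite mulr_ge0 ?(ltW C0)//; apply: sumr_ge0 => a _; rewrite powR_ge0.
    - by apply: sumr_ge0 => a _; rewrite mulr_ge0 ?powR_ge0.
    rewrite ler_pM2l// /B.
    rewrite (sum_enum_fun o (slot_vec R ends o l) (fun a => a `^ p)).
    case: mp => m0 m1; set T := (X in _ <= X + _).
    have -> : T = \sum_u slot_vec R ends o l u * T by rewrite -mulr_suml m1 mul1r.
    rewrite mulr_sumr -big_split/= /T; apply: ler_sum => u _; rewrite -(mulr_powRB1 (m0 u) p0).
    have p10 : 0 <= p - 1 by lra.
    have p11 : p - 1 <= 1 by lra.
    have := ler_wpM2l (m0 u) (powR_interp p10 p11 t1 (m0 u)).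
    rewrite powRr1// mulrDr => h; apply: le_trans h _; rewrite lerD2l.
    rewrite (_ : p - 1 - 1 = p - 2); last by ring.
    by rewrite expr2 mulrCA.
  rewrite iterEZ iterED iterE_cst// iterEZ -!powRrM.
  apply: (@le_trans _ _ (C * (2 `^ p * 2 * S) * ((1 + D) * s `^ (- ((p - 1) / 2))))); last first.
    by rewrite le_eqVlt; apply/orP; left; apply/eqP; ring.
  apply: ler_wpM2l; first by rewrite mulr_ge0 ?(ltW C0)// mulr_ge0// mulr_ge0// ltW.
  apply: (@le_trans _ _ (s `^ (- 2^-1 * (p - 1)) + s `^ (- 2^-1 * (p - 2)) * (D * s `^ (- 2^-1)))).
    by rewrite lerD2l; apply: ler_wpM2l => //; exact: powR_ge0.
  rewrite mulrCA -powRD ?(gt_eqF s0) ?implybT// mulrDl mul1r.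
  rewrite (_ : - 2^-1 * (p - 2) + - 2^-1 = - ((p - 1) / 2)); last by field.
  by rewrite (_ : - 2^-1 * (p - 1) = - ((p - 1) / 2)); last by field.
have E1 : iterE (slot_weight pr) M (fun l => iterE w #|W| (fun a =>
    `|lincomb x1 (v l) a| `^ p)) <= (1 + K * 4 * D) * (s `^ (- (p / 4)) * L `^ p).
  (* The level [L = 0] is separate because the interpolation scale must be positive; the clamped
     part is then identically zero. *)
  move: L0; rewrite le_eqVlt => /orP[/eqP L0|L0].
    have x1z a : x1 a = 0.
      have cz b : clamp L (x b) = 0 
        by have := @clamp_le R L (x b); rewrite -L0 => /(_ (lexx 0)); rewrite normr_le0 => /eqP.
      by rewrite /x1 /mu cz big1 ?subrr// => b _; rewrite cz mulr0.
    rewrite (@eq_iterE _ _ _ M _ (fun=> 0)); last first.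
      move=> l _; rewrite (@eq_iterE _ _ _ _ _ (fun=> 0)) ?iterE_cst// => a _.
      by rewrite lincomb0// normr0 powR0// gt_eqF.
    by rewrite iterE_cst// !mulr_ge0 ?powR_ge0// addr_ge0// !mulr_ge0// ltW.
  (* The order of the standard deviation: the summands are bounded by [2 L] and the squared weights
     have total mean of order [s^(-1/2)]. *)
  pose t := L * s `^ (- 4^-1); have t0 : 0 < t by rewrite mulr_gt0// powR_gt0.
  apply: (@le_trans _ _ (iterE (slot_weight pr) M (fun l => t `^ p +
     (t `^ (p - 2) * (K * (4 * L ^+ 2))) * sqnorm (slot_vec R ends o l)))).
    apply: ler_iterE => // l _; have mp := slot_vec_prob R en o l.
    apply: (@le_trans _ _ (iterE w #|W| (fun a => t `^ p + t `^ (p - 2) * `|lincomb x1 (v l) a| `^ 2))).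
      by apply: ler_iterE => // a _; apply: powR_interp => //; exact: ltW.
    rewrite iterED iterE_cst// iterEZ lerD2l -mulrA; apply: ler_wpM2l; first exact: powR_ge0.
    have := hK A w x1 w0 w1 x10 #|W| (v l) (v0 l).
    rewrite (sum_enum_fun o (slot_vec R ends o l) (fun a => a ^+ 2)) -/(sqnorm _) => h.
    apply: le_trans (h _) _; first by apply: lt_le_trans (sqnorm_lb mp); rewrite invr_gt0 ltr0n.
    rewrite divff// powRr1 ?sqnorm_ge0// -2!(mulrA K) ler_pM2l// mulrC.
    apply: ler_wpM2r; first exact: sqnorm_ge0.
    apply: sum_weight_le => // a; have : `|x1 a| <= 2 * L.
      by apply: le_trans (ler_normB _ _) _; have := @clamp_le R L (x a) (ltW L0); lra.
    rewrite powR_mulrn// => h1.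
    have : `|x1 a| ^+ 2 <= (2 * L) ^+ 2 by rewrite ler_sqr ?nnegrE// mulr_ge0// ltW.
    by rewrite exprMn; lra.
  rewrite iterED iterE_cst// iterEZ.
  have c0 : 0 <= t `^ (p - 2) * (K * (4 * L ^+ 2)).
    by rewrite !mulr_ge0 ?powR_ge0 ?sqr_ge0// ltW.
  apply: le_trans (lerD (lexx _) (ler_wpM2l c0 hQ)) _.
  have tp : t `^ p = s `^ (- (p / 4)) * L `^ p.
    rewrite powRM ?(ltW L0) ?powR_ge0// -powRrM mulrC; congr (_ `^ _ * _).
    by field.
  have -> : t `^ (p - 2) * (K * (4 * L ^+ 2)) * (D * s `^ (- 2^-1)) =
     K * 4 * D * (t `^ (p - 2) * t ^+ 2).
    have -> : t ^+ 2 = L ^+ 2 * s `^ (- 2^-1).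
      rewrite exprMn -(powR_mulrn _ (powR_ge0 _ _)) -powRrM; congr (_ * _ `^ _).
      by field.
    by ring.
  by rewrite powRB2_mulr_sqr ?(ltW t0)// tp -{1}(mul1r (s `^ _ * _)) -mulrDl.
apply: (@le_trans _ _ (2 `^ p * (iterE (slot_weight pr) M (fun l => iterE w #|W| (fun a =>
    `|lincomb x1 (v l) a| `^ p)) + iterE (slot_weight pr) M (fun l => iterE w #|W| (fun a =>
    `|lincomb x2 (v l) a| `^ p))))).
  rewrite -iterED -iterEZ; apply: ler_iterE => // l _.
  rewrite -iterED -iterEZ; apply: ler_iterE => // a _.
  rewrite -/(v l); apply: le_trans (powR_normD _ _ (ltW p0)).
  have -> // : lincomb x (v l) a = lincomb x1 (v l) a + lincomb x2 (v l) a.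
  rewrite -lincombD; congr (lincomb _ _ _); apply/funext => b; exact: xE.
apply: le_trans (ler_wpM2l (ltW P2) (lerD E1 E2)) _.
have h1 : 0 <= s `^ (- (p / 4)) * L `^ p by rewrite mulr_ge0 ?powR_ge0.
have h2 : 0 <= s `^ (- ((p - 1) / 2)) * S by rewrite mulr_ge0 ?powR_ge0.
have h3 := mulr_ge0 (ltW C10) h1.
have h4 := mulr_ge0 (ltW C20) h2.
apply: (@le_trans _ _ (C1 * (s `^ (- ((p - 1) / 2)) * S) + C2 * (s `^ (- (p / 4)) * L `^ p))).
  by rewrite /C1 /C2 le_eqVlt; apply/orP; left; apply/eqP; ring.
by move: h3 h4; lra.
Qed.

End discrete_bounds.

(** * Propagation of boundary effects *)

Section spread.
Variables (R : realType) (W I : finType) (ends : I -> W * W).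

(* The vertices whose opinion may depend on what happens outside the window. *)
Definition spread (i : I) (U : {set W}) : {set W} :=
  if ((ends i).1 \in U) || ((ends i).2 \in U)
  then ((ends i).1 |: ((ends i).2 |: U))%SET else U.

Definition spreads (U : {set W}) (l : seq {set I}) : {set W} :=
  foldl (fun U b => slot_step spread b U) U l.

Variables (phi : W -> R) (kappa p : R).
Hypothesis phi0 : forall v, 0 <= phi v.
Hypothesis kappa0 : 0 <= kappa.
Hypothesis p01 : 0 <= p <= 1.
Hypothesis phiP : forall v, \sum_i ((if (ends i).1 == v then phi (ends i).2 else 0) +
  (if (ends i).2 == v then phi (ends i).1 else 0)) <= kappa * phi v.

Definition mass (U : {set W}) : R := \sum_(v in U) phi v.

Lemma mass_ge0 U : 0 <= mass U.
Proof. by apply: sumr_ge0. Qed.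

Lemma massU1 v U : mass (v |: U)%SET <= phi v + mass U.
Proof.
rewrite /mass; have [vU|vU] := boolP (v \in U); last by rewrite big_setU1.
have -> : (v |: U)%SET = U by apply/finset.setUidPr; rewrite finset.sub1set.
by rewrite lerDr.
Qed.

(** An edge enlarges [U] only if exactly one end lies in it, up to edges that change nothing; the
    mass of the new end is charged to the old one, and the hypothesis on [phi] sums these
    charges. *)
Lemma mass_spread U : \sum_i (mass (spread i U) - mass U) <= kappa * mass U.
Proof.
apply: (@le_trans _ _ (\sum_i \sum_(v in U) ((if (ends i).1 == v then phi (ends i).2 else 0) +
  (if (ends i).2 == v then phi (ends i).1 else 0)))); last first.
  by rewrite exchange_big/= /mass mulr_sumr; apply: ler_sum.
apply: ler_sum => i _; rewrite big_split/=.
have one (a c : W) : \sum_(v in U) (if a == v then phi c else 0) = if a \in U then phi c else 0.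
  have [aU|aU] := boolP (a \in U).
    rewrite (bigD1 a)//= eqxx big1 ?addr0// => v /andP[_].
    by rewrite eq_sym => /negbTE ->.
  by rewrite big1// => v vU; case: eqP aU => // ->; rewrite vU.
rewrite !one /spread; have [aU|aU] := boolP (_ \in U); have [bU|bU] := boolP (_ \in U) => /=.
- have h := massU1 (ends i).1 ((ends i).2 |: U)%SET.
  have := massU1 (ends i).2 U; lra.
- have -> : ((ends i).1 |: ((ends i).2 |: U) = (ends i).2 |: U)%SET.
    by apply/finset.setUidPr; rewrite finset.sub1set !inE aU orbT.
  have := massU1 (ends i).2 U; lra.
- have -> : ((ends i).2 |: U = U)%SET by apply/finset.setUidPr; rewrite finset.sub1set.
  have := massU1 (ends i).1 U; lra.
- by rewrite subrr addr0.
Qed.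

Lemma iterE_mass_spreads M U :
  iterE (slot_weight p) M (fun l => mass (spreads U l)) <= (1 + p * kappa) ^+ M * mass U.
Proof.
have sw0 := @slot_weight_ge0 R I p p01.
have [p0 p1] := andP p01.
have pk : 0 <= 1 + p * kappa by rewrite addr_ge0// mulr_ge0.
elim: M U => [|M ih] U; first by rewrite expr0 mul1r.
rewrite /= (@le_trans _ _ (\sum_(b : {set I}) slot_weight p b *
    ((1 + p * kappa) ^+ M * mass (slot_step spread b U))))//.
  by apply: ler_sum => b _; apply: ler_wpM2l => //; exact: ih.
under eq_bigr do rewrite mulrCA.
rewrite -mulr_sumr exprSr -mulrA; apply: ler_wpM2l; first exact: exprn_ge0.
rewrite (sum_slot_step p _ mass) mulrDl mul1r lerD2l -mulrA.
set e := (1 - p) ^+ _; have e0 : 0 <= e by rewrite exprn_ge0// subr_ge0.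
have e1 : e <= 1 by rewrite exprn_ile1// ?subr_ge0// lerBlDl lerDr.
rewrite -(mulrA p); apply: ler_wpM2l => //.
apply: (@le_trans _ _ (e * (kappa * mass U))); first by apply: ler_wpM2l => //; exact: mass_spread.
by rewrite ler_piMl// mulr_ge0// mass_ge0.
Qed.

(** A first-moment bound: if [o] has been reached, the mass is at least [phi o = 1]. *)
Lemma iterE_spreads_mem (o : W) M U : phi o = 1 ->
  iterE (slot_weight p) M (fun l => (o \in spreads U l)%:R) <= (1 + p * kappa) ^+ M * mass U.
Proof.
move=> o1; apply: le_trans (iterE_mass_spreads M U).
apply: ler_iterE => [b|l _]; first exact: slot_weight_ge0.
have [oU|_] := boolP (o \in _); last exact: mass_ge0.
by rewrite /mass (bigD1 o)//= o1 lerDl sumr_ge0.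
Qed.

End spread.

(** * Paths of the process in slotted time *)

(* With integer inter-arrival times [(c k).+1], the [k]-th arrival is in slot
   [arrival c k], slots being numbered from 1. *)
Definition arrival (c : nat -> nat) (k : nat) : nat := \sum_(i < k.+1) (c i).+1.

(* [bits c g M]: the next [M] slots, when [g] empty slots have already elapsed
   since the last arrival. *)
Fixpoint bits (c : nat -> nat) (g M : nat) : seq bool :=
  if M is M'.+1 then
    if c 0%N == g then true :: bits (fun k => c k.+1) 0 M' else false :: bits c g.+1 M'
  else [::].

Lemma arrivalS c k : arrival c k.+1 = ((c 0%N).+1 + arrival (fun k => c k.+1) k)%N.
Proof. by rewrite /arrival big_ord_recl. Qed.

Lemma arrival0 c : arrival c 0 = (c 0%N).+1.
Proof. by rewrite /arrival big_ord1. Qed.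

Lemma arrival_gt c k : (c 0%N < arrival c k)%N.
Proof. by case: k => [|k]; rewrite ?arrival0// arrivalS ltn_addr. Qed.

Lemma size_bits c g M : size (bits c g M) = M.
Proof. by elim: M c g => //= M ih c g; case: ifP => _ /=; rewrite ih. Qed.

Lemma nth_bits c g M j : (g <= c 0%N)%N -> (j < M)%N ->
  nth false (bits c g M) j <-> exists k, arrival c k = (g + j.+1)%N.
Proof.
elim: M c g j => [//|M ih] c g j gc; rewrite ltnS => jM /=.
case: eqP => [c0|/eqP c0].
  case: j jM => [|j] jM /=.
    by split=> // _; exists 0%N; rewrite arrival0 c0 addn1.
  rewrite ih//; split=> [[k kj]|[k kj]].
    by exists k.+1; rewrite arrivalS kj c0; lia.
  case: k kj => [|k]; first by rewrite arrival0 c0; lia.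
  by rewrite arrivalS c0 => kj; exists k; lia.
have gc' : (g < c 0%N)%N by rewrite ltn_neqAle eq_sym c0.
case: j jM => [|j] jM /=.
  by split=> // -[k kj]; have := arrival_gt c k; lia.
by rewrite ih//; split=> -[k kj]; exists k; rewrite kj; lia.
Qed.

Section path.
Variables (R : realType) (V : countType) (adj : rel V).
Variables (ring : V -> V -> R -> Prop) (x0 : V -> R) (g : R -> V -> R).
Hypothesis gP : averaging_path adj ring x0 g.

(** Take the supremum of the times up to which the value has not changed. Without a ring, the left
    value carries the constancy to the supremum, and right-constancy carries it beyond. *)
Lemma averaging_path_const v s s' : 0 <= s -> s <= s' ->
  (forall r u, s < r -> r <= s' -> adj u v -> ~ ring u v r) -> g s' v = g s v.
Proof.
case: gP => _ g1 g2 s0 ss' nr.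
pose A := [set r | s <= r <= s' /\ forall q, s <= q -> q <= r -> g q v = g s v].
have As : A s.
  rewrite /A/=; split=> [|q sq qs]; first by rewrite lexx.
  by congr (g _ v); apply/le_anti/andP.
have ubA : has_ubound A by exists s' => r [/andP[]].
have sA : has_sup A by split; [exists s|].
set c := sup A; have sc : s <= c by exact: ub_le_sup.
have cs' : c <= s' by apply: ge_sup => [|r [/andP[]]]//; exists s.
have below q : s <= q -> q < c -> g q v = g s v.
  move=> sq qc; have qc' : 0 < c - q by rewrite subr_gt0.
  have [r Ar cr] := sup_adherent qc' sA.
  by case: Ar => _; apply => //; move: cr; rewrite -/c opprB addrC subrK => /ltW.
have gc : g c v = g s v.
  move: sc; rewrite le_eqVlt => /orP[/eqP <-//|sc].
  have [a [[e e0 ea] [ga _]]] := g2 v c (le_lt_trans s0 sc).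
  rewrite ga; last by move=> u uv; exact: nr.
  pose q := Num.max s (c - e / 2).
  have qc : q < c by rewrite /q gt_max sc/= ltrBlDr ltrDl divr_gt0.
  have sq : s <= q by rewrite /q le_max lexx.
  rewrite -(below q sq qc); apply/esym/ea => //; first exact: le_trans sq.
  by rewrite /q lt_max; apply/orP; right; lra.
have [e e0 ec] := g1 v c (le_trans s0 sc).
have [<-//|cs] : c = s' \/ c < s' by move: cs'; rewrite le_eqVlt => /orP[/eqP|]; [left|right].
pose r := Num.min s' (c + e / 2).
have cr : c < r by rewrite /r lt_min cs ltrDl divr_gt0.
have rs : r <= s' by rewrite /r ge_min lexx.
have : A r.
  split; first by rewrite rs (le_trans sc)// ltW.
  move=> q sq qr; have [qc|cq] := ltP q c; first exact: below.
  rewrite ec//; apply: le_lt_trans qr _; rewrite /r gt_min; apply/orP; right; lra.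
by move/(ub_le_sup ubA); rewrite leNgt cr.
Qed.

End path.

(** * Slotted and true paths in a finite window *)

Section window.
Variables (R : realType) (V : countType) (adj : rel V) (W I : finType).
Variables (loc : W -> V) (ends : I -> W * W) (U0 : {set W}).
Hypothesis adjC : forall u v, adj u v = adj v u.
Hypothesis adjN : forall v, ~~ adj v v.
Hypothesis loc_inj : injective loc.

Definition key (i : I) : V * V := (loc (ends i).1, loc (ends i).2).

Hypothesis ends_adj : forall i, adj (key i).1 (key i).2.
Hypothesis ends_key : forall i, edge_key (key i).1 (key i).2 = key i.
Hypothesis ends_cover : forall u v, adj (loc u) (loc v) -> edge_key (loc u) (loc v) = (loc u, loc v) ->
  exists i, ends i = (u, v).
Hypothesis closed_out : forall v x, v \notin U0 -> adj (loc v) x -> exists u, x = loc u.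

Lemma edge_keyC (u v : V) : u != v -> edge_key u v = edge_key v u.
Proof.
move=> uv; rewrite /edge_key; case: ltngtP => // /(pcan_inj pickleK) e.
by rewrite e eqxx in uv.
Qed.

Lemma edge_key_cases (u v : V) : edge_key u v = (u, v) \/ edge_key u v = (v, u).
Proof. by rewrite /edge_key; case: ifP; [left|right]. Qed.

Lemma edge_label v x : v \notin U0 -> adj x (loc v) ->
  exists i, edge_key x (loc v) = key i /\
    ((ends i).1 = v /\ x = loc (ends i).2 \/ (ends i).2 = v /\ x = loc (ends i).1).
Proof.
move=> vU xv; have [u xu] : exists u, x = loc u by apply: closed_out vU _; rewrite adjC.
have xv' : x != loc v by apply: contraTneq xv => ->; exact: adjN.
rewrite xu in xv xv' *.
have [e|e] := edge_key_cases (loc u) (loc v).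
  have [i ei] := ends_cover xv e; exists i; rewrite e /key ei/=; split=> //; by right.
have e' : edge_key (loc v) (loc u) = (loc v, loc u) by rewrite edge_keyC// eq_sym.
rewrite adjC in xv; have [i ei] := ends_cover xv e'.
by exists i; rewrite e /key ei/=; split=> //; left.
Qed.

Lemma ends_neq i : (ends i).1 != (ends i).2.
Proof. by apply/eqP => e; have := ends_adj i; rewrite /key/= e (negbTE (adjN _)). Qed.

Lemma spread_sub i (U : {set W}) : U \subset spread ends i U.
Proof. by rewrite /spread; case: ifP => // _; apply/fintype.subsetP => v vU; rewrite !inE vU !orbT. Qed.

Lemma spreads_sub (U : {set W}) (l : seq {set I}) : U \subset spreads ends U l.
Proof.
elim: l U => [//|b l ih] U /=; apply: fintype.subset_trans (ih _).
by rewrite /slot_step; case: pickP => // i _; exact: spread_sub.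
Qed.

Variables (tau : V * V -> nat -> R) (x0 : V -> R) (g : R -> V -> R) (t : R).
Hypothesis gP : averaging_path adj (fun u v s => rings tau u v s) x0 g.
Hypothesis t0 : 0 < t.
Notation rt i k := (ring_time tau (key i) k).
Hypothesis tau_gt0 : forall i k, 0 < tau (key i) k.
Hypothesis rt_neq : forall i j k k', i != j -> rt i k <> rt j k'.
Hypothesis rt_neq_t : forall i k, rt i k <> t.

Lemma ring_timeS e k : ring_time tau e k.+1 = ring_time tau e k + tau e k.+1.
Proof. by rewrite /ring_time big_ord_recr. Qed.

Lemma ring_time_lt i k k' : (k < k')%N -> rt i k < rt i k'.
Proof.
elim: k' => [//|k' ih]; rewrite ltnS leq_eqVlt ring_timeS => /orP[/eqP ->|/ih h].
  by rewrite ltrDl.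
by apply: lt_trans h _; rewrite ltrDl.
Qed.

Lemma ring_time_gt0 i k : 0 < rt i k.
Proof.
apply: (@lt_le_trans _ _ (rt i 0%N)); first by rewrite /ring_time big_ord1.
by case: k => // k; apply/ltW/ring_time_lt.
Qed.

Lemma ring_time_inj i k k' : rt i k = rt i k' -> k = k'.
Proof. by case: (ltngtP k k') => // /(ring_time_lt i) h e; move: h; rewrite e ltxx. Qed.

Section slotted.
Variables (M : nat) (slot : I -> nat -> nat) (l : seq {set I}).
Hypothesis slot_gt0 : forall i k, (0 < slot i k)%N.
Hypothesis slot_lt_t : forall i k, (slot i k <= M)%N -> rt i k < t.
Hypothesis lt_t_slot : forall i k, rt i k < t -> (slot i k <= M)%N.
Hypothesis slot_mono : forall i k j k', rt i k < t -> rt j k' < t -> rt i k < rt j k' ->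
  (slot i k < slot j k')%N.
Hypothesis size_l : size l = M.
Hypothesis lP : forall j i, (j < M)%N -> (i \in nth finset.set0 l j) <-> exists k, slot i k = j.+1.

Let avg_at j : W -> R := foldl (fun x b => slot_step (average ends) b x) (x0 \o loc) (take j l).
Let dirty j := spreads ends U0 (take j l).

Lemma slotted_inv j : (j <= M)%N -> exists s, [/\ 0 <= s /\ s < t,
  (forall i k, (slot i k <= j)%N -> rt i k <= s),
  (forall i k, rt i k < t -> (j < slot i k)%N -> s < rt i k) &
  (forall v, v \notin dirty j -> g s (loc v) = avg_at j v)].
Proof.
elim: j => [_|j ih jM].
  exists 0; split=> //.
  - by move=> i k; have := slot_gt0 i k; case: slot.
  - by move=> i k _ _; exact: ring_time_gt0.
  - by move=> v _; rewrite /avg_at take0/=; case: gP => ->.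
have {ih} [s [[s0 st] s1 s2 s3]] := ih (ltnW jM).
have bP := lP _ jM; set b := nth _ l j in bP.
have aS : avg_at j.+1 = slot_step (average ends) b (avg_at j).
  by rewrite /avg_at (take_nth finset.set0) ?size_l// foldl_rcons.
have dS : dirty j.+1 = slot_step (spread ends) b (dirty j).
  by rewrite /dirty /spreads (take_nth finset.set0) ?size_l// foldl_rcons.
have [b0|[i ib]] : b = finset.set0 \/ exists i, i \in b.
  by have [->|/set0Pn[i ib]] := eqVneq b finset.set0; [left|right; exists i].
  have noslot i k : slot i k <> j.+1.
    move=> h; have : i \in b by apply/bP; exists k.
    by rewrite b0 inE.
  exists s; split=> //.
  - move=> i k; rewrite leq_eqVlt => /orP[/eqP/noslot//|]; exact: s1.
  - by move=> i k h1 h2; apply: s2 => //; exact: ltnW.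
  - have nostep (X : Type) (f : I -> X -> X) x : slot_step f b x = x.
      by rewrite /slot_step; case: pickP => // i; rewrite b0 eq_sym -finset.cards_eq0 finset.cards1.
    by move=> v; rewrite dS aS !nostep; exact: s3.
have [k kj] : exists k, slot i k = j.+1 by apply/bP.
(* Two distinct edges in one slot would contradict strict monotonicity of slots in ring times,
   because rings of distinct edges never coincide. *)
have bi : b = [set i]%SET.
  apply/finset.setP => i'; rewrite finset.in_set1; apply/idP/eqP => [|-> //].
  move=> /bP[k' kj']; apply/eqP/negPn/negP => ii'.
  have r1 : rt i k < t by apply: slot_lt_t; rewrite kj.
  have r2 : rt i' k' < t by apply: slot_lt_t; rewrite kj'.
  have [h|h|h] := ltgtP (rt i k) (rt i' k').
  - by have := slot_mono r1 r2 h; rewrite kj kj' ltnn.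
  - by have := slot_mono r2 r1 h; rewrite kj kj' ltnn.
  - by apply: (@rt_neq i i' k k') => //; rewrite eq_sym.
rewrite bi slot_step1 in aS; rewrite bi slot_step1 in dS.
set S := rt i k; have St : S < t by apply: slot_lt_t; rewrite kj.
have sS : s < S by apply: s2 => //; rewrite kj.
have S0 : 0 < S by exact: ring_time_gt0.
(* Between [s] and [S] the window sees exactly one ring, the [k]-th of edge [i], at [S] itself. *)
have norings i' k' : s < rt i' k' -> rt i' k' <= S -> i' = i /\ k' = k.
  move=> h1 h2; have [h|h|h] := ltgtP (rt i' k') S.
  - have := slot_mono (lt_trans h St) St h; rewrite kj ltnS => /s1.
    by rewrite leNgt h1.
  - by move: h2; rewrite leNgt h.
  - have ii : i' = i by apply/eqP/negPn/negP => /rt_neq /(_ h).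
    by rewrite ii in h *; split=> //; exact: ring_time_inj h.
exists S; split.
- by split=> //; exact: ltW.
- move=> i' k' sl; rewrite leNgt; apply/negP => h.
  have := slot_mono St (slot_lt_t (leq_trans sl jM)) h; rewrite kj ltnNge.
  by rewrite sl.
- move=> i' k' h1 h2; rewrite ltNge; apply/negP => h3.
  have h4 : s < rt i' k' by apply: s2 => //; exact: ltnW.
  by have [ii kk] := norings i' k' h4 h3; move: h2; rewrite ii kk kj ltnn.
move=> v vd.
have dsub : dirty j \subset dirty j.+1.
  by rewrite dS; exact: spread_sub.
have vd' : v \notin dirty j by apply: contra vd; exact: (fintype.subsetP dsub).
have cleanU0 u : u \notin dirty j -> u \notin U0.
  by apply: contra; exact: (fintype.subsetP (spreads_sub U0 (take j l))).
have const u r : u \notin dirty j -> s <= r -> r < S -> g r (loc u) = g s (loc u).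
  move=> ud sr rS; apply: (averaging_path_const gP s0 sr) => q x sq qr xu [k' k'q].
  have [i' [ek _]] := edge_label (cleanU0 u ud) xu.
  have h1 : s < rt i' k' by rewrite -ek k'q.
  have h2 : rt i' k' <= S by rewrite -ek k'q (le_trans qr)// ltW.
  have [ii kk] := norings i' k' h1 h2.
  by move: k'q qr; rewrite ek ii kk => <-; rewrite leNgt rS.
have lv u : u \notin dirty j -> left_value g (loc u) S (avg_at j u).
  move=> ud; exists (S - s); first by rewrite subr_gt0.
  move=> r r0; rewrite opprB addrC subrK => sr rS.
  by rewrite (const u r ud (ltW sr) rS); exact: s3.
have upd u : v \notin dirty j -> u \notin dirty j -> adj (loc u) (loc v) ->
    edge_key (loc u) (loc v) = key i -> g S (loc v) = (avg_at j v + avg_at j u) / 2.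
  move=> _ ud uv ek; case: gP => _ _ /(_ (loc v) S S0)[a [av [_ h]]].
  rewrite (h (loc u) (avg_at j u) uv _ (lv u ud)); last by exists k; rewrite ek.
  congr ((_ + _) / 2); case: av => e e0 ea.
  pose q := Num.max s (S - e / 2).
  have qS : q < S by rewrite /q gt_max sS/= ltrBlDr ltrDl divr_gt0.
  have sq : s <= q by rewrite /q le_max lexx.
  rewrite -(ea q) ?(const v q)//; first exact: s3.
  - exact: le_trans sq.
  - by rewrite /q lt_max; apply/orP; right; lra.
(* If [v] is an end of [i], being clean after this slot forces both ends to be clean before it, so
   both left values are known. *)
rewrite aS /average; case: ifPn => [vi|].
  have di : ~~ (((ends i).1 \in dirty j) || ((ends i).2 \in dirty j)).
    apply: contra vd; rewrite dS /spread => ->; rewrite !inE.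
    by case/orP: vi => ->; rewrite ?orbT.
  rewrite negb_or in di; case/andP: di => d1 d2.
  have a12 : adj (loc (ends i).1) (loc (ends i).2) := ends_adj i.
  have ek := ends_key i; rewrite /= in ek.
  have ne : loc (ends i).1 != loc (ends i).2.
    by apply: contraTneq a12 => ->; exact: adjN.
  case/orP: vi => /eqP vi.
    rewrite vi; rewrite vi in upd vd'.
    by apply: upd => //; [rewrite adjC|rewrite -edge_keyC].
  rewrite vi addrC; rewrite vi in upd vd'.
  exact: upd.
rewrite negb_or => /andP[v1 v2].
rewrite -(s3 v vd'); apply: (averaging_path_const gP s0 (ltW sS)) => q x sq qS xv [k' k'q].
have [i' [ek vi]] := edge_label (cleanU0 v vd') xv.
have [ii kk] : i' = i /\ k' = k by apply: norings; rewrite -ek k'q.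
by rewrite ii in vi; case: vi => -[vi _]; move: v1 v2; rewrite vi eqxx.
Qed.

Lemma slotted_path v : v \notin spreads ends U0 l ->
  g t (loc v) = foldl (fun x b => slot_step (average ends) b x) (x0 \o loc) l v.
Proof.
move=> vd; have [s [[s0 st] s1 _ s3]] := slotted_inv (leqnn M).
have := s3 v; rewrite /dirty /avg_at take_oversize ?size_l// => /(_ vd) <-.
apply: (averaging_path_const gP s0 (ltW st)) => q x sq qt xv [k' k'q].
have vU : v \notin U0 by apply: contra vd; exact: (fintype.subsetP (spreads_sub U0 l)).
have [i [ek _]] := edge_label vU xv; rewrite ek in k'q.
move: qt; rewrite le_eqVlt => /orP[/eqP qt|qt]; first by apply: (@rt_neq_t i k'); rewrite k'q.
have := s1 i k'; rewrite k'q leNgt sq => h.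
have /lt_t_slot /h // : rt i k' < t by rewrite k'q.
Qed.

End slotted.

End window.

(** * Discretised exponential clocks *)

Section exponential_law.
Context d (T : measurableType d) (R : realType) (P : probability T R).

(** The density is at most one. This gives both the absence of atoms and, below, the rarity of
    coincidences between ring times. *)
Lemma exponential_prob_le (B : set R) : measurable B ->
  (exponential_prob 1 B <= lebesgue_measure B)%E.
Proof.
move=> mB; have -> : lebesgue_measure B = (\int[lebesgue_measure]_(x in B) (1%R)%:E)%E.
  by rewrite integral_cst// mul1e.
apply: ge0_le_integral => //.
- by move=> x _; rewrite lee_fin exponential_pdf_ge0.
- apply/measurable_EFinP; apply: measurable_funTS; exact: measurable_exponential_pdf.
- move=> x _; rewrite lee_fin; have [x0|x0] := leP 0 x.
    by rewrite exponential_pdfE// mul1r mulN1r expR_le1 oppr_le0.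
  by rewrite lt0_exponential_pdf.
Qed.

Lemma exponential_prob_lt0 : exponential_prob 1 (`]-oo, 0%R[ : set R) = 0%E.
Proof.
apply: integral0_eq => x /=; rewrite in_itv/= => x0.
by rewrite lt0_exponential_pdf.
Qed.

Variable Z : T -> R.
Hypothesis mZ : measurable_fun setT Z.
Hypothesis lawZ : forall B, measurable B -> P (Z @^-1` B) = exponential_prob 1 B.

Lemma measurable_preimage (B : set R) : measurable B -> measurable (Z @^-1` B).
Proof. by move=> mB; rewrite -[X in measurable X]setTI; exact: mZ. Qed.

Lemma exponential_law_set1 x : P (Z @^-1` [set x]) = 0%E.
Proof.
apply/eqP; rewrite eq_le measure_ge0 andbT lawZ//.
by rewrite (le_trans (exponential_prob_le _))// lebesgue_measure_set1.
Qed.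

Lemma exponential_law_le0 : P (Z @^-1` `]-oo, 0%R]) = 0%E.
Proof.
have -> : Z @^-1` `]-oo, 0%R] = Z @^-1` `]-oo, 0%R[ `|` Z @^-1` [set 0%R].
  apply/seteqP; split => w /=; rewrite !in_itv/= le_eqVlt.
    by move=> /orP[/eqP|]; [right|left].
  by case=> [->|->]; rewrite ?orbT ?eqxx.
apply: null_set_setU; try exact: measurable_preimage.
  exact: etrans (lawZ (measurable_itv _)) exponential_prob_lt0.
exact: exponential_law_set1.
Qed.

Lemma exponential_law_ge x : 0 <= x -> P (Z @^-1` `[x, +oo[) = (expR (- x))%:E.
Proof.
rewrite le_eqVlt => /orP[/eqP <-|x0].
  rewrite oppr0 expR0.
  have -> : Z @^-1` `[0%R, +oo[ = ~` (Z @^-1` `]-oo, 0%R[).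
    by apply/seteqP; split => w /=; rewrite !in_itv/= andbT leNgt => /negP.
  rewrite probability_setC; last exact: measurable_preimage.
  by rewrite lawZ// exponential_prob_lt0 sube0.
have -> : Z @^-1` `[x, +oo[ = ~` (Z @^-1` `]-oo, 0%R[ `|` Z @^-1` `[0%R, x]) `|` Z @^-1` [set x].
  apply/seteqP; split => w /=; rewrite !in_itv/= andbT.
    rewrite le_eqVlt => /orP[/eqP ->|xw]; [by right|left].
    by move=> [w0|/andP[_]]; [have := lt_trans w0 x0 => /lt_trans /(_ xw); rewrite ltxx|rewrite leNgt xw].
  move=> [h|->//]; rewrite leNgt; apply/negP => wx; apply: h.
  by have [w0|w0] := ltP (Z w) 0; [left|right; rewrite ltW].
have mx := measurable_preimage (measurable_set1 x).
have m0 := measurable_preimage (measurable_itv `]-oo, 0%R[).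
have m1 := measurable_preimage (measurable_itv `[0%R, x]).
transitivity (P (~` (Z @^-1` `]-oo, 0%R[ `|` Z @^-1` `[0%R, x]))).
  by apply: measureU0 mx (exponential_law_set1 x); exact/measurableC/measurableU.
rewrite probability_setC; last exact: measurableU.
have -> : P (Z @^-1` `]-oo, 0%R[ `|` Z @^-1` `[0%R, x]) =
    (P (Z @^-1` `]-oo, 0%R[) + P (Z @^-1` `[0%R, x]))%E.
  apply: measureU => //; apply/seteqP; split => w //= []; rewrite !in_itv/= => w0 /andP[].
  by rewrite leNgt w0.
rewrite !lawZ// exponential_prob_lt0 add0e exponential_prob_itv0c// mulN1r.
by rewrite -EFinB opprB addrC subrK.
Qed.

Variable N : nat.
Hypothesis N0 : (0 < N)%N.
Let rho : R := expR (- N%:R^-1).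

Lemma truncn_ge_itv g : (0 < g)%N ->
  [set y : R | (g <= Num.truncn (N%:R * y))%N] = `[g%:R / N%:R, +oo[%classic.
Proof.
move=> g0; apply/seteqP; split => y /=; rewrite in_itv/= andbT.
  by case: g g0 => // g _; rewrite truncn_gt_nat ler_pdivrMr ?ltr0n// mulrC.
by case: g g0 => // g _; rewrite truncn_gt_nat ler_pdivrMr ?ltr0n// mulrC.
Qed.

Lemma measurable_truncn_ge g : measurable [set y : R | (g <= Num.truncn (N%:R * y))%N].
Proof.
case: g => [|g]; last by rewrite truncn_ge_itv.
rewrite (_ : mkset _ = setT)//; by apply/seteqP; split.
Qed.

Lemma truncn_eq_setD g : [set y : R | Num.truncn (N%:R * y) = g] =
  [set y | (g <= Num.truncn (N%:R * y))%N] `\` [set y | (g.+1 <= Num.truncn (N%:R * y))%N].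
Proof.
apply/seteqP; split => y /=; first by move=> ->; rewrite leqnn ltnn.
by move=> [h1 /negP]; rewrite -leqNgt => h2; apply/eqP; rewrite eqn_leq h1 h2.
Qed.

Lemma measurable_truncn_eq g : measurable [set y : R | Num.truncn (N%:R * y) = g].
Proof. by rewrite truncn_eq_setD; apply: measurableD; exact: measurable_truncn_ge. Qed.

Lemma law_truncn_ge g :
  P (Z @^-1` [set y | (g <= Num.truncn (N%:R * y))%N]) = (rho ^+ g)%:E.
Proof.
case: g => [|g].
  rewrite expr0 (_ : _ @^-1` _ = setT) ?probability_setT//.
  by apply/seteqP; split.
rewrite truncn_ge_itv// exponential_law_ge ?divr_ge0// /rho -expRM_natl.
by rewrite mulrN.
Qed.

Lemma law_truncn_eq g :
  P (Z @^-1` [set y | Num.truncn (N%:R * y) = g]) = (rho ^+ g * (1 - rho))%:E.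
Proof.
have mge g' : measurable (Z @^-1` [set y | (g' <= Num.truncn (N%:R * y))%N]).
  by apply: measurable_preimage; exact: measurable_truncn_ge.
rewrite truncn_eq_setD.
transitivity (P (Z @^-1` [set y | (g <= Num.truncn (N%:R * y))%N]) -
  P (Z @^-1` [set y | (g <= Num.truncn (N%:R * y))%N] `&`
     Z @^-1` [set y | (g.+1 <= Num.truncn (N%:R * y))%N]))%E.
  apply: measureD; [exact: mge|exact: mge|].
  exact: le_lt_trans (probability_le1 P (mge g)) (ltry _).
rewrite setIidr; last by move=> w /=; exact: leq_trans.
by rewrite !law_truncn_ge -EFinB mulrBr mulr1 exprSr.
Qed.

End exponential_law.

(* The condition on the [k]-th inter-arrival time under which the first slots
   are described by [b], given that [g] empty slots have already elapsed. *)
Fixpoint gap_set (R : realType) (N g : nat) (b : seq bool) (k : nat) : set R :=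
  match b with
  | [::] => if k is 0%N then [set y | (g <= Num.truncn (N%:R * y))%N] else setT
  | true :: b' => if k is k'.+1 then gap_set N 0 b' k'
                  else [set y | Num.truncn (N%:R * y) = g]
  | false :: b' => gap_set N g.+1 b' k
  end.

Section gap_set.
Variables (R : realType) (N : nat).
Hypothesis N0 : (0 < N)%N.

Lemma measurable_gap_set g b k : measurable (gap_set N g b k : set R).
Proof.
elim: b g k => [|[] b ih] g [|k] //=; first exact: measurable_truncn_ge.
exact: measurable_truncn_eq.
Qed.

Lemma gap_set0 g b (y : R) : gap_set N g b 0%N y -> (g <= Num.truncn (N%:R * y))%N.
Proof. by elim: b g => [//|[] b ih] g /= => [->//|/ih/ltnW]. Qed.

Lemma gap_set_oversize g b k : (size b < k)%N -> gap_set N g b k = setT :> set R.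
Proof. by elim: b g k => [|[] b ih] g [|k] //=; rewrite ltnS => h; rewrite ih// ltnW. Qed.

(** A prescribed pattern of slots constrains each gap separately, so the event is a rectangle in the
    gaps and independence applies. *)
Lemma bits_gap_set (y : nat -> R) g b :
  (g <= Num.truncn (N%:R * y 0%N))%N ->
  bits (fun k => Num.truncn (N%:R * y k)) g (size b) = b <->
  forall k, (k <= size b)%N -> gap_set N g b k (y k).
Proof.
move=> gy; suff : bits (fun k => Num.truncn (N%:R * y k)) g (size b) = b <->
    forall k, gap_set N g b k (y k).
  move=> ->; split=> h k; first by move=> _; exact: h.
  by have [/h//|kb] := leqP k (size b); rewrite gap_set_oversize.
elim: b y g gy => [|[] b ih] y g gy /=.
- by split=> // _ [|k].
- case: eqP => [e|e].
    have ihb := ih (fun k => y k.+1) 0%N (leq0n _).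
    split=> [[/ihb h] [|k]//|h].
    by congr (_ :: _); apply/ihb => k; exact: (h k.+1).
  by split=> // h; have := h 0%N.
- case: eqP => [e|/eqP e].
    split=> // h; have := gap_set0 (h 0%N); by rewrite e ltnn.
  have gy' : (g < Num.truncn (N%:R * y 0%N))%N by rewrite ltn_neqAle eq_sym e.
  by have ihb := ih y g.+1 gy'; split=> [[/ihb]//|/ihb ->].
Qed.

(** Memorylessness: a rounded exponential gap is geometric, so a product over gaps regroups as a
    product over slots with one Bernoulli factor each. The unfinished last gap has a tail
    probability, and the gaps after it contribute [1]. *)
Lemma prod_gap_set (mu : set R -> \bar R) (rho : R) g b n :
  (forall g, mu [set y | (g <= Num.truncn (N%:R * y))%N] = (rho ^+ g)%:E) ->
  (forall g, mu [set y | Num.truncn (N%:R * y) = g] = (rho ^+ g * (1 - rho))%:E) ->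
  mu setT = 1%E -> (size b < n)%N ->
  (\prod_(k < n) mu (gap_set N g b k) =
   (rho ^+ g * \prod_(x <- b) (if x then 1 - rho else rho))%:E)%E.
Proof.
move=> mge meq mT; elim: b g n => [|[] b ih] g [//|n] /= bn.
- rewrite big_ord_recl/= mge big1 ?mule1 ?big_nil ?mulr1//.
- by rewrite big_ord_recl/= meq ih// big_cons expr0 mul1r -EFinM mulrA.
- by rewrite ih 1?ltnW// big_cons exprSr mulrA.
Qed.

End gap_set.

(** * Joint law of the opinions and the slots *)

Lemma iterE_tuple (R : realType) (S : finType) (w : S -> R) n (F : seq S -> R) :
  iterE w n F = \sum_(t : n.-tuple S) (\prod_(s <- t) w s) * F t.
Proof.
elim: n F => [|n ih] F /=.
  rewrite (big_pred1 [tuple]) => [|t]; last by apply/esym/eqP; exact: tuple0.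
  by rewrite big_nil mul1r.
pose h (p : S * n.-tuple S) : n.+1.-tuple S := cons_tuple p.1 p.2.
rewrite (reindex h)/=; last first.
  exists (fun t => (thead t, behead_tuple t)) => [[s t] _|t _]/=.
    by congr (_, _); apply/val_inj.
  by rewrite [RHS]tuple_eta.
rewrite -(pair_big xpredT xpredT (fun s (t : n.-tuple S) =>
  (\prod_(s0 <- s :: t) w s0) * F (s :: t)))/=.
apply: eq_bigr => s _; rewrite ih mulr_sumr; apply: eq_bigr => t _.
by rewrite big_cons mulrA.
Qed.

Section finite_valued.
Context d (T : measurableType d) (R : realType) (P : probability T R).
Variables (Y : finType) (Z : T -> Y).
Hypothesis mZ : forall y, measurable (Z @^-1` [set y]).

Lemma finite_valuedE (F : Y -> R) w :
  F (Z w) = \sum_y F y * \1_(Z @^-1` [set y]) w.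
Proof.
rewrite (bigD1 (Z w))//= indicE mem_set// mulr1 big1 ?addr0// => y yZ.
by rewrite indicE memNset ?mulr0//= => e; rewrite e eqxx in yZ.
Qed.

Lemma measurable_finite_valued (F : Y -> R) : measurable_fun setT (fun w => F (Z w)).
Proof.
rewrite (_ : (fun w => _) = (fun w => \sum_y F y * \1_(Z @^-1` [set y]) w)); last first.
  by apply/funext => w; exact: finite_valuedE.
by apply: measurable_sum => y; apply: measurable_funM.
Qed.

Lemma integral_finite_valued (F : Y -> R) (q : Y -> R) : (forall y, 0 <= F y) ->
  (forall y, P (Z @^-1` [set y]) = (q y)%:E) ->
  (\int[P]_w (F (Z w))%:E = (\sum_y q y * F y)%:E)%E.
Proof.
move=> F0 qP.
under eq_integral do rewrite finite_valuedE -sumEFin.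
rewrite ge0_integral_sum//; last first.
- by move=> y w _; rewrite lee_fin mulr_ge0.
- by move=> y; apply/measurable_EFinP; apply: measurable_funM.
rewrite -sumEFin; apply: eq_bigr => y _.
under eq_integral do rewrite EFinM.
rewrite ge0_integralZl ?lee_fin//; last exact/measurable_EFinP/measurable_indic.
rewrite integral_indic// setIT mulrC EFinM; congr (_ * _)%E; exact: qP.
Qed.

End finite_valued.

Section cells.
Variables (R : realType) (N : nat).
Hypothesis N0 : (0 < N)%N.

(* Discretisation of the line at scale [1/N], truncated to [[-N, N]]. *)
Definition cell (y : R) : 'I_(2 * N ^ 2).+1 :=
  inord (Num.truncn (N%:R * (clamp N%:R y + N%:R))).

Definition cell_val (i : 'I_(2 * N ^ 2).+1) : R := i%:R / N%:R - N%:R.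

Lemma measurable_clamp (L : R) : measurable_fun setT (clamp L).
Proof.
apply: (@measurable_maxr _ _ R setT (fun=> - L)) => //.
exact: (@measurable_minr _ _ R setT (fun=> L)).
Qed.

Lemma measurable_cell i : measurable (cell @^-1` [set i]).
Proof.
pose h (y : R) := N%:R * (clamp N%:R y + N%:R).
have mh : measurable_fun setT h.
  by apply: measurable_funM => //; apply: measurable_funD => //; exact: measurable_clamp.
have mge m : measurable [set y | (m <= Num.truncn (h y))%N].
  case: m => [|m].
    by rewrite (_ : mkset _ = setT)//; apply/seteqP; split.
  rewrite (_ : mkset _ = h @^-1` `[m.+1%:R, +oo[%classic); last first.
    by apply/seteqP; split => y /=; rewrite in_itv/= andbT truncn_gt_nat.
  by rewrite -[X in measurable X]setTI; exact: mh.
have -> : cell @^-1` [set i] =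
    \bigcup_(m in [set m | inord m = i]) [set y | Num.truncn (h y) = m].
  apply/seteqP; split => y /=; first by move=> e; exists (Num.truncn (h y)).
  by move=> [m /= mi hm]; rewrite /cell -/(h y) hm.
apply: bigcup_measurable => m _.
rewrite (_ : mkset _ = [set y | (m <= Num.truncn (h y))%N] `\`
                       [set y | (m.+1 <= Num.truncn (h y))%N]); first exact: measurableD.
apply/seteqP; split => y /=; first by move=> ->; rewrite leqnn ltnn.
by move=> [h1 /negP]; rewrite -leqNgt => h2; apply/eqP; rewrite eqn_leq h1 h2.
Qed.

Lemma cell_valK y : clamp N%:R y - N%:R^-1 <= cell_val (cell y) <= clamp N%:R y.
Proof.
have n0 : 0 < N%:R :> R by rewrite ltr0n.
have := @clamp_le R N%:R y (ltW n0); rewrite ler_norml => /andP[h1 h2].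
have c0 : 0 <= N%:R * (clamp N%:R y + N%:R) by rewrite mulr_ge0//; lra.
have /andP[t1 t2] := truncn_itv c0.
rewrite /cell_val /cell inordK; last first.
  rewrite ltnS -(ler_nat R) (le_trans t1)// natrM natrX expr2 mulrCA ler_pM2l//; lra.
move: t1 t2; set m := Num.truncn _; rewrite -natr1 => t1 t2.
have e : m%:R = N%:R * (m%:R / N%:R) :> R by field; rewrite gt_eqF.
rewrite e in t1 t2; rewrite ler_pM2l// in t1.
have {}t2 : N%:R * (clamp N%:R y + N%:R) < N%:R * (m%:R / N%:R + N%:R^-1).
  by rewrite [ltRHS]mulrDr divff ?gt_eqF.
by rewrite ltr_pM2l// in t2; apply/andP; split; lra.
Qed.

End cells.

Section joint_law.
Context d (T : measurableType d) (R : realType) (P : probability T R).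
Variables (V : countType) (adj : rel V) (W I : finType) (loc : W -> V) (ends : I -> W * W).
Variables (f0 : V -> T -> R) (tau : V * V -> nat -> T -> R).
Notation key := (key loc ends).
Hypothesis loc_inj : injective loc.
Hypothesis key_inj : injective key.
Hypothesis key_index : forall i, adj (key i).1 (key i).2 /\ edge_key (key i).1 (key i).2 = key i.
Hypothesis mf0 : forall v, measurable_fun setT (f0 v).
Hypothesis f0_id : forall u v B, measurable B -> P (f0 u @^-1` B) = P (f0 v @^-1` B).
Hypothesis mtau : forall e n, measurable_fun setT (tau e n).
Hypothesis law_tau : forall e n B, measurable B -> P (tau e n @^-1` B) = exponential_prob 1 B.
Hypothesis indep : mutually_independent P (process_indices adj)
  (fun i => match i with inl v => f0 v | inr (e, n) => tau e n end).

Definition slots_at (N M : nat) (w : T) : M.-tuple {set I} :=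
  map_tuple (fun j => [set i | nth false
    (bits (fun k => Num.truncn (N%:R * tau (key i) k w)) 0 M) j]%SET) (iota_tuple M 0).

Definition states_at (N : nat) (w : T) : #|W|.-tuple 'I_(2 * N ^ 2).+1 :=
  map_tuple (fun v => cell N (f0 (loc v) w)) (enum_tuple W).

Variable v0 : V.

Definition cell_weight (N : nat) (s : 'I_(2 * N ^ 2).+1) : R :=
  fine (P (f0 v0 @^-1` (cell N @^-1` [set s]))).

Variables (N M : nat).
Hypothesis N0 : (0 < N)%N.

Let mpre (f : T -> R) (B : set R) : measurable_fun setT f -> measurable B -> measurable (f @^-1` B).
Proof. by move=> mf mB; rewrite -[X in measurable X]setTI; exact: mf. Qed.

Lemma cell_weightE v (s : 'I_(2 * N ^ 2).+1) : P (f0 v @^-1` (cell N @^-1` [set s])) = (cell_weight s)%:E.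
Proof.
have mc : measurable (cell N @^-1` [set s] : set R) by exact: measurable_cell.
rewrite (f0_id v v0 mc) /cell_weight fineK// fin_num_measure//; exact: mpre.
Qed.

Lemma cell_weight_ge0 (s : 'I_(2 * N ^ 2).+1) : 0 <= cell_weight s.
Proof. exact/fine_ge0/measure_ge0. Qed.

Lemma states_atP w (a : #|W|.-tuple 'I_(2 * N ^ 2).+1) :
  states_at N w = a <-> forall v, cell N (f0 (loc v) w) = tnth a (enum_rank v).
Proof.
have e v : tnth (enum_tuple W) (enum_rank v) = v.
  by rewrite (tnth_nth v)/= nth_enum_rank.
split=> [<- v|h]; first by rewrite tnth_map e.
by apply: eq_from_tnth => j; rewrite tnth_map -(enum_valK j) e h.
Qed.

Lemma slots_atP w (l : M.-tuple {set I}) :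
  slots_at N M w = l <-> forall i,
  bits (fun k => Num.truncn (N%:R * tau (key i) k w)) 0 M = [seq i \in b | b : {set I} <- l].
Proof.
split=> [<- i|h].
  apply: (@eq_from_nth _ false); first by rewrite size_bits !size_map size_iota.
  move=> j; rewrite size_bits => jM.
  by rewrite -map_comp (nth_map 0%N) ?size_iota//= nth_iota// inE.
apply/val_inj/(@eq_from_nth _ finset.set0); first by rewrite size_map size_iota size_tuple.
move=> j; rewrite size_map size_iota => jM.
rewrite (nth_map 0%N) ?size_iota//= nth_iota//; apply/finset.setP => i; rewrite inE h.
by rewrite (nth_map finset.set0)// size_tuple.
Qed.

(** Each gap occupies at least one slot, so [M] slots involve at most [M + 1] gaps, the last of them
    unfinished. *)
Let F : seq (V + (V * V * nat)) :=
  [seq inl (loc v) | v <- enum W] ++ [seq inr (key i, k) | i <- enum I, k <- iota 0 M.+1].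

Let uniqF : uniq F.
Proof.
rewrite cat_uniq map_inj_uniq ?enum_uniq ?andTb; last by move=> u v [/loc_inj].
apply/andP; split.
  by apply/hasPn => x xF; have [[i k] [_ _ ->]] := allpairsP xF; apply/negP => /mapP[].
apply: allpairs_uniq; rewrite ?enum_uniq ?iota_uniq//.
move=> [i k] [i' k'] _ _ /= e.
have [/key_inj -> -> //] : key i = key i' /\ k = k'.
by case: e => e1 e2 e3; split=> //; rewrite /key e1 e2.
Qed.

Let B (l : M.-tuple {set I}) (a : #|W|.-tuple 'I_(2 * N ^ 2).+1) (x : V + (V * V * nat)) : set R :=
  match x with
  | inl u => if [pick v | loc v == u] is Some v then cell N @^-1` [set tnth a (enum_rank v)] else setT
  | inr (e, k) => if [pick i | key i == e] is Some i
                  then gap_set N 0 [seq i \in b | b : {set I} <- l] k else setT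
  end.

Let B_inl l a v : B l a (inl (loc v)) = cell N @^-1` [set tnth a (enum_rank v)].
Proof. by rewrite /B; case: pickP => [u /eqP/loc_inj ->//|/(_ v)]; rewrite eqxx. Qed.

Let B_inr l a i k : B l a (inr (key i, k)) = gap_set N 0 [seq i \in b | b : {set I} <- l] k.
Proof. by rewrite /B; case: pickP => [j /eqP/key_inj ->//|/(_ i)]; rewrite eqxx. Qed.

Let fam (x : V + (V * V * nat)) : T -> R :=
  match x with inl v => f0 v | inr (e, n) => tau e n end.

(** A finite intersection of events on distinct members of the independent family, which is the form
    in which mutual independence is stated. *)
Let event_rect l a : [set w | (slots_at N M w, states_at N w) = (l, a)] =
  \big[setI/setT]_(x <- F) (fam x @^-1` B l a x).
Proof.
rewrite -bigcap_seq; apply/seteqP; split => w /=.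
  move=> [/slots_atP hl /states_atP ha] x /=; rewrite mem_cat => /orP[/mapP[v _ ->]|].
    by rewrite B_inl /= ha.
  move=> /allpairsP[[i k] [_ kM ->]]; rewrite B_inr.
  have {}kM : (k <= M)%N by move: kM; rewrite mem_iota add0n ltnS.
  have := hl i; have sz : size [seq i \in b | b : {set I} <- l] = M by rewrite size_map size_tuple.
  rewrite -{1}sz => /bits_gap_set; apply => //.
  by rewrite sz.
move=> h; congr (_, _).
  apply/slots_atP => i.
  have sz : size [seq i \in b | b : {set I} <- l] = M by rewrite size_map size_tuple.
  rewrite -{1}sz; apply/bits_gap_set => // k; rewrite sz => kM.
  rewrite -(B_inr l a); apply: (h (inr (key i, k))); rewrite /= mem_cat; apply/orP; right.
  by apply/allpairsP; exists (i, k); split; rewrite ?mem_enum ?mem_iota.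
apply/states_atP => v.
have := h (inl (loc v)); rewrite B_inl; apply; rewrite /= mem_cat; apply/orP; left.
by apply/mapP; exists v => //; rewrite mem_enum.
Qed.

Let mB l a x : measurable (B l a x).
Proof.
case: x => [u|[e k]] /=; case: pickP => // i _; first exact: measurable_cell.
exact: measurable_gap_set.
Qed.

Lemma measurable_joint_event l a :
  measurable [set w | (slots_at N M w, states_at N w) = (l, a)].
Proof.
rewrite event_rect; apply: bigsetI_measurable => x _.
by apply: mpre (mB l a x); case: x => [v|[e k]] /=.
Qed.

Lemma joint_law l a :
  P [set w | (slots_at N M w, states_at N w) = (l, a)] =
  ((\prod_(b <- l) slot_weight (1 - expR (- N%:R^-1)) b) * \prod_(s <- a) cell_weight s)%:E.
Proof.
rewrite event_rect (indep uniqF) //; last first.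
  move=> x; rewrite mem_cat => /orP[/mapP[v _ ->]//|].
  by move=> /allpairsP[[i k] [_ _ ->]]; exact: key_index.
transitivity ((\prod_(x <- [seq inl (loc v) | v <- enum W]) P (fam x @^-1` B l a x)) *
    \prod_(x <- [seq inr (key i, k) | i <- enum I, k <- iota 0 M.+1]) P (fam x @^-1` B l a x))%E.
  exact: big_cat.
rewrite muleC EFinM; congr (_ * _)%E.
  rewrite big_allpairs_dep big_enum.
  pose c (b : {set I}) i : R := if i \in b then 1 - expR (- N%:R^-1)
    else 1 - (1 - expR (- N%:R^-1)).
  transitivity (\prod_(i : I) (\prod_(b <- l) c b i)%R%:E)%E.
    apply: eq_bigr => i _.
    rewrite -[iota 0 M.+1]/(index_iota 0 M.+1) big_mkord.
    transitivity (\prod_(k < M.+1) exponential_prob 1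
        (gap_set N 0 [seq i \in b | b : {set I} <- l] k : set R))%E.
      by apply: eq_bigr => k _; rewrite B_inr /fam law_tau//; exact: measurable_gap_set.
    rewrite (@prod_gap_set R N (exponential_prob 1) (expR (- N%:R^-1))).
    - rewrite expr0 mul1r big_map; congr (_%:E); apply: eq_bigr => b _; rewrite /c; case: ifP => // _.
      by rewrite opprB addrC subrK.
    - move=> g; rewrite -(law_tau (key i) 0); last exact: measurable_truncn_ge.
      by apply: law_truncn_ge => //; exact: law_tau.
    - move=> g; rewrite -(law_tau (key i) 0); last exact: measurable_truncn_eq.
      by apply: law_truncn_eq => //; exact: law_tau.
    - by rewrite -(law_tau (key i) 0)// preimage_setT probability_setT.
    - by rewrite size_map size_tuple.
  by rewrite prodEFin exchange_big.
rewrite big_map big_enum.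
transitivity (\prod_(v : W) (cell_weight (tnth a (enum_rank v)))%:E)%E.
  by apply: eq_bigr => v _; rewrite B_inl /fam cell_weightE.
rewrite prodEFin; congr (_%:E); rewrite big_tuple (reindex (@enum_rank W))//.
exact: onW_bij (enum_rank_bij W).
Qed.

Lemma cell_weight_sum1 : \sum_(s : 'I_(2 * N ^ 2).+1) cell_weight s = 1.
Proof.
have mC s : measurable (f0 v0 @^-1` (cell N @^-1` [set s])).
  by apply: mpre => //; exact: measurable_cell.
have := @integral_finite_valued _ T R P _ (cell N \o f0 v0) mC (fun=> 1) (@cell_weight N)
  (fun=> ler01) (cell_weightE v0).
rewrite integral_cst// mul1e; under [in X in _ = X -> _]eq_bigr do rewrite mulr1.
by move=> e; have := etrans (esym e) (probability_setT P) => -[].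
Qed.

Lemma integral_cells (h : R -> R) : (forall s : 'I_(2 * N ^ 2).+1, 0 <= h (cell_val R s)) ->
  (\int[P]_w (h (cell_val R (cell N (f0 v0 w))))%:E = (\sum_(s : 'I_(2 * N ^ 2).+1) cell_weight s * h (cell_val R s))%:E)%E.
Proof.
have mC s : measurable (f0 v0 @^-1` (cell N @^-1` [set s])).
  by apply: mpre => //; exact: measurable_cell.
move=> h0; exact: (@integral_finite_valued _ T R P _ (cell N \o f0 v0) mC (fun s => h (cell_val R s))
  (@cell_weight N) h0 (cell_weightE v0)).
Qed.

Lemma integral_joint (H : seq {set I} -> seq 'I_(2 * N ^ 2).+1 -> R) :
  (forall l a, 0 <= H l a) ->
  (\int[P]_w (H (slots_at N M w) (states_at N w))%:E =
   (iterE (slot_weight (1 - expR (- N%:R^-1))) M (fun l => iterE (@cell_weight N) #|W| (H l)))%:E)%E.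
Proof.
move=> H0.
rewrite (@integral_finite_valued _ T R P _ (fun w => (slots_at N M w, states_at N w)) _
  (fun y => H y.1 y.2) (fun y => (\prod_(b <- y.1) slot_weight (1 - expR (- N%:R^-1)) b)
    * \prod_(s <- y.2) cell_weight s)).
- congr (_%:E); rewrite iterE_tuple.
  rewrite -(pair_big xpredT xpredT (fun (l : M.-tuple {set I}) (a : #|W|.-tuple 'I_(2 * N ^ 2).+1) =>
    (\prod_(b <- l) slot_weight (1 - expR (- N%:R^-1)) b) * (\prod_(s <- a) cell_weight s) * H l a))/=.
  apply: eq_bigr => l _; rewrite iterE_tuple mulr_sumr.
  by apply: eq_bigr => a _; rewrite mulrA.
- by move=> [l a]; exact: measurable_joint_event.
- by [].
- by move=> [l a]; exact: joint_law.
Qed.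

Lemma measurable_joint (H : seq {set I} -> seq 'I_(2 * N ^ 2).+1 -> R) :
  measurable_fun setT (fun w => H (slots_at N M w) (states_at N w)).
Proof.
apply: (@measurable_finite_valued _ T R _ (fun w => (slots_at N M w, states_at N w)) _
  (fun y => H y.1 y.2)).
by move=> [l a]; exact: measurable_joint_event.
Qed.

End joint_law.

(** * Almost sure exactness of the discretisation *)

Lemma measure_bigsetU_le d (T : measurableType d) (R : realType) (P : probability T R)
    (I : Type) (s : seq I) (A : I -> set T) : (forall i, measurable (A i)) ->
  (P (\big[setU/set0]_(i <- s) A i) <= \sum_(i <- s) P (A i))%E.
Proof.
move=> mA; elim: s => [|i s ih]; first by rewrite !big_nil measure0.
rewrite !big_cons; apply: le_trans (measureU2 _ (mA i) _) _.
  by apply: bigsetU_measurable.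
exact: leeD2l.
Qed.

Lemma negligible_le_inv d (T : measurableType d) (R : realType) (P : probability T R)
    (E : set T) (B : nat -> set T) (c : R) : (forall n, measurable (B n)) ->
  (forall n, E `<=` B n) -> (forall n, (P (B n) <= (c / n.+1%:R)%:E)%E) -> P.-negligible E.
Proof.
move=> mB EB PB; exists (\bigcap_n B n); split.
- exact: bigcapT_measurable.
- apply/eqP; rewrite eq_le measure_ge0 andbT; apply/lee_addgt0Pr => e e0; rewrite add0e.
  have [n cn] : exists n, c / n.+1%:R <= e.
    exists (Num.truncn (`|c| / e)); rewrite ler_pdivrMr// mulrC -ler_pdivrMr//.
    by rewrite (le_trans _ (ltW (truncnS_gt _)))// ler_pM2r ?invr_gt0// ler_norm.
  apply: (@le_trans _ _ (P (B n))).
    by apply: le_measure; rewrite ?inE//; [exact: bigcapT_measurable|exact: bigcap_inf].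
  by apply: le_trans (PB n) _; rewrite lee_fin.
- by move=> w Ew n _; exact: EB.
Qed.

(** * Affine coincidences between independent exponential variables *)

Section coincidence.
Context d (T : measurableType d) (R : realType) (P : probability T R).
Variables (Ix : choiceType) (D : set Ix) (X : Ix -> T -> R).
Hypothesis indep : mutually_independent P D X.
Variables (J : finType) (e : J -> Ix) (i0 : Ix).
Hypothesis e_inj : injective e.
Hypothesis e_i0 : forall j, e j != i0.
Hypothesis D0 : D i0.
Hypothesis De : forall j, D (e j).
Hypothesis mX0 : measurable_fun setT (X i0).
Hypothesis mXe : forall j, measurable_fun setT (X (e j)).
Hypothesis law0 : forall B, measurable B -> P (X i0 @^-1` B) = exponential_prob 1 B.
Hypothesis lawe : forall j B, measurable B -> P (X (e j) @^-1` B) = exponential_prob 1 B.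
Variables (c : J -> R) (t : R).
Hypothesis c1 : forall j, `|c j| <= 1.

Let F : seq Ix := i0 :: [seq e j | j <- enum J].

Let uniqF : uniq F.
Proof.
rewrite /= map_inj_uniq// enum_uniq andbT; apply/negP => /mapP[j _ ij].
by move: (e_i0 j); rewrite ij eqxx.
Qed.

(** Knowing each [X (e j)] up to [1 / N], with coefficients at most one in absolute value, locates
    the combination within [|J| / N]. *)
Let itv0 (N : nat) (G : J -> nat) : set R :=
  `[t + \sum_j c j * ((G j)%:R / N%:R) - #|J|%:R / N%:R,
    t + \sum_j c j * ((G j)%:R / N%:R) + #|J|%:R / N%:R].

Let B (N : nat) (G : J -> nat) (i : Ix) : set R :=
  if i == i0 then itv0 N G
  else if [pick j | e j == i] is Some j then [set y | Num.truncn (N%:R * y) = G j] else setT.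

Let rect N G := \big[setI/setT]_(i <- F) (X i @^-1` B N G i).

Let B0 N G : B N G i0 = itv0 N G. Proof. by rewrite /B eqxx. Qed.

Let Be N G j : B N G (e j) = [set y | Num.truncn (N%:R * y) = G j].
Proof.
rewrite /B (negbTE (e_i0 j)); case: pickP => [k /eqP/e_inj ->//|/(_ j)].
by rewrite eqxx.
Qed.

Let mB N G i : (0 < N)%N -> measurable (B N G i).
Proof.
move=> N0; rewrite /B; case: ifP => _; first exact: measurable_itv.
by case: pickP => // j _; exact: measurable_truncn_eq.
Qed.

Let mrect N G : (0 < N)%N -> measurable (rect N G).
Proof.
move=> N0; rewrite /rect big_cons; apply: measurableI.
  by rewrite -[X in measurable X]setTI; apply: mX0 => //; exact: mB.
rewrite big_map; apply: bigsetI_measurable => j _.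
by rewrite -[X in measurable X]setTI; apply: mXe => //; exact: mB.
Qed.

Let P_rect N G : (0 < N)%N ->
  (P (rect N G) <= (2 * #|J|%:R / N%:R *
    \prod_j (expR (- N%:R^-1) ^+ G j * (1 - expR (- N%:R^-1))))%:E)%E.
Proof.
move=> N0; rewrite /rect (indep uniqF); last 2 first.
- by move=> i; rewrite inE => /orP[/eqP ->//|/mapP[j _ ->]].
- by move=> i; exact: mB.
rewrite big_cons big_map big_enum/= EFinM.
have -> : (\prod_(j : J) P (X (e j) @^-1` B N G (e j)) =
    (\prod_j (expR (- N%:R^-1) ^+ G j * (1 - expR (- N%:R^-1))))%R%:E)%E.
  rewrite -prodEFin; apply: eq_bigr => j _; rewrite Be.
  by apply: law_truncn_eq => //; exact: lawe.
apply: lee_wpmul2r.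
  rewrite lee_fin; apply: prodr_ge0 => j _; apply: mulr_ge0.
    exact/exprn_ge0/expR_ge0.
  by rewrite subr_ge0 expR_le1 oppr_le0 invr_ge0.
rewrite B0 law0; last exact: measurable_itv.
apply: le_trans (exponential_prob_le _) _; first exact: measurable_itv.
have h : 0 <= #|J|%:R / N%:R :> R by rewrite divr_ge0.
rewrite /itv0 lebesgue_measure_itv/=; case: ifP => _; last by rewrite lee_fin mulr_ge0// mulr_ge0.
by rewrite -EFinB lee_fin; lra.
Qed.

Let E m := [set w | X i0 w = t + \sum_j c j * X (e j) w /\ forall j, 0 <= X (e j) w < m%:R].

Let cover N m := \big[setU/set0]_(g : {ffun J -> 'I_(m * N)}) rect N (fun j => g j).

Let E_cover N m : (0 < N)%N -> E m `<=` cover N m.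
Proof.
move=> N0 w [wE wm]; have n0 : 0 < N%:R :> R by rewrite ltr0n.
have lt j : (Num.truncn (N%:R * X (e j) w) < m * N)%N.
  have /andP[w0 wlt] := wm j.
  by rewrite truncn_lt_nat ?mulr_ge0 ?(ltW n0)// natrM mulrC ltr_pM2r.
pose g := [ffun j => Ordinal (lt j)].
rewrite /cover -bigcup_seq; exists g; first by rewrite /= mem_index_enum.
rewrite /rect -bigcap_seq => i /=; rewrite inE => /orP[/eqP ->|/mapP[j _ ->]].
  rewrite B0 /itv0 /= in_itv/=.
  have : `|X i0 w - (t + \sum_j c j * ((g j)%:R / N%:R))| <= #|J|%:R / N%:R.
    rewrite wE opprD addrACA subrr add0r -sumrB.
    apply: le_trans (ler_norm_sum _ _ _) _.
    rewrite (_ : #|J|%:R / N%:R = \sum_(j : J) N%:R^-1); last first.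
      by rewrite sumr_const -[RHS]mulr_natl.
    apply: ler_sum => j _; rewrite -mulrBr normrM.
    rewrite -[leRHS]mul1r; apply: ler_pM => //; rewrite ffunE/=.
    have /andP[w0 _] := wm j.
    have /andP[t1 t2] := truncn_itv (mulr_ge0 (ltW n0) w0).
    move: t1 t2; set k := Num.truncn _; rewrite -natr1 => t1 t2.
    have k1 : k%:R / N%:R <= X (e j) w by rewrite ler_pdivrMr// mulrC.
    rewrite ger0_norm ?subr_ge0// lerBlDl -[X in _ + X]mul1r -mulrDl ler_pdivlMr//.
    by rewrite mulrC ltW.
  by rewrite ler_distl => /andP[-> ->].
by rewrite Be /= ffunE.
Qed.

Let P_cover N m : (0 < N)%N -> (P (cover N m) <= (2 * #|J|%:R / N%:R)%:E)%E.
Proof.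
move=> N0; apply: le_trans (measure_bigsetU_le _ _ _) _; first by move=> g; exact: mrect.
set rho := expR (- N%:R^-1) : R.
have r0 : 0 <= rho by exact: expR_ge0.
apply: (@le_trans _ _ (\sum_(g : {ffun J -> 'I_(m * N)})
    (2 * #|J|%:R / N%:R * \prod_j (rho ^+ g j * (1 - rho)))%:E)%E).
  by apply: lee_sum => g _; exact: P_rect.
rewrite sumEFin lee_fin -mulr_sumr.
rewrite -(bigA_distr_bigA (fun (j : J) (s : 'I_(m * N)) => rho ^+ s * (1 - rho))).
rewrite -[leRHS]mulr1; apply: ler_wpM2l; first by rewrite mulr_ge0 ?invr_ge0// mulr_ge0.
rewrite -[leRHS](expr1n _ #|J|) -prodr_const; apply: ler_prod => j _.
rewrite -mulr_suml mulrC.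
have -> : (1 - rho) * \sum_(s < m * N) rho ^+ s = 1 - rho ^+ (m * N).
  rewrite -[X in X - rho ^+ _](expr1n _ (m * N)) subrXX; congr (_ * _).
  by apply: eq_bigr => s _; rewrite expr1n mul1r.
by rewrite subr_ge0 exprn_ile1 ?expR_le1 ?oppr_le0 ?invr_ge0// gerBl exprn_ge0.
Qed.

(** Discretise the [X (e j)] at scale [1 / N]. On each cell [X i0] must fall in an interval of
    length [2 |J| / N], of probability at most that length, and the cell probabilities add up to at
    most one. The bound [m] on the [X (e j)] leaves finitely many cells, and [N] tends to
    infinity. *)
Lemma ae_no_coincidence :
  {ae P, forall w, (forall j, 0 < X (e j) w) -> X i0 w <> t + \sum_j c j * X (e j) w}.
Proof.
have : {ae P, forall w, forall m, ~ E m w}.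
  apply: ae_foralln => m; rewrite /almost_everywhere/=.
  apply: (@negligible_le_inv _ _ _ P _ (fun n => cover n.+1 m) (2 * #|J|%:R)).
  - by move=> n; apply: bigsetU_measurable => g _; exact: mrect.
  - by move=> n w /contrapT; exact: E_cover.
  - by move=> n; exact: P_cover.
apply: filterS => w nE Xpos wE.
pose m := (\max_j (Num.truncn (X (e j) w)).+1)%N.
apply: (nE m); split=> // j; rewrite (ltW (Xpos j))/=.
by rewrite (lt_le_trans (truncnS_gt _))// ler_nat; exact: leq_bigmax.
Qed.

End coincidence.

Lemma arrival_bounds (R : realType) (y : nat -> R) (N k : nat) : (forall j, 0 <= y j) ->
  N%:R * (\sum_(j < k.+1) y j) < (arrival (fun j => Num.truncn (N%:R * y j)) k)%:R /\
  (arrival (fun j => Num.truncn (N%:R * y j)) k)%:R <= N%:R * (\sum_(j < k.+1) y j) + k.+1%:R.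
Proof.
move=> y0; have t j : (Num.truncn (N%:R * y j))%:R <= N%:R * y j < (Num.truncn (N%:R * y j)).+1%:R.
  by apply: truncn_itv; rewrite mulr_ge0.
rewrite /arrival natr_sum mulr_sumr; split.
  apply: ltr_sum => [|j _]; first by apply/hasP; exists ord0; rewrite ?mem_index_enum.
  by have /andP[] := t j.
have -> : k.+1%:R = \sum_(j < k.+1) 1 :> R by rewrite sumr_const card_ord.
rewrite -big_split/=.
by apply: ler_sum => j _; rewrite -natr1 lerD2r; have /andP[] := t j.
Qed.

Section eventually.
Variables (R : realType) (V : countType) (W I : finType) (loc : W -> V) (ends : I -> W * W).
Variables (tau : V * V -> nat -> R) (t : R).
Notation key := (key loc ends).
Notation rt i k := (ring_time tau (key i) k).
Notation slot n i k := (arrival (fun j => Num.truncn (n.+1%:R * tau (key i) j)) k).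
Hypothesis tau_gt0 : forall i k, 0 < tau (key i) k.
Hypothesis tau_unbounded : forall i (m : nat), exists k, m%:R < tau (key i) k.
Hypothesis t0 : 0 < t.

(** The slot of the [k]-th ring exceeds [N] times its time by at most [k + 1]. Only finitely many
    rings precede [t], so all strict inequalities among them and with [t] survive rounding once [N]
    is large. *)
Lemma slots_eventually : \forall n \near \oo,
  [/\ (forall i k, (slot n i k <= Num.truncn (n.+1%:R * t))%N -> rt i k < t),
      (forall i k, rt i k < t -> (slot n i k <= Num.truncn (n.+1%:R * t))%N) &
      (forall i k j k', rt i k < t -> rt j k' < t -> rt i k < rt j k' ->
         (slot n i k < slot n j k')%N)].
Proof.
have bd n i k := @arrival_bounds R (tau (key i)) n.+1 k (fun j => ltW (tau_gt0 i j)).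
have [K KP] : exists K : nat, forall i k, rt i k < t -> (k < K)%N.
  have h i : exists k, t < rt i k.
    have [k kt] := tau_unbounded i (Num.truncn t).+1.
    exists k; apply: lt_le_trans (lt_trans (truncnS_gt t) kt) _.
    by rewrite /ring_time big_ord_recr/= lerDr sumr_ge0// => j _; exact: ltW.
  pose kk i := projT1 (cid (h i)).
  exists (\max_i kk i)%N => i k kt; apply: leq_trans (leq_bigmax i).
  rewrite ltnNge; apply/negP => kk_k.
  have h1 : t < rt i (kk i) := projT2 (cid (h i)).
  have h2 : rt i (kk i) <= rt i k.
    move: kk_k; rewrite leq_eqVlt => /orP[/eqP <- //|kk_k].
    by apply: ltW; exact: ring_time_lt.
  by have := lt_trans (lt_le_trans h1 h2) kt; rewrite ltxx.
have e1 : \forall n \near \oo, forall x : I * 'I_K, rt x.1 x.2 < t ->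
    (slot n x.1 x.2 <= Num.truncn (n.+1%:R * t))%N.
  apply: filter_forall => -[i k] /=.
  have [it|it] := ltP (rt i k) t; last first.
    by apply: nearW => n.
  have := nbhs_infty_ger (k.+1%:R / (t - rt i k)); apply: filterS => n nk _.
  have n1 : n%:R <= n.+1%:R :> R by rewrite ler_nat.
  rewrite truncn_ge_nat ?mulr_ge0 ?(ltW t0)//.
  apply: le_trans (bd n i k).2 _; rewrite -/(rt i k).
  have d0 : 0 < t - rt i k by rewrite subr_gt0.
  rewrite ler_pdivrMr// in nk; have : n%:R * (t - rt i k) <= n.+1%:R * (t - rt i k).
    by apply: ler_wpM2r => //; exact: ltW.
  by lra.
have e2 : \forall n \near \oo, forall x : (I * 'I_K) * (I * 'I_K),
    rt x.1.1 x.1.2 < rt x.2.1 x.2.2 ->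
    (slot n x.1.1 x.1.2 < slot n x.2.1 x.2.2)%N.
  apply: filter_forall => -[[i k] [j k']] /=.
  have [ij|ij] := ltP (rt i k) (rt j k'); last first.
    by apply: nearW => n.
  have := nbhs_infty_ger (k.+1%:R / (rt j k' - rt i k)); apply: filterS => n nk _.
  have n1 : n%:R <= n.+1%:R :> R by rewrite ler_nat.
  rewrite -(ltr_nat R); apply: le_lt_trans (bd n i k).2 _.
  apply: le_lt_trans (bd n j k').1; rewrite -/(rt i k) -/(rt j k').
  have d0 : 0 < rt j k' - rt i k by rewrite subr_gt0.
  rewrite ler_pdivrMr// in nk; have : n%:R * (rt j k' - rt i k) <= n.+1%:R * (rt j k' - rt i k).
    by apply: ler_wpM2r => //; exact: ltW.
  by lra.
move: e1 e2; apply: filterS2 => n e1 e2; split.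
(* This implication holds for every mesh, because rounded arrivals come strictly later than the true
   ones. *)
- move=> i k sl; have n0 : 0 < n.+1%:R :> R by rewrite ltr0n.
  rewrite -(ltr_pM2l n0); apply: lt_le_trans (bd n i k).1 _.
  rewrite (le_trans (_ : _ <= (Num.truncn (n.+1%:R * t))%:R))//; first by rewrite ler_nat.
  by rewrite truncn_le mulr_ge0 ?(ltW t0).
- by move=> i k it; exact: (e1 (i, Ordinal (KP i k it)) it).
- move=> i k j k' it jt ij.
  exact: (e2 ((i, Ordinal (KP i k it)), (j, Ordinal (KP j k' jt))) ij).
Qed.

End eventually.

Section ae_eventually.
Context d (T : measurableType d) (R : realType) (P : probability T R).
Variables (V : countType) (adj : rel V) (W I : finType) (loc : W -> V) (ends : I -> W * W)
  (U0 : {set W}).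
Variables (f0 : V -> T -> R) (tau : V * V -> nat -> T -> R) (f : R -> V -> T -> R).
Notation key := (key loc ends).
Hypothesis adjC : forall u v, adj u v = adj v u.
Hypothesis adjN : forall v, ~~ adj v v.
Hypothesis loc_inj : injective loc.
Hypothesis key_inj : injective key.
Hypothesis key_index : forall i, adj (key i).1 (key i).2 /\ edge_key (key i).1 (key i).2 = key i.
Hypothesis ends_cover : forall u v, adj (loc u) (loc v) -> edge_key (loc u) (loc v) = (loc u, loc v) ->
  exists i, ends i = (u, v).
Hypothesis closed_out : forall v x, v \notin U0 -> adj (loc v) x -> exists u, x = loc u.
Hypothesis mtau : forall e n, measurable_fun setT (tau e n).
Hypothesis law_tau : forall e n B, measurable B -> P (tau e n @^-1` B) = exponential_prob 1 B.
Hypothesis indep : mutually_independent P (process_indices adj)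
  (fun i => match i with inl v => f0 v | inr (e, n) => tau e n end).
Hypothesis f_path : {ae P, forall w, averaging_path adj
  (fun u v s => rings (fun e n => tau e n w) u v s) (fun v => f0 v w) (fun t v => f t v w)}.

Lemma ae_tau_gt0 e : {ae P, forall w, forall k, 0 < tau e k w}.
Proof.
apply: ae_foralln => k; exists (tau e k @^-1` `]-oo, 0%R]); split.
- by apply: measurable_preimage => //; exact: measurable_itv.
- by apply: exponential_law_le0 => //; exact: law_tau.
- by move=> w /negP; rewrite -leNgt /= in_itv.
Qed.

(** Needed only so that each edge rings finitely often before [t]: a single gap exceeding [t]
    suffices, since the gaps are positive. *)
Lemma ae_tau_unbounded i : {ae P, forall w, forall m : nat, exists k, m%:R < tau (key i) k w}.
Proof.
apply: ae_foralln => m.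
pose B n := \big[setI/setT]_(k <- [seq inr (key i, k) | k <- iota 0 n] : seq (V + (V * V * nat)))
  ((match k with inl v => f0 v | inr (e, n) => tau e n end) @^-1` `]-oo, m.+1%:R[).
pose x : R := expR (- m.+1%:R).
have x0 : 0 < x by exact: expR_gt0.
have x1 : x <= 1 by rewrite expR_le1 oppr_le0.
have mlt k : measurable (tau (key i) k @^-1` `]-oo, m.+1%:R[).
  by apply: measurable_preimage => //; exact: measurable_itv.
apply: (@negligible_le_inv _ _ _ P _ B x^-1).
- by move=> n; rewrite /B big_map; apply: bigsetI_measurable => k _; exact: mlt.
- move=> n w /= nw; rewrite /B -bigcap_seq => _ /mapP[k _ ->] /=.
  rewrite in_itv/= ltNge; apply/negP => h; apply: nw; exists k.
  by apply: lt_le_trans h; rewrite ltr_nat.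
move=> n; rewrite /B (indep (F := [seq inr (key i, k) | k <- iota 0 n])); last 3 first.
- by rewrite map_inj_uniq ?iota_uniq// => a b [].
- by move=> _ /mapP[k _ ->]; exact: key_index.
- by move=> _; exact: measurable_itv.
rewrite big_map (eq_bigr (fun=> (1 - x)%:E)); last first.
  move=> k _; rewrite (_ : _ @^-1` _ = ~` (tau (key i) k @^-1` `[m.+1%:R, +oo[)); last first.
    by apply/seteqP; split => w /=; rewrite !in_itv/= andbT ltNge => /negP.
  rewrite probability_setC; last by apply: measurable_preimage => //; exact: measurable_itv.
  by rewrite (exponential_law_ge (mtau (key i) k) (law_tau (key i) k)).
rewrite prodEFin lee_fin big_const_seq count_predT size_iota -Monoid.iteropE -/(_ ^+ _).
(* Replaces geometric decay by the rate [1 / (n + 1)] that [negligible_le_inv] expects. *)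
have h : (1 - x) ^+ n * (1 + n%:R * x) <= 1.
  elim: n => [|n ih]; first by rewrite expr0 mul0r addr0 mulr1.
  apply: le_trans ih; rewrite exprSr -mulrA; apply: ler_wpM2l; first by rewrite exprn_ge0// subr_ge0.
  have : 0 <= n%:R * x * x by rewrite !mulr_ge0// ltW.
  by rewrite -natr1; nra.
rewrite ler_pdivlMr// -[leRHS]mulr1 ler_pdivlMl// mulrA [x * _]mulrC -mulrA.
apply: le_trans h; apply: ler_wpM2l; first by rewrite exprn_ge0// subr_ge0.
by rewrite -natr1; nra.
Qed.

(** Solving for the first gap turns the event into an affine coincidence with coefficients [-1]; two
    different edges are treated the same way, with coefficients of both signs. *)
Lemma ae_rt_neq_t i k (t : R) : {ae P, forall w, ring_time (fun e n => tau e n w) (key i) k <> t}.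
Proof.
have h := @ae_no_coincidence _ T R P _ (process_indices adj) _ indep 'I_k
  (fun j => inr (key i, j.+1)) (inr (key i, 0%N)) _ _ (key_index i) (fun=> key_index i)
  (mtau (key i) 0) (fun j => mtau (key i) j.+1) (law_tau (key i) 0)
  (fun j => law_tau (key i) j.+1) (fun=> -1) t _.
have {h} : {ae P, forall w, (forall j : 'I_k, 0 < tau (key i) j.+1 w) ->
    tau (key i) 0 w <> t + \sum_(j < k) -1 * tau (key i) j.+1 w}.
  apply: h; last by move=> _; rewrite normrN normr1.
  - by move=> a b [] /val_inj.
  - by move=> j; apply/eqP => -[].
move: (ae_tau_gt0 (key i)); apply: filterS2 => w pos ne e.
apply: ne => [j|]; first exact: pos.
move: e; rewrite /ring_time big_ord_recl/= => <-.
by rewrite -mulr_sumr mulN1r addrK.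
Qed.

Lemma ae_rt_neq i j k k' : i != j -> {ae P, forall w,
  ring_time (fun e n => tau e n w) (key i) k <> ring_time (fun e n => tau e n w) (key j) k'}.
Proof.
move=> ij.
pose e (x : 'I_k + 'I_k'.+1) : V + (V * V * nat) :=
  match x with inl a => inr (key i, a.+1) | inr b => inr (key j, nat_of_ord b) end.
pose c (x : 'I_k + 'I_k'.+1) : R := match x with inl _ => -1 | inr _ => 1 end.
have kij : key i <> key j by move=> /key_inj e'; rewrite e' eqxx in ij.
have h := @ae_no_coincidence _ T R P _ (process_indices adj) _ indep _
  e (inr (key i, 0%N)) _ _ (key_index i) _
  (mtau (key i) 0) _ (law_tau (key i) 0) _ c 0 _.
have {h} : {ae P, forall w, (forall x : 'I_k + 'I_k'.+1,
    0 < match e x with inl v => f0 v | inr (e, n) => tau e n end w) ->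
    tau (key i) 0 w <> 0 + \sum_x c x * match e x with inl v => f0 v | inr (e, n) => tau e n end w}.
  apply: h.
  - have inrP (a b : V * V * nat) : inr a = inr b :> V + (V * V * nat) -> a = b by case.
    move=> [a|b] [a'|b'] /inrP/pair_equal_spec[k1 k2].
    + by congr inl; apply/val_inj; case: k2.
    + by case: kij.
    + by case: kij.
    + by congr inr; exact: val_inj.
  - move=> [a|b]; apply/eqP; first by case.
    have inrP (a b' : V * V * nat) : inr a = inr b' :> V + (V * V * nat) -> a = b' by case.
    by move=> /inrP/pair_equal_spec[/esym].
  - by move=> [a|b]; exact: key_index.
  - by move=> [a|b]; exact: mtau.
  - by move=> [a|b]; exact: law_tau.
  - by move=> [a|b] /=; rewrite ?normrN normr1.
move: (ae_tau_gt0 (key i)) (ae_tau_gt0 (key j)); apply: filterS3 => w pi pj ne eq.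
apply: ne => [[a|b] /=|]; [exact: pi|exact: pj|].
move: eq; rewrite /ring_time big_ord_recl/= => eq.
rewrite big_sumType/= add0r -!mulr_sumr mulN1r mul1r addrC -eq.
by rewrite addrK.
Qed.

Lemma ae_eventually_foldl (t : R) : 0 < t -> {ae P, forall w, \forall n \near \oo, forall o : W,
  o \notin spreads ends U0 (slots_at loc ends tau n.+1 (Num.truncn (n.+1%:R * t)) w) ->
  f t (loc o) w = foldl (fun x b => slot_step (average ends) b x) (fun v => f0 (loc v) w)
    (slots_at loc ends tau n.+1 (Num.truncn (n.+1%:R * t)) w) o}.
Proof.
move=> t0.
have h1 : {ae P, forall w, forall i k, 0 < tau (key i) k w}.
  by apply: filter_forall => i; exact: ae_tau_gt0.
have h2 : {ae P, forall w, forall i (m : nat), exists k, m%:R < tau (key i) k w}.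
  by apply: filter_forall => i; exact: ae_tau_unbounded.
have h3 : {ae P, forall w, forall i k, ring_time (fun e n => tau e n w) (key i) k <> t}.
  by apply: filter_forall => i; apply: ae_foralln => k; exact: ae_rt_neq_t.
have h4 : {ae P, forall w, forall x : I * I, forall k k', x.1 != x.2 ->
    ring_time (fun e n => tau e n w) (key x.1) k <> ring_time (fun e n => tau e n w) (key x.2) k'}.
  apply: filter_forall => -[i j] /=; apply: ae_foralln => k; apply: ae_foralln => k'.
  have [->|ij] := eqVneq i j; first by apply: nearW.
  by have := @ae_rt_neq i j k k' ij; apply: filterS.
have h123 : {ae P, forall w, [/\ forall i k, 0 < tau (key i) k w,
    forall i (m : nat), exists k, m%:R < tau (key i) k w &
    forall i k, ring_time (fun e n => tau e n w) (key i) k <> t]}.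
  by move: h1 h2 h3; apply: filterS3.
move: h123 h4 f_path; apply: filterS3 => w [w1 w2 w3] w4 wp.
have := @slots_eventually R V W I loc ends (fun e n => tau e n w) t w1 w2 t0.
apply: filterS => n [s1 s2 s3] o on.
have ends_adj i : adj (key i).1 (key i).2 by case: (key_index i).
have ends_key i : edge_key (key i).1 (key i).2 = key i by case: (key_index i).
have := @slotted_path R V adj W I loc ends U0 adjC adjN ends_adj ends_key ends_cover closed_out
  (fun e n => tau e n w) (fun v => f0 v w) (fun t v => f t v w) t wp t0 w1
  (fun i j k k' ij => w4 (i, j) k k' ij) w3 (Num.truncn (n.+1%:R * t))
  (fun i k => arrival (fun j => Num.truncn (n.+1%:R * tau (key i) j w)) k)
  (slots_at loc ends tau n.+1 (Num.truncn (n.+1%:R * t)) w) _ s1 s2 s3 _ _ o on.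
apply.
- by move=> i k; apply: leq_ltn_trans (arrival_gt _ _).
- by rewrite size_tuple.
move=> j i jM; rewrite (nth_map 0%N) ?size_iota// nth_iota// inE.
by rewrite nth_bits// add0n.
Qed.

End ae_eventually.

(** * The window bound by Fatou's lemma *)

Section limits.
Variable R : realType.

Lemma limn_einf_ge (u : (\bar R)^nat) (c : \bar R) :
  (\forall n \near \oo, (c <= u n)%E) -> (c <= limn_einf u)%E.
Proof.
move=> [N _ uN]; rewrite limn_einf_lim (cvg_lim _ (@cvg_einfs_sup _ u))//.
apply: (@le_trans _ _ (einfs u N)); last by apply: ereal_sup_ubound; exists N.
by apply: le_ereal_inf_tmp => _ [n /= Nn <-]; exact: uN.
Qed.

Lemma limn_einf_le (u : (\bar R)^nat) (c : \bar R) :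
  (\forall n \near \oo, (u n <= c)%E) -> (limn_einf u <= c)%E.
Proof.
move=> [N _ uN]; rewrite limn_einf_lim (cvg_lim _ (@cvg_einfs_sup _ u))//.
apply: ge_ereal_sup => _ [n _ <-].
apply: (@le_trans _ _ (u (maxn n N))); last by apply: uN; rewrite /= leq_maxr.
by apply: ereal_inf_lbound; exists (maxn n N) => //=; exact: leq_maxl.
Qed.

Lemma powR_lipschitz (p a b K : R) : 1 <= p -> 0 <= a -> a <= K -> 0 <= b -> b <= K ->
  `|a `^ p - b `^ p| <= p * K `^ (p - 1) * `|a - b|.
Proof.
move=> p1; wlog ab : a b / b <= a.
  move=> h a0 aK b0 bK; have [|ab] := leP b a; first by move=> ba; exact: h.
  by rewrite distrC (distrC a); apply: h => //; exact: ltW.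
move=> a0 aK b0 bK; rewrite ger0_norm; last first.
  by rewrite subr_ge0; apply: ge0_ler_powR; rewrite ?nnegrE//; lra.
rewrite ger0_norm ?subr_ge0//.
move: a0; rewrite le_eqVlt => /orP[/eqP a0|a0].
  have b00 : b = a by apply/le_anti; rewrite ab -a0 b0.
  by rewrite b00 !subrr mulr0.
have h := powR_tangent p1 b0 a0.
apply: (@le_trans _ _ (p * a `^ (p - 1) * (a - b))); first by move: h; lra.
apply: ler_wpM2r; first by rewrite subr_ge0.
apply: ler_wpM2l; first lra.
by apply: ge0_ler_powR; rewrite ?nnegrE ?(ltW a0)//; [lra|exact: le_trans (ltW a0) _].
Qed.

Lemma excess_lipschitz (L x y : R) : `|excess L x - excess L y| <= `|x - y|.
Proof.
have h (a b : R) : excess L a - excess L b <= `|a - b|.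
  rewrite /excess lerBlDr ge_max; apply/andP; split.
    by rewrite addr_ge0// le_max lexx.
  apply: (@le_trans _ _ (`|a - b| + (`|b| - L))); last by rewrite lerD2l le_max lexx orbT.
  by have := ler_normD (a - b) b; rewrite subrK; lra.
by rewrite ler_norml lerNl opprB h distrC h.
Qed.

Lemma excess_le_norm (L x : R) : 0 <= L -> excess L x <= `|x|.
Proof. by move=> L0; rewrite /excess ge_max normr_ge0/=; lra. Qed.

Lemma excess0 (x : R) : excess 0 x = `|x|.
Proof. by rewrite /excess subr0 max_r. Qed.

Lemma cvg_excess_powR (p L x : R) (u : nat -> R) : 1 <= p ->
  u @ \oo --> x -> (fun n => excess L (u n) `^ p) @ \oo --> excess L x `^ p.
Proof.
move=> p1 ux; apply/cvgrPdist_le => e e0.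
pose K := excess L x + 1; have K0 : 0 < K by have := excess_ge0 L x; rewrite /K; lra.
pose c := p * K `^ (p - 1); have c0 : 0 < c by rewrite mulr_gt0 ?powR_gt0//; lra.
have d0 : 0 < Num.min 1 (e / c) by rewrite lt_min ltr01 divr_gt0.
have /cvgrPdist_le /(_ _ d0) := ux; apply: filterS => n; rewrite le_min => /andP[h1 h2].
have h3 := excess_lipschitz L x (u n).
have h4 : excess L (u n) <= K.
  have := le_trans h3 h1; rewrite ler_norml /K; lra.
apply: le_trans (powR_lipschitz p1 (excess_ge0 _ _) _ (excess_ge0 _ _) h4) _.
  by rewrite /K; lra.
rewrite -/c -ler_pdivlMl// mulrC; exact: le_trans h3 h2.
Qed.

Lemma norm_clamp_le (L x : R) : 0 <= L -> `|clamp L x| <= `|x|.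
Proof.
move=> L0; have [xL|Lx] := leP `|x| L; last exact: le_trans (clamp_le x L0) (ltW Lx).
by move: (xL); rewrite ler_norml => /andP[h1 h2]; rewrite /clamp min_r// max_r.
Qed.

Lemma clamp_id (L x : R) : `|x| <= L -> clamp L x = x.
Proof. by rewrite ler_norml => /andP[h1 h2]; rewrite /clamp min_r// max_r. Qed.

Definition rounding (n : nat) (y : R) : R := cell_val R (cell n.+1 y).

Lemma rounding_norm n y : `|rounding n y| <= `|y| + 1.
Proof.
have /andP[h1 h2] := @cell_valK R n.+1 isT y.
have h3 := @norm_clamp_le n.+1%:R y (ler0n _ _).
have h4 : n.+1%:R^-1 <= 1 :> R by rewrite invf_le1 ?ler1n// ltr0n.
rewrite /rounding; move: h3; rewrite !ler_norml => /andP[h5 h6].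
apply/andP; split.
  by apply: le_trans h1; rewrite opprD lerB//.
by apply: le_trans h2 _; apply: le_trans h6 _; rewrite lerDl.
Qed.

Lemma rounding_cvg y : (fun n => rounding n y) @ \oo --> y.
Proof.
apply/cvgrPdist_le => e e0.
have h1 := nbhs_infty_ger `|y|; have h2 := nbhs_infty_ger e^-1.
move: h1 h2; apply: filterS2 => n h1 h2.
have n1 : n%:R <= n.+1%:R :> R by rewrite ler_nat.
have /andP[h3 h4] := @cell_valK R n.+1 isT y.
rewrite clamp_id ?(le_trans h1)// in h3 h4.
have h5 : n.+1%:R^-1 <= e by rewrite invf_ple ?posrE ?ltr0n// (le_trans h2).
rewrite /rounding ger0_norm ?subr_ge0// lerBlDr.
by rewrite lerBlDr in h3; apply: le_trans h3 _; rewrite addrC lerD2r.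
Qed.

End limits.

Lemma measurable_excess (R : realType) (L : R) : measurable_fun setT (excess L).
Proof.
apply: (@measurable_maxr _ _ R setT (fun=> 0)) => //.
by apply: measurable_funB => //; exact: measurable_normr.
Qed.

(** * Moments of the rounded opinions and their limits *)

Section moments.
Context d (T : measurableType d) (R : realType) (P : probability T R).
Variables (X : T -> R) (p : R).
Hypothesis mX : measurable_fun setT X.
Hypothesis p1 : 1 <= p.
Hypothesis intXp : P.-integrable setT (fun w => (`|X w| `^ p)%:E).

Let p0 : 0 < p. Proof. exact: lt_le_trans ltr01 p1. Qed.

Lemma measurable_excess_powR (L : R) (Z : T -> R) : measurable_fun setT Z ->
  measurable_fun setT (fun w => excess L (Z w) `^ p).
Proof.
move=> mZ; apply: (measurableT_comp (measurable_powR p)).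
exact: measurableT_comp (measurable_excess L) mZ.
Qed.

Lemma integrable_powR_shift (c : R) : 0 <= c ->
  P.-integrable setT (fun w => ((`|X w| + c) `^ p)%:E).
Proof.
move=> c0.
have h : P.-integrable setT (fun w => ((2 `^ p)%:E * ((`|X w| `^ p)%:E + (c `^ p)%:E))%E).
  apply: integrableZl => //; apply: integrableD => //.
  exact: finite_measure_integrable_cst.
apply: le_integrable h => //.
  apply/measurable_EFinP; apply: (measurableT_comp (measurable_powR p)).
  by apply: measurable_funD => //; exact: measurableT_comp.
move=> w _; rewrite -EFinD -EFinM !abse_EFin lee_fin ger0_norm ?powR_ge0//.
rewrite ger0_norm; last by rewrite mulr_ge0 ?addr_ge0 ?powR_ge0.
have := @powR_normD R p (`|X w|) c (ltW p0).
by rewrite normr_id (ger0_norm c0) (@ger0_norm _ (_ + c)) ?addr_ge0//.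
Qed.

Lemma integrable_of_powR : P.-integrable setT (fun w => (X w)%:E).
Proof.
apply: le_integrable (integrable_powR_shift ler01) => //.
  exact/measurable_EFinP.
move=> w _; rewrite !abse_EFin lee_fin (ger0_norm (powR_ge0 _ _)).
apply: (@le_trans _ _ (`|X w| + 1)); first by rewrite lerDl.
by apply: le1r_powR => //; rewrite lerDr.
Qed.

Lemma integrable_excess (L m : R) : 0 <= L ->
  P.-integrable setT (fun w => (excess L (X w - m) `^ p)%:E).
Proof.
move=> L0; apply: le_integrable (integrable_powR_shift (normr_ge0 m)) => //.
  by apply/measurable_EFinP/measurable_excess_powR; exact: measurable_funB.
move=> w _; rewrite !abse_EFin lee_fin 2?(ger0_norm (powR_ge0 _ _)).
apply: ge0_ler_powR; rewrite ?nnegrE ?excess_ge0 ?(ltW p0) ?addr_ge0//.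
exact: le_trans (excess_le_norm _ L0) (ler_normB _ _).
Qed.

Lemma measurable_rounding n : measurable_fun setT (fun w => rounding n (X w)).
Proof.
apply: (@measurable_finite_valued _ T R _ (cell n.+1 \o X) _ (@cell_val R n.+1)) => s.
by rewrite comp_preimage; apply: measurable_preimage => //; exact: measurable_cell.
Qed.

Lemma integrable_rounding n : P.-integrable setT (fun w => (rounding n (X w))%:E).
Proof.
have h : P.-integrable setT (fun w => (`|X w|%:E + 1)%E).
  apply: integrableD => //; last exact: finite_measure_integrable_cst.
  exact: integrable_norm integrable_of_powR.
apply: le_integrable h => //; first exact/measurable_EFinP/measurable_rounding.
move=> w _; rewrite -EFinD !abse_EFin lee_fin (@ger0_norm _ (_ + _)) ?addr_ge0//.
exact: rounding_norm.
Qed.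

Lemma cvg_integral_rounding :
  (fun n => \int[P]_w (rounding n (X w))%:E)%E @ \oo --> (\int[P]_w (X w)%:E)%E.
Proof.
have h : P.-integrable setT (fun w => (`|X w|%:E + 1)%E).
  apply: integrableD => //; last exact: finite_measure_integrable_cst.
  exact: integrable_norm integrable_of_powR.
have [|||||_ _ //] := @dominated_convergence _ T R P setT measurableT
  (fun n w => (rounding n (X w))%:E) (fun w => (X w)%:E) (fun w => (`|X w|%:E + 1)%E).
- by move=> n; exact/measurable_EFinP/measurable_rounding.
- exact/measurable_EFinP.
- by apply: nearW => w _; apply: cvg_EFin; [exact: nearW|exact: rounding_cvg].
- exact: h.
- by apply: nearW => w n _; rewrite -EFinD abse_EFin lee_fin rounding_norm.
Qed.

Lemma cvg_integral_excess (L m : R) (u : nat -> R) : 0 <= L -> u @ \oo --> m ->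
  (fun n => \int[P]_w (excess L (rounding n (X w) - u n) `^ p)%:E)%E @ \oo -->
  (\int[P]_w (excess L (X w - m) `^ p)%:E)%E.
Proof.
move=> L0 um.
have [c c0 uc] : exists2 c, 0 <= c & forall n, `|u n| <= c.
  have /cvg_seq_bounded [M [_ hM]] : cvgn u by apply/cvg_ex; exists m.
  exists (`|M| + 1) => [|n]; first by rewrite addr_ge0.
  by apply: hM => //; rewrite (le_lt_trans (ler_norm M))// ltrDl.
have [|||||_ _ //] := @dominated_convergence _ T R P setT measurableT
  (fun n w => (excess L (rounding n (X w) - u n) `^ p)%:E) (fun w => (excess L (X w - m) `^ p)%:E)
  (fun w => ((`|X w| + (1 + c)) `^ p)%:E).
- move=> n; apply/measurable_EFinP/measurable_excess_powR.
  by apply: measurable_funB => //; exact: measurable_rounding.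
- by apply/measurable_EFinP/measurable_excess_powR; exact: measurable_funB.
- apply: nearW => w _; apply: cvg_EFin; first exact: nearW.
  by apply: cvg_excess_powR => //; apply: cvgB => //; exact: rounding_cvg.
- by apply: integrable_powR_shift; rewrite addr_ge0.
- apply: nearW => w n _; rewrite abse_EFin lee_fin ger0_norm ?powR_ge0//.
  apply: ge0_ler_powR; rewrite ?nnegrE ?excess_ge0 ?(ltW p0) ?addr_ge0//.
  apply: le_trans (excess_le_norm _ L0) _; apply: le_trans (ler_normB _ _) _.
  by rewrite addrA lerD// rounding_norm.
Qed.

End moments.

Lemma lincomb_map (R : realType) (W : finType) (A : Type) (x : A -> R) (o : W) (m : W -> R)
    (h : W -> A) :
  lincomb x (enum_fun o m) [seq h v | v <- enum W] = \sum_v m v * x (h v).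
Proof.
rewrite -[RHS]big_enum/= /enum_fun; elim: (enum W) => [|u r ih]; first by rewrite big_nil.
by rewrite /= big_cons ih.
Qed.

(* [p * (1 - p) ^+ k] is the probability that a given edge, and none of the [k]
   others, rings during a slot of length [1 / (n + 1)]. *)
Lemma near_ring_rate (R : realType) (t s : R) (k : nat) : 0 < t -> s <= t ->
  \forall n \near \oo, let p := 1 - expR (- n.+1%:R^-1) in
    s <= 2 * (p * (1 - p) ^+ k * (Num.truncn (n.+1%:R * t))%:R).
Proof.
(* The first threshold makes [exp (-(k + 1) / (n + 1))] at least [3/4], the second makes truncation
   lose at most a quarter of [t]. The product [9/16] exceeds [1/2], which is where the factor [2]
   comes from. *)
move=> t0 st; have h1 := nbhs_infty_ger (4 * k.+1%:R : R).
have h2 := nbhs_infty_ger (4 / t).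
move: h1 h2; apply: filterS2 => n h1 h2 /=.
have n0 : 0 < n.+1%:R :> R by rewrite ltr0n.
have n1 : n%:R <= n.+1%:R :> R by rewrite ler_nat.
have i0 : 0 < n.+1%:R^-1 :> R by rewrite invr_gt0.
set x := n.+1%:R^-1 in i0 *; set m := Num.truncn _.
rewrite (_ : 1 - (1 - expR (- x)) = expR (- x)); last by ring.
have m1 : n.+1%:R * t < m%:R + 1 by have := truncnS_gt (n.+1%:R * t); rewrite -/m natr1.
have e1 : x * expR (- x) <= 1 - expR (- x).
  have := expR_ge1Dx x; rewrite expRN => h.
  have E0 := expR_gt0 x; rewrite -(ler_pM2r E0) mulrBl mul1r mulVf ?gt_eqF//.
  by rewrite -mulrA mulVf ?gt_eqF//; lra.
have e2 : 3 / 4 <= expR (- x) * expR (- x) ^+ k.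
  rewrite -exprS -expRM_natl mulrN; apply: le_trans (expR_ge1Dx _).
  have : k.+1%:R * x <= 1 / 4.
    by rewrite /x ler_pdivrMr//; move: (le_trans h1 n1); lra.
  lra.
have e3 : 3 / 4 * t <= x * m%:R.
  rewrite /x [leRHS]mulrC ler_pdivlMr//.
  have : 4 <= n.+1%:R * t by move: (le_trans h2 n1); rewrite ler_pdivrMr.
  by move: m1; lra.
have m0 : 0 <= m%:R :> R by [].
have E0 : 0 <= expR (- x) ^+ k by rewrite exprn_ge0// expR_ge0.
have e4 : x * expR (- x) * expR (- x) ^+ k * m%:R <=
    (1 - expR (- x)) * expR (- x) ^+ k * m%:R.
  by apply: ler_wpM2r => //; apply: ler_wpM2r.
have e5 : 3 / 4 * (3 / 4 * t) <= (expR (- x) * expR (- x) ^+ k) * (x * m%:R).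
  by apply: ler_pM => //; rewrite mulr_ge0 ?divr_ge0// ltW.
have e6 : (expR (- x) * expR (- x) ^+ k) * (x * m%:R) = x * expR (- x) * expR (- x) ^+ k * m%:R.
  by ring.
rewrite e6 in e5; have := le_trans e5 e4; lra.
Qed.

Section window.
Context d (T : measurableType d) (R : realType) (P : probability T R).
Variables (V : countType) (adj : rel V) (W I : finType) (loc : W -> V) (ends : I -> W * W)
  (U0 : {set W}).
Variables (f0 : V -> T -> R) (tau : V * V -> nat -> T -> R) (f : R -> V -> T -> R).
Notation key := (key loc ends).
Hypothesis adjC : forall u v, adj u v = adj v u.
Hypothesis adjN : forall v, ~~ adj v v.
Hypothesis loc_inj : injective loc.
Hypothesis key_inj : injective key.
Hypothesis key_index : forall i, adj (key i).1 (key i).2 /\ edge_key (key i).1 (key i).2 = key i.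
Hypothesis ends_cover : forall u v, adj (loc u) (loc v) -> edge_key (loc u) (loc v) = (loc u, loc v) ->
  exists i, ends i = (u, v).
Hypothesis closed_out : forall v x, v \notin U0 -> adj (loc v) x -> exists u, x = loc u.
Hypothesis mf0 : forall v, measurable_fun setT (f0 v).
Hypothesis f0_id : forall u v B, measurable B -> P (f0 u @^-1` B) = P (f0 v @^-1` B).
Hypothesis mtau : forall e n, measurable_fun setT (tau e n).
Hypothesis law_tau : forall e n B, measurable B -> P (tau e n @^-1` B) = exponential_prob 1 B.
Hypothesis indep : mutually_independent P (process_indices adj)
  (fun i => match i with inl v => f0 v | inr (e, n) => tau e n end).
Hypothesis mf : forall t v, measurable_fun setT (f t v).
Hypothesis f_path : {ae P, forall w, averaging_path adj
  (fun u v s => rings (fun e n => tau e n w) u v s) (fun v => f0 v w) (fun t v => f t v w)}.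
Variables (o : W) (p mu t L : R).
Hypothesis t0 : 0 < t.
Hypothesis p1 : 1 <= p.
Hypothesis L0 : 0 <= L.
Hypothesis intXp : P.-integrable setT (fun w => (`|f0 (loc o) w| `^ p)%:E).
Hypothesis mean : (\int[P]_w (f0 (loc o) w)%:E = mu%:E)%E.

Notation slots n w := (slots_at loc ends tau n.+1 (Num.truncn (n.+1%:R * t)) w).
Notation states n w := (states_at loc f0 n.+1 w).
Notation weight n := (@cell_weight _ T R P V f0 (loc o) n.+1).

(** The mean of the rounded opinions: subtracting it instead of [mu] makes them exactly centred, as
    the moment bounds require. *)
Let muh n : R := \sum_s weight n s * cell_val R s.

Let weight_ge0 n s : 0 <= weight n s. Proof. exact: cell_weight_ge0. Qed.

Let weight_sum1 n : \sum_s weight n s = 1. Proof. exact: cell_weight_sum1. Qed.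

Lemma integral_rounding n : (\int[P]_w (rounding n (f0 (loc o) w))%:E = (muh n)%:E)%E.
Proof.
(* Integrals of finitely valued functions are computed for nonnegative functions; cell values are at
   least [-(n + 1)], so they are shifted and the shift is removed afterwards. *)
have h : forall s : 'I_(2 * n.+1 ^ 2).+1, 0 <= cell_val R s + n.+1%:R.
  by move=> s; rewrite /cell_val subrK.
have := @integral_cells _ T R P V f0 mf0 f0_id (loc o) n.+1 (fun y => y + n.+1%:R) h.
under eq_integral do rewrite EFinD.
rewrite integralD//; last 2 first.
- exact: integrable_rounding (mf0 (loc o)) p1 intXp n.
- exact: finite_measure_integrable_cst.
rewrite integral_cst//.
have -> : (n.+1%:R%:E * P setT = n.+1%:R%:E)%E by rewrite [P _](probability_setT P) mule1.
under eq_bigr do rewrite mulrDr.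
rewrite big_split/= -mulr_suml weight_sum1 mul1r EFinD.
by move=> /(congr1 (fun x => x - n.+1%:R%:E)%E); rewrite !addeK.
Qed.

Let muh_cvg : muh @ \oo --> mu.
Proof.
have := cvg_integral_rounding (mf0 (loc o)) p1 intXp; rewrite mean.
under eq_fun do rewrite integral_rounding.
by move=> /fine_cvg.
Qed.

Let g : R := fine (\int[P]_w (excess L (f0 (loc o) w - mu) `^ p)%:E).

Let gn n : R := \sum_s weight n s * excess L (cell_val R s - muh n) `^ p.

Let gE : g%:E = (\int[P]_w (excess L (f0 (loc o) w - mu) `^ p)%:E)%E.
Proof.
have mX := mf0 (loc o); rewrite /g fineK//; apply: integrable_fin_num => //.
exact: integrable_excess.
Qed.

Let gn_cvg : gn @ \oo --> g.
Proof.
have := cvg_integral_excess (mf0 (loc o)) p1 intXp L0 muh_cvg.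
have -> : (fun n => \int[P]_w (excess L (rounding n (f0 (loc o) w) - muh n) `^ p)%:E)%E =
    EFin \o gn.
  apply/funext => n /=.
  apply: (@integral_cells _ T R P V f0 mf0 f0_id (loc o) n.+1 (fun y => excess L (y - muh n) `^ p)).
  by move=> s; exact: powR_ge0.
rewrite -gE => /fine_cvg.
exact.
Qed.

Variables (a b s delta A kappa : R) (phi : W -> R).
Hypothesis st : s <= t.
Hypothesis delta0 : 0 < delta.
Hypothesis A0 : 0 <= A.
Hypothesis moment_bound : forall (pr : R), 0 <= pr <= 1 -> forall M : nat,
  s <= 2 * (pr * (1 - pr) ^+ #|I|.-1 * M%:R) ->
  forall (S : finType) (w x : S -> R), (forall c, 0 <= w c) -> \sum_c w c = 1 ->
    \sum_c w c * x c = 0 ->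
  moment p ends pr o M w x <= a * \sum_c w c * excess L (x c) `^ p + b.
Hypothesis phi0 : forall v, 0 <= phi v.
Hypothesis phi_o : phi o = 1.
Hypothesis kappa0 : 0 <= kappa.
Hypothesis phiP : forall v, \sum_i ((if (ends i).1 == v then phi (ends i).2 else 0) +
  (if (ends i).2 == v then phi (ends i).1 else 0)) <= kappa * phi v.

Let ends_ne i : (ends i).1 != (ends i).2.
Proof.
apply/eqP => e; have [h _] := key_index i; move: h.
by rewrite /key/= e (negbTE (adjN _)).
Qed.

(** The integrand for Fatou's lemma. Where the boundary has reached [o] the slotted path carries no
    information, and the second term supplies the cap [A] instead. *)
Let H n (l : seq {set I}) (c : seq 'I_(2 * n.+1 ^ 2).+1) : R :=
  `|lincomb (fun s => cell_val R s - muh n) (enum_fun o (slot_vec R ends o l)) c| `^ p +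
  A * (o \in spreads ends U0 l)%:R.

Let H_ge0 n l c : 0 <= @H n l c.
Proof. by rewrite /H addr_ge0 ?powR_ge0// mulr_ge0. Qed.

Let integral_H : \forall n \near \oo, (\int[P]_w (H (slots n w) (states n w))%:E <=
  (a * gn n + b + A * (expR (kappa * t) * mass phi U0))%:E)%E.
Proof.
have := near_ring_rate #|I|.-1 t0 st; apply: filterS => n /= rate.
rewrite (@integral_joint _ T R P V adj W I loc ends f0 tau loc_inj key_inj key_index mf0 f0_id
  mtau law_tau indep (loc o) n.+1 _ isT (@H n) (@H_ge0 n)) lee_fin.
set pr := 1 - expR _ in rate *; set M := Num.truncn _ in rate *.
have x0 : 0 < n.+1%:R^-1 :> R by rewrite invr_gt0.
have pr01 : 0 <= pr <= 1.
  by rewrite /pr subr_ge0 expR_le1 oppr_le0 (ltW x0) gerBl expR_ge0.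
have prx : pr <= n.+1%:R^-1 by rewrite /pr lerBlDr -lerBlDl; exact: expR_ge1Dx.
have sw0 := @slot_weight_ge0 R I pr pr01; have sw1 := @slot_weight_sum1 R I pr.
have cw0 := @weight_ge0 n; have cw1 := weight_sum1 n.
rewrite (@eq_iterE _ _ _ M _ (fun l => iterE (weight n) #|W| (fun c =>
   `|lincomb (fun s => cell_val R s - muh n) (enum_fun o (slot_vec R ends o l)) c| `^ p) +
   A * (o \in spreads ends U0 l)%:R)); last first.
  by move=> l _; rewrite /H iterED iterE_cst.
rewrite iterED iterEZ; apply: lerD.
  apply: moment_bound => //.
  under eq_bigr do rewrite mulrBr.
  by rewrite sumrB -mulr_suml cw1 mul1r subrr.
apply: ler_wpM2l => //.
apply: le_trans (iterE_spreads_mem phi0 kappa0 pr01 phiP M U0 phi_o) _.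
apply: ler_wpM2r; first exact: mass_ge0.
have [pr0 pr1] := andP pr01.
(* The growth factor is uniform in the mesh: [pr] is at most the slot length and [M] slots cover at
   most time [t]. *)
apply: (@le_trans _ _ (expR (pr * kappa) ^+ M)).
  by apply: lerXn2r; rewrite ?nnegrE ?expR_ge0 ?expR_ge1Dx// addr_ge0// mulr_ge0.
rewrite -expRM_natl ler_expR mulrA mulrC; apply: ler_wpM2l => //.
have n0 : 0 < n.+1%:R :> R by rewrite ltr0n.
apply: (@le_trans _ _ (n.+1%:R * t * n.+1%:R^-1)).
  apply: ler_pM => //; by rewrite truncn_le mulr_ge0// ltW.
by rewrite mulrAC divff ?gt_eqF// mul1r.
Qed.

Let H_lower : {ae P, forall w, \forall n \near \oo,
  Num.min A (excess delta (f t (loc o) w - mu) `^ p) <= H (slots n w) (states n w)}.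
Proof.
have := @ae_eventually_foldl _ T R P V adj W I loc ends U0 f0 tau f adjC adjN key_inj
  key_index ends_cover closed_out mtau law_tau indep f_path t t0.
apply: filterS => w ev.
have d2 : 0 < delta / 2 by rewrite divr_gt0.
have c1 : \forall n \near \oo, forall v, `|f0 (loc v) w - rounding n (f0 (loc v) w)| <= delta / 2.
  by apply: filter_forall => v; by have /cvgrPdist_le/(_ _ d2) := @rounding_cvg R (f0 (loc v) w).
have /cvgrPdist_le/(_ _ d2) c2 := muh_cvg.
move: ev c1 c2; apply: filterS3 => n ev c1 c2.
rewrite /H; have [oU|oU] := boolP (o \in _).
  by rewrite mulr1 ge_min; apply/orP; left; rewrite lerDr powR_ge0.
rewrite mulr0 addr0 ge_min; apply/orP; right.
apply: ge0_ler_powR; rewrite ?nnegrE ?excess_ge0//; first exact: le_trans ler01 p1.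
have := ev o oU.
set l := slots_at _ _ _ _ _ _.
have mp := slot_vec_prob R ends_ne o l; case: (mp) => m0 m1.
have -> : states_at loc f0 n.+1 w = [seq cell n.+1 (f0 (loc v) w) | v <- enum W] :> seq _ by [].
rewrite lincomb_map => fE.
have {}fE : f t (loc o) w = \sum_v slot_vec R ends o l v * f0 (loc v) w.
  rewrite fE -foldl_average_dual// (bigD1 o)//= eqxx mul1r big1 ?addr0// => v /negbTE ->.
  by rewrite mul0r.
have muE (c : R) : c = \sum_v slot_vec R ends o l v * c by rewrite -mulr_suml m1 mul1r.
(* The second sum collects the errors of rounding the opinions and their mean, each at most
   [delta / 2], and the weights sum to one. *)
have e : f t (loc o) w - mu = \sum_v slot_vec R ends o l v * (cell_val R (cell n.+1 (f0 (loc v) w)) - muh n) +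
    \sum_v slot_vec R ends o l v * ((f0 (loc v) w - rounding n (f0 (loc v) w)) - (mu - muh n)).
  rewrite fE {1}(muE mu) -sumrB -big_split/=; apply: eq_bigr => v _.
  by rewrite /rounding; ring.
have h : `|\sum_v slot_vec R ends o l v *
    ((f0 (loc v) w - rounding n (f0 (loc v) w)) - (mu - muh n))| <= delta.
  apply: le_trans (ler_norm_sum _ _ _) _.
  under eq_bigr do rewrite normrM (ger0_norm (m0 _)).
  apply: sum_weight_le => // v; apply: le_trans (ler_normB _ _) _.
  by rewrite [leRHS](splitr delta) lerD.
rewrite /excess ge_max normr_ge0/= lerBlDr e.
by apply: le_trans (ler_normD _ _) _; rewrite lerD2l.
Qed.

Lemma window_bound :
  (\int[P]_w (Num.min A (excess delta (f t (loc o) w - mu) `^ p))%:E <=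
   (a * g + b + A * (expR (kappa * t) * mass phi U0))%:E)%E.
Proof.
have mH n : measurable_fun setT (fun w => (H (slots n w) (states n w))%:E).
  apply/measurable_EFinP.
  by apply: measurable_joint.
have H0 n w : setT w -> (0 <= (H (slots n w) (states n w))%:E)%E by rewrite lee_fin.
have := fatou P measurableT mH H0.
have lo : (\int[P]_w (Num.min A (excess delta (f t (loc o) w - mu) `^ p))%:E <=
    \int[P]_w limn_einf (fun n => (H (slots n w) (states n w))%:E))%E.
  apply: ae_ge0_le_integral => //.
  - by move=> w _; rewrite lee_fin le_min A0 powR_ge0.
  - apply/measurable_EFinP; apply: (@measurable_minr _ _ R setT (fun=> A)) => //.
    by apply: measurable_excess_powR => //; exact: measurable_funB.
  - move=> w _; apply: limn_einf_ge; apply: nearW => n; exact: H0.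
  - apply: (emeasurable_fun_cvg (fun n w => einfs (fun k => (H (slots k w) (states k w))%:E) n)).
      by move=> n; exact: measurable_fun_einfs.
    by move=> w _; rewrite limn_einf_lim; exact: is_cvg_einfs.
  apply: filterS H_lower => w h _; apply: limn_einf_ge.
  by apply: filterS h => n; rewrite lee_fin.
move=> /(le_trans lo) /le_trans; apply.
apply/lee_addgt0Pr => e e0; rewrite -EFinD; apply: limn_einf_le.
have agn : (fun n => a * gn n) @ \oo --> a * g by exact: cvgMr gn_cvg.
move: agn => /cvgrPdist_le/(_ _ e0) agn; move: agn integral_H; apply: filterS2 => n h1 h2.
apply: le_trans h2 _; rewrite lee_fin.
by move: h1; rewrite distrC ler_distl => /andP[_ h1]; lra.
Qed.

End window.

(** * Finite windows *)

(** Removes both truncations by a second use of Fatou's lemma, with [A = n] and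
    [delta = 1 / (n + 1)]. *)
Lemma integral_powR_le_truncated d (T : measurableType d) (R : realType) (P : probability T R)
    (Z : T -> R) (p c : R) : measurable_fun setT Z -> 1 <= p ->
  (forall A delta : R, 0 <= A -> 0 < delta ->
    (\int[P]_w (Num.min A (excess delta (Z w) `^ p))%:E <= c%:E)%E) ->
  (\int[P]_w (`|Z w| `^ p)%:E <= c%:E)%E.
Proof.
move=> mZ p1 hc; have p0 : 0 <= p by exact: le_trans ler01 p1.
pose F n w := (Num.min n%:R (excess n.+1%:R^-1 (Z w) `^ p))%:E.
have mF n : measurable_fun setT (F n).
  apply/measurable_EFinP; apply: (@measurable_minr _ _ R setT (fun=> n%:R)) => //.
  exact: measurable_excess_powR.
have F0 n w : setT w -> (0 <= F n w)%E by move=> _; rewrite lee_fin le_min ler0n powR_ge0.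
have := fatou P measurableT mF F0.
have lo : (\int[P]_w (`|Z w| `^ p)%:E <= \int[P]_w limn_einf (F ^~ w))%E.
  apply: ge0_le_integral => //.
  - apply/measurable_EFinP; apply: (measurableT_comp (measurable_powR p)).
    exact: measurableT_comp.
  - apply: (emeasurable_fun_cvg (fun n w => einfs (F ^~ w) n)).
      by move=> n; exact: measurable_fun_einfs.
    by move=> w _; rewrite limn_einf_lim; exact: is_cvg_einfs.
  move=> w _; rewrite -[leRHS]adde0; apply/lee_addgt0Pr => e e0; rewrite adde0.
  rewrite -leeBlDr// -EFinB; apply: limn_einf_ge.
  pose K := p * `|Z w| `^ (p - 1); have K0 : 0 <= K by rewrite mulr_ge0 ?powR_ge0.
  have h1 := nbhs_infty_ger (`|Z w| `^ p); have h2 := nbhs_infty_ger (K / e).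
  move: h1 h2; apply: filterS2 => n h1 h2; rewrite lee_fin.
  have i0 : 0 <= n.+1%:R^-1 :> R by rewrite invr_ge0.
  have eZ : excess n.+1%:R^-1 (Z w) <= `|Z w| by exact: excess_le_norm.
  rewrite le_min; apply/andP; split; first by rewrite lerBlDr (le_trans h1)// lerDl ltW.
  have := powR_lipschitz p1 (normr_ge0 (Z w)) (lexx _) (excess_ge0 n.+1%:R^-1 (Z w)) eZ.
  rewrite -/K => h3; have := le_trans (ler_norm _) h3.
  have h4 : `| `|Z w| - excess n.+1%:R^-1 (Z w)| <= n.+1%:R^-1.
    rewrite ger0_norm ?subr_ge0// lerBlDl -lerBlDr.
    by rewrite /excess le_max lexx orbT.
  have h5 : K * n.+1%:R^-1 <= e.
    rewrite ler_pdivrMr ?ltr0n// -ler_pdivrMl// mulrC (le_trans h2)//.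
    by rewrite ler_nat.
  have h6 := ler_wpM2l K0 h4; move=> h7.
  by rewrite lerBlDr -lerBlDl; apply: le_trans h7 (le_trans h6 h5).
move=> /(le_trans lo) /le_trans; apply; apply: limn_einf_le; apply: nearW => n.
by apply: hc; rewrite ?invr_gt0.
Qed.

Section vertex_window.
Variables (V : countType) (adj : rel V) (s0 : seq V).
Hypothesis adjC : forall u v, adj u v = adj v u.
Hypothesis adjN : forall v, ~~ adj v v.

Definition wvertex : finType := seq_sub s0.
Definition wloc (v : wvertex) : V := val v.
(** Keeping only the canonical orientation gives each undirected edge one index, hence one clock. *)
Definition wedge : finType :=
  {x : wvertex * wvertex | adj (wloc x.1) (wloc x.2) &&
    (edge_key (wloc x.1) (wloc x.2) == (wloc x.1, wloc x.2))}.
Definition wends (i : wedge) : wvertex * wvertex := val i.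
Definition wboundary : {set wvertex} :=
  [set v : wvertex | ~~ `[< forall x, adj (wloc v) x -> x \in s0 >]]%SET.

Lemma wloc_inj : injective wloc.
Proof. exact: val_inj. Qed.

Lemma wkey_inj : injective (key wloc wends).
Proof.
move=> i j [/val_inj e1 /val_inj e2]; apply/val_inj.
by rewrite [LHS]surjective_pairing [RHS]surjective_pairing; congr (_, _).
Qed.

Lemma wkey_index i : adj (key wloc wends i).1 (key wloc wends i).2 /\
  edge_key (key wloc wends i).1 (key wloc wends i).2 = key wloc wends i.
Proof. by have /andP[h1 /eqP h2] := valP i; split. Qed.

Lemma wends_cover u v : adj (wloc u) (wloc v) ->
  edge_key (wloc u) (wloc v) = (wloc u, wloc v) -> exists i, wends i = (u, v).
Proof.
move=> uv e; have h : adj (wloc (u, v).1) (wloc (u, v).2) &&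
    (edge_key (wloc (u, v).1) (wloc (u, v).2) == (wloc (u, v).1, wloc (u, v).2)).
  by rewrite /= uv e eqxx.
by exists (exist _ (u, v) h).
Qed.

Lemma wclosed_out v x : v \notin wboundary -> adj (wloc v) x -> exists u, x = wloc u.
Proof.
rewrite inE negbK => /asboolP h /h xs.
by exists (SeqSub xs).
Qed.

Lemma wends_neq i : (wends i).1 != (wends i).2.
Proof.
apply/eqP => e; have [h _] := wkey_index i; move: h.
by rewrite /key/= e (negbTE (adjN _)).
Qed.

Lemma wedge_rel u v : adj (wloc u) (wloc v) -> edge_rel wends u v.
Proof.
move=> uv; have uv' : wloc u != wloc v by apply: contraTneq uv => ->; exact: adjN.
have [e|e] := edge_key_cases (wloc u) (wloc v).
  by have [i ei] := wends_cover uv e; apply/existsP; exists i; rewrite ei eqxx.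
rewrite edge_keyC// in e; rewrite adjC in uv.
by have [i ei] := wends_cover uv e; apply/existsP; exists i; rewrite ei eqxx orbT.
Qed.

Lemma wconnect (o : wvertex) : (forall v : wvertex, exists q : seq V,
    [/\ path adj (wloc o) q, last (wloc o) q = wloc v & all [in s0] q]) ->
  forall u v, connect (edge_rel wends) u v.
Proof.
move=> h; have sym : connect_sym (edge_rel wends).
  apply: sym_connect_sym => u v; rewrite /edge_rel; apply: eq_existsb => i.
  by rewrite orbC.
suff oc v : connect (edge_rel wends) o v.
  by move=> u v; apply: connect_trans (oc v); rewrite sym.
have [q [qp ql qs]] := h v; elim: q o qp ql qs {h} => [|x q ih] o /=.
  by move=> _ /val_inj -> _; exact: connect0.
move=> /andP[ox qp] ql /andP[xs qs].
apply: connect_trans (ih (SeqSub xs) qp ql qs).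
by apply: connect1; exact: wedge_rel.
Qed.

Lemma card_wvertex : uniq s0 -> #|{: wvertex}| = size s0.
Proof. exact: card_seq_sub. Qed.

Lemma wdegree (R : realType) (phi : V -> R) (D : nat) (x : R) : 0 <= x ->
  (forall v, 0 <= phi v) ->
  (forall (v : V) (s : seq V), uniq s -> all (adj v) s -> (size s <= D)%N) ->
  (forall u v, adj u v -> phi v <= x * phi u) ->
  forall v, \sum_i ((if (wends i).1 == v then phi (wloc (wends i).2) else 0) +
    (if (wends i).2 == v then phi (wloc (wends i).1) else 0)) <= (2 * D%:R * x) * phi (wloc v).
Proof.
move=> x0 phi0 deg phix v.
have half (h1 h2 : wedge -> wvertex) :
    (forall i j, h1 i = h1 j -> h2 i = h2 j -> i = j) ->
    (forall i, adj (wloc (h1 i)) (wloc (h2 i))) ->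
    \sum_i (if h1 i == v then phi (wloc (h2 i)) else 0) <= D%:R * (x * phi (wloc v)).
  move=> hinj hadj; rewrite -big_mkcond/=.
  apply: (@le_trans _ _ (\sum_(i | h1 i == v) x * phi (wloc v))).
    by apply: ler_sum => i /eqP iv; apply: phix; rewrite -iv.
  rewrite sumr_const -[leLHS]mulr_natl; apply: ler_wpM2r; first exact: mulr_ge0.
  rewrite ler_nat cardE -(size_map (fun i => wloc (h2 i))).
  apply: (deg (wloc v)).
    rewrite map_inj_in_uniq ?enum_uniq// => i j; rewrite !mem_enum => /eqP iv /eqP jv /val_inj ij.
    by apply: hinj => //; apply: val_inj; rewrite iv jv.
  apply/allP => y /mapP[i]; rewrite mem_enum => /eqP/val_inj iv ->.
  by rewrite -iv.
rewrite big_split/= (_ : 2 * D%:R * x * _ = D%:R * (x * phi (wloc v)) + D%:R * (x * phi (wloc v))); last by ring.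
have pe i j : (wends i).1 = (wends j).1 -> (wends i).2 = (wends j).2 -> i = j.
  move=> e1 e2; apply: val_inj; rewrite -/(wends i) -/(wends j).
  by rewrite [LHS]surjective_pairing [RHS]surjective_pairing e1 e2.
apply: lerD.
- apply: (half (fun i => (wends i).1) (fun i => (wends i).2)) => // i.
  by have [] := wkey_index i.
- apply: (half (fun i => (wends i).2) (fun i => (wends i).1)) => [i j e1 e2|i]; first exact: pe.
  by rewrite adjC; have [] := wkey_index i.
Qed.

End vertex_window.

(** * Balls in a connected graph of bounded degree *)

Section balls.
Variables (V : countType) (adj : rel V) (D : nat).
Hypothesis adjC : forall u v, adj u v = adj v u.
Hypothesis conn : connected_graph adj.
Hypothesis deg : forall (v : V) (s : seq V), uniq s -> all (adj v) s -> (size s <= D)%N.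

(** The degree bound allows a duplicate-free list of neighbours of maximal length, and maximality
    forces it to contain all of them. *)
Lemma neighbor_list v : exists s : seq V, uniq s /\ forall x, (x \in s) = adj v x.
Proof.
pose Q n := `[< exists s : seq V, [/\ uniq s, all (adj v) s & size s = n] >].
have Q0 : exists n, Q n by exists 0%N; apply/asboolP; exists [::].
have QD n : Q n -> (n <= D)%N by move=> /asboolP[s [us av <-]]; exact: deg av.
case: (ex_maxnP Q0 QD) => n /asboolP[s [us av sn]] nmax.
exists s; split=> // x; apply/idP/idP; first exact: (allP av).
move=> vx; apply/negPn/negP => xs.
have : Q n.+1 by apply/asboolP; exists (x :: s); rewrite /= xs us vx av sn.
by move=> /nmax; rewrite ltnn.
Qed.

Definition neighbors (v : V) : seq V := projT1 (cid (neighbor_list v)).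

Lemma mem_neighbors v x : (x \in neighbors v) = adj v x.
Proof. by have [_ ->] := projT2 (cid (neighbor_list v)). Qed.

Lemma size_neighbors v : (size (neighbors v) <= D)%N.
Proof.
have [us h] := projT2 (cid (neighbor_list v)).
by apply: (deg us (v := v)); apply/allP => x; rewrite h.
Qed.

Variable o : V.

Fixpoint ball (r : nat) : seq V :=
  if r is r'.+1 then undup (ball r' ++ flatten [seq neighbors u | u <- ball r']) else [:: o].

Lemma ball_uniq r : uniq (ball r).
Proof. by case: r => //= r; exact: undup_uniq. Qed.

Lemma ballS r v : v \in ball r -> v \in ball r.+1.
Proof. by move=> vr; rewrite /= mem_undup mem_cat vr. Qed.

Lemma ball_mono r r' v : (r <= r')%N -> v \in ball r -> v \in ball r'.
Proof.
elim: r' => [|r' ih]; first by rewrite leqn0 => /eqP ->.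
by rewrite leq_eqVlt ltnS => /orP[/eqP ->//|/ih h /h]; exact: ballS.
Qed.

Lemma ball_adj r u v : u \in ball r -> adj u v -> v \in ball r.+1.
Proof.
move=> ur uv; rewrite /= mem_undup mem_cat; apply/orP; right.
apply/flattenP; exists (neighbors u); first exact: map_f.
by rewrite mem_neighbors.
Qed.

Lemma size_ball r : (size (ball r) <= D.+1 ^ r)%N.
Proof.
elim: r => [//|r ih]; rewrite /=; apply: leq_trans (size_undup _) _.
rewrite size_cat expnS mulSn; apply: leq_add => //.
apply: (@leq_trans (D * size (ball r))%N); last by rewrite leq_mul2l ih orbT.
elim: (ball r) => [//|u s ihs]; rewrite /= size_cat mulnS.
by apply: leq_add => //; exact: size_neighbors.
Qed.

Lemma ball_path r v : v \in ball r -> exists q : seq V,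
  [/\ path adj o q, last o q = v & all [in ball r] q].
Proof.
elim: r v => [|r ih] v /=; first by rewrite inE => /eqP ->; exists [::].
have sub (q : seq V) : all [in ball r] q -> all [in ball r.+1] q.
  by apply: sub_all => u; exact: ballS.
rewrite mem_undup mem_cat => /orP[/ih[q [q1 q2 q3]]|/flattenP[_ /mapP[u ur ->]]].
  by exists q; split=> //; exact: sub.
rewrite mem_neighbors => uv; have [q [q1 q2 q3]] := ih u ur.
exists (rcons q v); rewrite rcons_path last_rcons all_rcons q1 q2 uv; split=> //.
by apply/andP; split; [exact: ball_adj uv|exact: sub].
Qed.

Lemma mem_some_ball v : exists r, v \in ball r.
Proof.
have [q [qp <-]] := conn o v.
suff h u r : u \in ball r -> path adj u q -> exists r', last u q \in ball r'.
  by apply: (h o 0%N) => //; rewrite inE.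
elim: q u r {qp} => [|x q ih] u r ur /=; first by exists r.
by move=> /andP[ux xq]; apply: ih xq; exact: ball_adj ur ux.
Qed.

Definition dist (v : V) : nat := ex_minn (mem_some_ball v).

Lemma mem_ball r v : (v \in ball r) = (dist v <= r)%N.
Proof.
rewrite /dist; case: ex_minnP => m vm mmin; apply/idP/idP => [/mmin//|mr].
exact: ball_mono mr vm.
Qed.

Lemma dist_adj u v : adj u v -> (dist v <= (dist u).+1)%N.
Proof.
by move=> uv; rewrite -mem_ball; apply: ball_adj uv; rewrite mem_ball.
Qed.

Lemma dist_o : dist o = 0%N.
Proof. by apply/eqP; rewrite -leqn0 -mem_ball inE. Qed.

Lemma ball_infinite : (forall s : seq V, exists v, v \notin s) ->
  forall m, exists r0, forall r, (r0 <= r)%N -> (m <= size (ball r))%N.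
Proof.
move=> inf m.
have [s [us sm]] : exists s : seq V, uniq s /\ size s = m.
  elim: m => [|m [s [us sm]]]; first by exists [::].
  by have [v vs] := inf s; exists (v :: s); rewrite /= vs us sm.
exists (\max_(v <- s) dist v)%N => r sr; rewrite -sm; apply: uniq_leq_size => // v vs.
by rewrite mem_ball; apply: leq_trans sr; exact: leq_bigmax_seq.
Qed.

End balls.

(** The rate [kappa] is fixed before [eta], so the boundary mass can be made small against
    [exp (kappa t)]. A finite graph is its own window with empty boundary. In an infinite one the
    window is a ball, and the weight [phi] must decay faster than balls grow while staying
    comparable at neighbours. *)
Lemma window_exists (R : realType) (V : countType) (adj : rel V) (k : option nat) (o : V) (t : R) :
  simple_graph adj -> connected_graph adj -> bounded_degree adj -> vcard V k ->
  exists2 kappa : R, 0 <= kappa & forall eta : R, 0 < eta ->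
  exists (s0 : seq V) (phi : V -> R),
  [/\ uniq s0, o \in s0,
      (forall v : wvertex s0, exists q : seq V,
        [/\ path adj o q, last o q = wloc v & all [in s0] q]) &
      tstar k t <= (size s0)%:R ^+ 2] /\
  [/\ (forall v, 0 <= phi v), phi o = 1,
      (forall v : wvertex s0, \sum_i
        ((if (@wends V adj s0 i).1 == v then phi (wloc (wends i).2) else 0) +
         (if (wends i).2 == v then phi (wloc (wends i).1) else 0)) <= kappa * phi (wloc v)) &
      mass (phi \o @wloc V s0) (wboundary adj s0) <= eta].
Proof.
move=> [adjC adjN] conn [D deg] vk.
(* Balls of radius [r] have at most [(D + 1)^r] vertices, so the weight [x^(-r)] on the boundary
   leaves a total mass of at most [2^(-r)]. *)
pose x : R := 2 * D.+1%:R; have x1 : 1 <= x.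
  have : 1 <= D.+1%:R :> R by rewrite ler1n.
  by rewrite /x; lra.
have x0 : 0 < x by exact: lt_le_trans ltr01 x1.
exists (2 * D%:R * x); first by rewrite !mulr_ge0// ltW.
move=> eta eta0; case: k vk => [n|] /= vk.
  have [s [us sall sn]] := vk.
  exists s, (fun=> 1); split; split=> //.
  - by move=> v; have [q [q1 q2]] := conn o (wloc v); exists q; split=> //; apply/allP => y _; exact: sall.
  - by rewrite sn ge_min natrX lexx orbT.
  - move=> v; apply: (@wdegree V adj s adjC R (fun=> 1) D x (ltW x0) (fun=> ler01) deg).
    by move=> *; rewrite mulr1.
  - rewrite /mass big1 ?ltW// => v; rewrite inE => /negP[]; apply/asboolP => y _; exact: sall.
pose phi v : R := x^-1 ^+ dist conn deg o v.
have i0 : 0 <= x^-1 by rewrite invr_ge0 ltW.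
have i1 : x^-1 <= 1 by rewrite invf_le1.
have phi0 v : 0 <= phi v by exact: exprn_ge0.
have phix u v : adj u v -> phi v <= x * phi u.
  move=> uv; rewrite adjC in uv; have h := dist_adj conn deg o uv.
  rewrite -ler_pdivrMl// /phi -exprS.
  exact: ler_wiXn2l.
have [r0 hr0] := ball_infinite conn deg o vk (Num.truncn t).+1.
(* The first bound gives the ball at least [t] vertices, so that [t] is below the squared size; the
   second makes [2^(-r)] at most [eta]. *)
pose r := maxn r0 (Num.truncn eta^-1).+1.
pose s0 := ball deg o r.
exists s0, phi; split; split=> //.
- exact: ball_uniq.
- by rewrite (mem_ball conn) dist_o.
- by move=> v; apply: (ball_path (r := r)); exact: (valP v).
- have h : ((Num.truncn t).+1 <= size s0)%N by apply: hr0; exact: leq_maxl.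
  have h1 : 1 <= (size s0)%:R :> R by rewrite ler1n (leq_trans _ h).
  have h2 : t <= (size s0)%:R by rewrite (le_trans (ltW (truncnS_gt t)))// ler_nat.
  by rewrite expr2; nra.
- by rewrite /phi dist_o expr0.
- exact: (@wdegree V adj s0 adjC R phi D x (ltW x0) phi0 deg phix).
apply: (@le_trans _ _ (\sum_(v : wvertex s0) x^-1 ^+ r)).
  rewrite /mass [leRHS](bigID (mem (wboundary adj s0)))/= -[leLHS]addr0; apply: lerD.
    apply: ler_sum => v; rewrite inE => vb; apply: ler_wiXn2l => //.
    rewrite leqNgt; apply/negP => dr; case/negP: vb; apply/asboolP => y vy.
    rewrite (mem_ball conn); apply: leq_trans dr; exact: dist_adj.
  by apply: sumr_ge0 => v _; exact: exprn_ge0.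
rewrite sumr_const -[leLHS]mulr_natl.
rewrite card_wvertex; last exact: ball_uniq.
apply: (@le_trans _ _ ((D.+1 ^ r)%:R * x^-1 ^+ r)).
  by apply: ler_wpM2r; [exact: exprn_ge0|rewrite ler_nat; exact: size_ball].
rewrite natrX -exprMn /x invfM mulrCA divff ?mulr1 ?pnatr_eq0//.
have h : (Num.truncn eta^-1).+1%:R <= 2 ^+ r :> R.
  rewrite -natrX ler_nat; apply: leq_trans (ltnW (ltn_expl r (ltnSn 1))).
  exact: leq_maxr.
rewrite exprVn invf_ple ?posrE ?exprn_gt0//.
exact: le_trans (ltW (truncnS_gt _)) h.
Qed.

(** * Moments of the process *)

Lemma tstar_le (R : realType) (k : option nat) (t : R) : tstar k t <= t.
Proof. by case: k => [n|] //=; rewrite ge_min lexx. Qed.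

Lemma tstar_gt0 (R : realType) (V : countType) (k : option nat) (o : V) (t : R) :
  vcard V k -> 0 < t -> 0 < tstar k t.
Proof.
case: k => [n [s [us sall sn]]|] //= t0; rewrite lt_min t0 ltr0n expn_gt0.
by have := sall o; rewrite -sn; case: s {us sall sn}.
Qed.

Lemma EFin_powR_norm d (T : measurableType d) (R : realType) (h : T -> R) (p : R) w :
  (`|(EFin \o h) w| `^ p = (`|h w| `^ p)%:E)%E.
Proof. by []. Qed.

Lemma Lnorm_EFin d (T : measurableType d) (R : realType) (P : probability T R) (h : T -> R) (p : R) :
  (Lnorm P p%:E (EFin \o h) = (\int[P]_w (`|h w| `^ p)%:E) `^ p^-1)%E.
Proof.
rewrite unlock; congr (_ `^ _)%E; apply: eq_integral => w _; exact: EFin_powR_norm.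
Qed.

Lemma Lnorm_le_powR d (T : measurableType d) (R : realType) (P : probability T R) (h : T -> R) (p c : R) :
  0 < p -> 0 <= c -> (\int[P]_w (`|h w| `^ p)%:E <= c%:E)%E ->
  (Lnorm P p%:E (EFin \o h) <= (c `^ p^-1)%:E)%E.
Proof.
move=> p0 c0 hc; rewrite Lnorm_EFin -poweR_EFin.
apply: gt0_ler_poweR => //; first by rewrite invr_ge0 ltW.
  rewrite in_itv/= integral_ge0 ?leey// => w _; by rewrite lee_fin powR_ge0.
by rewrite in_itv/= lee_fin c0 leey.
Qed.

Lemma integrable_of_Lnorm d (T : measurableType d) (R : realType) (P : probability T R) (h : T -> R) (p : R) :
  measurable_fun setT h -> 0 < p -> (Lnorm P p%:E (EFin \o h) < +oo)%E ->
  P.-integrable setT (fun w => (`|h w| `^ p)%:E).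
Proof.
move=> mh p0 hL; apply/integrableP; split.
  apply/measurable_EFinP; apply: (measurableT_comp (measurable_powR p)).
  exact: measurableT_comp.
under eq_integral do rewrite abse_EFin (ger0_norm (powR_ge0 _ _)).
have := @powR_Lnorm _ T R P (EFin \o h) p; rewrite gt_eqF// => /(_ isT) e.
have -> : (\int[P]_w (`|h w| `^ p)%:E = Lnorm P p%:E (EFin \o h) `^ p)%E.
  by rewrite e; apply: eq_integral => w _; rewrite EFin_powR_norm.
exact: poweR_lty.
Qed.

Section process.
Context d (T : measurableType d) (R : realType) (P : probability T R).
Variables (V : countType) (adj : rel V) (k : option nat).
Variables (f0 : V -> T -> R) (tau : V * V -> nat -> T -> R) (f : R -> V -> T -> R) (mu p : R).
Hypothesis p1 : 1 <= p.
Hypothesis simple : simple_graph adj.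
Hypothesis conn : connected_graph adj.
Hypothesis deg : bounded_degree adj.
Hypothesis vk : vcard V k.
Hypothesis mf0 : forall v, measurable_fun setT (f0 v).
Hypothesis f0_id : forall u v B, measurable B -> P (f0 u @^-1` B) = P (f0 v @^-1` B).
Hypothesis intXp : forall v, P.-integrable setT (fun w => (`|f0 v w| `^ p)%:E).
Hypothesis mean : forall v, (\int[P]_w (f0 v w)%:E = mu%:E)%E.
Hypothesis mtau : forall e n, measurable_fun setT (tau e n).
Hypothesis law_tau : forall e n B, measurable B -> P (tau e n @^-1` B) = exponential_prob 1 B.
Hypothesis indep : mutually_independent P (process_indices adj)
  (fun i => match i with inl v => f0 v | inr (e, n) => tau e n end).
Hypothesis mf : forall t v, measurable_fun setT (f t v).
Hypothesis f_path : {ae P, forall w, averaging_path adj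
  (fun u v s => rings (fun e n => tau e n w) u v s) (fun v => f0 v w) (fun t v => f t v w)}.

(** Transfers a bound valid uniformly over finite connected graphs to the process: the uniformity
    lets the window grow without changing [a] and [b]. *)
Lemma process_moment (t L a b : R) (o : V) : 0 < t -> 0 <= L ->
  (forall (W I : finType) (ends : I -> W * W), (forall i, (ends i).1 != (ends i).2) ->
    (forall u v : W, connect (edge_rel ends) u v) ->
    forall pr : R, 0 <= pr <= 1 -> forall (o' : W) (M : nat),
    tstar k t <= #|W|%:R ^+ 2 -> tstar k t <= 2 * (pr * (1 - pr) ^+ #|I|.-1 * M%:R) ->
    forall (S : finType) (w x : S -> R), (forall c, 0 <= w c) -> \sum_c w c = 1 ->
      \sum_c w c * x c = 0 ->
    moment p ends pr o' M w x <= a * \sum_c w c * excess L (x c) `^ p + b) ->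
  (\int[P]_w (`|f t o w - mu| `^ p)%:E <=
    (a * fine (\int[P]_w (excess L (f0 o w - mu) `^ p)%:E) + b)%:E)%E.
Proof.
move=> t0 L0 hmom; case: (simple) => adjC adjN.
have [kappa kappa0 hw] := @window_exists R V adj k o t simple conn deg vk.
apply: integral_powR_le_truncated => //; first exact: measurable_funB.
move=> A delta A0 delta0; apply/lee_addgt0Pr => e e0.
(* The added [1] keeps the divisor positive when [A = 0]. *)
pose B := A * expR (kappa * t) + 1.
have B0 : 0 < B by rewrite ltr_wpDl// mulr_ge0// expR_ge0.
have [s0 [phi [[us os0 s0conn s0size] [phi0 phio phiP massle]]]] := hw (e / B) (divr_gt0 e0 B0).
have := @window_bound _ T R P V adj (wvertex s0) (wedge adj s0) (@wloc V s0) (@wends V adj s0)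
  (wboundary adj s0) f0 tau f adjC adjN (@wloc_inj V s0) (@wkey_inj V adj s0)
  (@wkey_index V adj s0) (@wends_cover V adj s0) (@wclosed_out V adj s0) mf0 f0_id mtau
  law_tau indep mf f_path (SeqSub os0) p mu t L t0 p1 L0 (intXp o) (mean o)
  a b (tstar k t) delta A kappa (phi \o @wloc V s0) (tstar_le k t) delta0 A0.
move=> h; apply: le_trans (h _ _ _ _ _) _ => {h} //.
- move=> pr pr01 M rate S w x w0 w1 x0; apply: hmom => //.
  + exact: wends_neq.
  + exact: (wconnect adjC adjN (o := SeqSub os0)).
  + by rewrite card_wvertex.
- by move=> v; exact: phi0.
rewrite -EFinD lee_fin lerD2l.
apply: (@le_trans _ _ (A * expR (kappa * t) * (e / B))).
  by rewrite mulrA; apply: ler_wpM2l => //; rewrite mulr_ge0// expR_ge0.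
rewrite mulrA ler_pdivrMr// mulrC ler_pM2l// /B lerDl.
exact: ler01.
Qed.

Lemma process_Lnorm (C q t : R) (o : V) : 0 < C -> 0 < t ->
  (forall (W I : finType) (ends : I -> W * W), (forall i, (ends i).1 != (ends i).2) ->
    (forall u v : W, connect (edge_rel ends) u v) ->
    forall pr : R, 0 <= pr <= 1 -> forall (o' : W) (M : nat),
    tstar k t <= #|W|%:R ^+ 2 -> tstar k t <= 2 * (pr * (1 - pr) ^+ #|I|.-1 * M%:R) ->
    forall (S : finType) (w x : S -> R), (forall c, 0 <= w c) -> \sum_c w c = 1 ->
      \sum_c w c * x c = 0 ->
    moment p ends pr o' M w x <= C * (tstar k t `^ (- q) * \sum_c w c * `|x c| `^ p)) ->
  (Lnorm P p%:E (EFin \o (fun w => (f t o w - mu)%R)) <=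
    (C `^ p^-1)%:E * Lnorm P p%:E (EFin \o (fun w => (f0 o w - mu)%R)) *
    (tstar k t `^ (- (q / p)))%:E)%E.
Proof.
move=> C0 t0 hmom; have p0 : 0 < p := lt_le_trans ltr01 p1.
have h := @process_moment t 0 (C * tstar k t `^ (- q)) 0 o t0 (lexx 0).
have e0 : (\int[P]_w (excess 0 (f0 o w - mu) `^ p)%:E = \int[P]_w (`|f0 o w - mu| `^ p)%:E)%E.
  by apply: eq_integral => w _; rewrite excess0.
have fin : (\int[P]_w (`|f0 o w - mu| `^ p)%:E \is a fin_num)%E.
  rewrite -e0; apply: integrable_fin_num => //.
  exact: (integrable_excess (mf0 o) p1 (intXp o) mu (lexx 0)).
have J0 : 0 <= fine (\int[P]_w (`|f0 o w - mu| `^ p)%:E).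
  by apply/fine_ge0/integral_ge0 => w _; rewrite lee_fin powR_ge0.
rewrite e0 in h; rewrite (Lnorm_EFin P (fun w => f0 o w - mu)) -(fineK fin) poweR_EFin -!EFinM.
move: h; set J := fine _ in J0 *; set s := tstar k t => h.
apply: (@le_trans _ _ ((C * s `^ (- q) * J) `^ p^-1)%:E).
  apply: Lnorm_le_powR => //; first by rewrite !mulr_ge0 ?powR_ge0 ?(ltW C0).
  rewrite -[X in (_ <= X%:E)%E]addr0; apply: h => W I ends e1 e2 pr pr01 o' M sM sM' S w x w0 w1 x0.
  apply: le_trans (hmom _ _ _ e1 e2 _ pr01 _ _ sM sM' _ _ _ w0 w1 x0) _.
  rewrite addr0 mulrA ler_wpM2l ?mulr_ge0 ?powR_ge0 ?(ltW C0)//.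
  by apply: ler_sum => c _; rewrite excess0.
rewrite lee_fin 2?powRM ?mulr_ge0 ?powR_ge0 ?(ltW C0)//.
by rewrite -(powRrM s) mulNr mulrAC.
Qed.

(** Choose the level first, so that the excess term is at most half of [eps^p] at the critical rate;
    then, with the level fixed, large [t] makes the clamped term small by its faster rate. *)
Lemma process_Lnorm_littleo (C eps : R) (o : V) : k = None -> p < 2 -> 0 < C -> 0 < eps ->
  (forall (W I : finType) (ends : I -> W * W), (forall i, (ends i).1 != (ends i).2) ->
    (forall u v : W, connect (edge_rel ends) u v) ->
    forall pr : R, 0 <= pr <= 1 -> forall (o' : W) (M : nat) (s : R), 0 < s ->
    s <= #|W|%:R ^+ 2 -> s <= 2 * (pr * (1 - pr) ^+ #|I|.-1 * M%:R) ->
    forall (S : finType) (w x : S -> R), (forall c, 0 <= w c) -> \sum_c w c = 1 ->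
      \sum_c w c * x c = 0 -> forall L, 0 <= L ->
    moment p ends pr o' M w x <= C * (s `^ (- ((p - 1) / 2)) * \sum_c w c * excess L (x c) `^ p +
      s `^ (- (p / 4)) * L `^ p)) ->
  exists T0 : R, forall t : R, T0 <= t ->
    (Lnorm P p%:E (EFin \o (fun w => (f t o w - mu)%R)) <=
      (eps * t `^ ((1 - p) / (2 * p)))%:E)%E.
Proof.
move=> kN p2 C0 eps0 hmom; have p0 : 0 < p := lt_le_trans ltr01 p1.
have ep0 : 0 < eps `^ p by rewrite powR_gt0.
pose J (n : nat) := fine (\int[P]_w (excess n%:R (f0 o w - mu) `^ p)%:E).
have [n hn] : exists n, C * J n <= eps `^ p / 2.
  have cvgJ : (fun n : nat => \int[P]_w (excess n%:R (f0 o w - mu) `^ p)%:E)%E @ \oo --> (0 : \bar R).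
    have [|||||_ _] := @dominated_convergence _ T R P setT measurableT
      (fun n w => (excess n%:R (f0 o w - mu) `^ p)%:E) (fun=> 0%E)
      (fun w => ((`|f0 o w| + `|mu|) `^ p)%:E).
    - move=> n; apply/measurable_EFinP/measurable_excess_powR.
      exact: measurable_funB.
    - exact: measurable_cst.
    - apply: nearW => w _; apply: cvg_near_cst; near=> n.
      rewrite /excess max_l ?powR0 ?gt_eqF// subr_le0.
      near: n; exact: nbhs_infty_ger.
    - by apply: integrable_powR_shift.
    - apply: nearW => w n _; rewrite abse_EFin lee_fin ger0_norm ?powR_ge0//.
      apply: ge0_ler_powR; rewrite ?nnegrE ?excess_ge0 ?(ltW p0) ?addr_ge0//.
      exact: le_trans (excess_le_norm _ (ler0n _ _)) (ler_normB _ _).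
    by rewrite integral0.
  have d0 : 0 < eps `^ p / 2 / C by rewrite !divr_gt0.
  have /cvgrPdist_le /(_ _ d0) [n _ /(_ n (leqnn n))] : J @ \oo --> (0 : R).
    exact: fine_cvg cvgJ.
  rewrite /= sub0r normrN => hJ; exists n.
  by rewrite mulrC -ler_pdivlMr//; exact: le_trans (ler_norm _) hJ.
(* The ratio of the two rates is [t^((2 - p) / 4)]; once it exceeds [Q] the clamped term is at most
   half of [eps^p] at the critical rate. *)
pose L : R := n%:R; pose Q := 2 * C * L `^ p / eps `^ p.
have Q0 : 0 <= Q by rewrite !mulr_ge0 ?powR_ge0 ?invr_ge0 ?(ltW C0) ?(ltW ep0).
exists (Num.max 1 (Q `^ (4 / (2 - p)))) => t; rewrite ge_max => /andP[t1 tQ].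
have t0 : 0 < t by exact: lt_le_trans ltr01 t1.
have p20 : 0 < (2 - p) / 4 by rewrite divr_gt0// subr_gt0.
have hQ : Q <= t `^ ((2 - p) / 4).
  have -> : Q = (Q `^ (4 / (2 - p))) `^ ((2 - p) / 4).
    rewrite -powRrM (_ : _ * _ = 1) ?powRr1//.
    by field; rewrite subr_eq0 gt_eqF.
  by apply: ge0_ler_powR; rewrite ?nnegrE ?powR_ge0 ?(ltW p20) ?(ltW t0).
have h := @process_moment t L (C * t `^ (- ((p - 1) / 2))) (C * t `^ (- (p / 4)) * L `^ p) o t0
  (ler0n _ _).
rewrite kN /= in h.
have {}h := h (fun W I ends e1 e2 pr pr01 o' M sM sM' S w x w0 w1 x0 =>
  le_trans (hmom W I ends e1 e2 pr pr01 o' M t t0 sM sM' S w x w0 w1 x0 L (ler0n _ _)) _).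
apply: (@le_trans _ _ ((eps `^ p * t `^ (- ((p - 1) / 2))) `^ p^-1)%:E).
  apply: Lnorm_le_powR => //; first by rewrite mulr_ge0// powR_ge0.
  apply: le_trans (h _) _ => [*|]; first by rewrite mulrDr !mulrA.
  rewrite lee_fin -/(J n).
  have -> : t `^ (- (p / 4)) = t `^ (- ((p - 1) / 2)) / t `^ ((2 - p) / 4).
    rewrite -powRN -powRD; first by congr (_ `^ _); field.
    by rewrite (gt_eqF t0) implybT.
  set a := t `^ (- _); have a0 : 0 <= a by exact: powR_ge0.
  set b := t `^ _ in hQ *; have b0 : 0 < b by rewrite powR_gt0.
  have h1 : C * L `^ p / b <= eps `^ p / 2.
    rewrite ler_pdivrMr//; move: hQ; rewrite /Q ler_pdivrMr// => hQ; lra.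
  have h2 := ler_wpM2l a0 hn; have h3 := ler_wpM2l a0 h1.
  have -> : C * (a / b) * L `^ p = a * (C * L `^ p / b) by ring.
  have -> : C * a * J n = a * (C * J n) by ring.
  lra.
rewrite lee_fin powRM ?powR_ge0 ?(ltW ep0)// -!powRrM divff ?gt_eqF// powRr1 ?(ltW eps0)//.
rewrite (_ : - ((p - 1) / 2) * p^-1 = (1 - p) / (2 * p))//.
by field; rewrite gt_eqF.
Unshelve. all: by end_near. Qed.

End process.

Theorem theorem1p3 (R : realType) (p : R) (hp : 1 <= p) :
  exists2 C : R, 0 < C &
  forall (d : measure_display) (T : measurableType d) (P : probability T R)
    (V : countType) (adj : rel V) (k : option nat)
    (f0 : V -> T -> R) (tau : V * V -> nat -> T -> R)
    (f : R -> V -> T -> R) (mu : R),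
    simple_graph adj -> connected_graph adj -> bounded_degree adj ->
    vcard V k ->
    (* i.i.d. initial opinions in L^p with mean mu *)
    (forall v, measurable_fun setT (f0 v)) ->
    (forall u v B, measurable B -> P (f0 u @^-1` B) = P (f0 v @^-1` B)) ->
    (forall v, (Lnorm P p%:E (EFin \o f0 v) < +oo)%E) ->
    (forall v, ('E_P[f0 v] = mu%:E)%E) ->
    (* rate-one Poisson clocks: i.i.d. Exp(1) inter-arrival times *)
    (forall e n, measurable_fun setT (tau e n)) ->
    (forall e n B, measurable B -> P (tau e n @^-1` B) = exponential_prob 1 B) ->
    (* the initial opinions and all clocks are mutually independent *)
    mutually_independent P (process_indices adj)
      (fun i => match i with inl v => f0 v | inr (e, n) => tau e n end) ->
    (* f is the edge-averaging process driven by these *)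
    (forall t v, measurable_fun setT (f t v)) ->
    {ae P, forall w, averaging_path adj
        (fun u v s => rings (fun e n => tau e n w) u v s)
        (fun v => f0 v w) (fun t v => f t v w)} ->
    (forall (t : R) (o : V), 0 < t ->
       (Lnorm P p%:E (EFin \o (fun w => (f t o w - mu)%R)) <=
        C%:E * Lnorm P p%:E (EFin \o (fun w => (f0 o w - mu)%R)) *
        (if p < 2 then tstar k t `^ ((1 - p) / (2 * p))
         else tstar k t `^ (- (1 / 4)))%:E)%E) /\
    (k = None -> p < 2 -> forall (o : V) (eps : R), 0 < eps ->
       exists T0 : R, forall t : R, T0 <= t ->
         (Lnorm P p%:E (EFin \o (fun w => (f t o w - mu)%R)) <=
          (eps * t `^ ((1 - p) / (2 * p)))%:E)%E).
Proof.
have p0 : 0 < p := lt_le_trans ltr01 hp; have pN0 : p != 0 by rewrite gt_eqF.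
case: (ltP p 2) => [p2|p2].
  have [C C0 hmom] := moment_bound_le2 hp (ltW p2).
  exists (C `^ p^-1); first by rewrite powR_gt0.
  move=> d T P V adj k f0 tau f mu sg cg bd vk mf0 f0_id finX mean mtau law_tau indep mf f_path.
  have intXp v := integrable_of_Lnorm (mf0 v) p0 (finX v).
  have mean' v : (\int[P]_w (f0 v w)%:E = mu%:E)%E by rewrite -(mean v) unlock.
  split=> [t o t0|kN _ o eps eps0].
    have -> : (1 - p) / (2 * p) = - ((p - 1) / 2 / p) by field.
    apply: (process_Lnorm (tau := tau) (adj := adj)) => //.
    move=> W I ends e1 e2 pr pr01 o' M sM sM' S w x w0 w1 x0.
    (* Level [0]: the excess is the absolute value and the clamped term vanishes. *)
    have := hmom W I ends e1 e2 pr pr01 o' M _ (tstar_gt0 o vk t0) sM sM' S w x w0 w1 x0 0 (lexx 0).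
    rewrite powR0// mulr0 addr0; congr (_ <= _ * (_ * _)).
    by apply: eq_bigr => c _; rewrite excess0.
  exact: (process_Lnorm_littleo hp sg cg bd vk mf0 f0_id intXp mean' mtau law_tau indep mf f_path o kN p2 C0 eps0 hmom).
have [C C0 hmom] := moment_bound_ge2 p2.
exists (C `^ p^-1); first by rewrite powR_gt0.
move=> d T P V adj k f0 tau f mu sg cg bd vk mf0 f0_id finX mean mtau law_tau indep mf f_path.
have intXp v := integrable_of_Lnorm (mf0 v) p0 (finX v).
have mean' v : (\int[P]_w (f0 v w)%:E = mu%:E)%E by rewrite -(mean v) unlock.
split=> // t o t0.
have -> : 1 / 4 = p / 4 / p by field.
apply: (process_Lnorm (tau := tau) (adj := adj)) => //.
move=> W I ends e1 e2 pr pr01 o' M sM sM' S w x w0 w1 x0.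
exact: (hmom W I ends e1 e2 pr pr01 o' M _ (tstar_gt0 o vk t0) sM sM' S w x w0 w1 x0).
Qed.
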